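(* Let $n\ge 1$ and let $\alpha:[0,1]^n\to\mathcal{P}(S)$ be a continuous function, where $\mathcal{P}(S)$ is endowed with the topology of weak convergence. Let $X:\partial[0,1]^n\to L^0(\Omega,S)$ be a continuous function, where $\partial[0,1]^n$ is the boundary of the cube and $L^0(\Omega,S)$ is endowed with the topology of convergence in probability, such that $law(X(t))=\alpha(t)$ for all $t\in\partial[0,1]^n$. Then there is a continuous map $\hat\alpha:[0,1]^n\to L^0(\Omega,S)$ such that $\hat\alpha|_{\partial[0,1]^n}=X$ and $law(\hat\alpha(t))=\alpha(t)$ for all $t\in[0,1]^n$.
   Context: $(S,d)$ is a complete separable metric space and $(\Omega,\mathcal{F},P)$ is a complete nonatomic probability space. $\mathcal{P}(S)$ is the set of probability measures on the Borel $\sigma$-algebra $\mathcal{B}(S)$. $L^0(\Omega,S)$ is the space of $S$-valued random variables on $\Omega$ (random variables that are equal almost surely are identified); the topology of convergence in probability is the one given by the metric $\rho(X,Y)=\inf\{\epsilon>0: P\{\omega: d(X(\omega),Y(\omega))\ge\epsilon\}\le\epsilon\}$. For $X\in L^0(\Omega,S)$, $law(X)\in\mathcal{P}(S)$ is the distribution of $X$, $law(X)(A)=P(X^{-1}(A))$. *)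

(* Defs.v *)
From HB Require Import structures.
From mathcomp Require Import all_boot all_order all_algebra.
From mathcomp Require Import all_classical all_reals all_analysis.
Set Implicit Arguments.
Unset Strict Implicit.
Unset Printing Implicit Defensive.
Import Order.TTheory GRing.Theory Num.Theory.
Import numFieldNormedType.Exports.
Local Open Scope classical_set_scope.
Local Open Scope ring_scope.

HB.mixin Record isSeparable T & Topological T := {
  separable : exists D : set T, countable D /\ dense D
}.

(* Measurable types are pointed in the library; no generality is lost, since a
   space carrying a probability measure is nonempty. *)
#[short(type="polishMetricType")]
HB.structure Definition PolishMetric (R : numDomainType) :=
  {S of Metric R S & Complete S & isSeparable S & isPointed S}.

Definition borel (R : numDomainType) (S : polishMetricType R) :=
  g_sigma_algebraType (@open S).

Section WeakConvergence.
Context (R : realType) (S : polishMetricType R).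

Definition bounded_continuous :=
  {f : S -> R | continuous f /\ bounded_fun f}.
HB.instance Definition _ := gen_eqMixin bounded_continuous.
HB.instance Definition _ := gen_choiceMixin bounded_continuous.

Definition integrals (mu : probability (borel S) R) :
  {ptws bounded_continuous -> R} := fun f => \int[mu]_x sval f x.

(* The coarsest topology making all the maps [mu |-> \int f dmu] continuous.
   Elements of [probability _ _] are functions on all subsets, constrained on
   measurable ones only, so equality of measures is agreement on measurable
   sets ([measure_eq] in [giry]), not [=]. *)
Definition weakProb : Type := initial_topology integrals.
HB.instance Definition _ := Topological.on weakProb.

End WeakConvergence.

Section L0.
Context d (Omega : measurableType d) (R : realType) (P : probability Omega R).
Context (S : polishMetricType R).

Definition L0 : Type := {mfun_ P, Omega >-> borel S}.
HB.instance Definition _ := Choice.on L0.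
HB.instance Definition _ := EqQuotient.on L0.

Definition law (X : L0) : probability (borel S) R := distribution P (repr X).

Definition L0_dist_ge (X Y : L0) (e : R) : set Omega :=
  [set w | e <= mdist (repr X w : S) (repr Y w : S)].

Definition L0_dist (X Y : L0) : R :=
  inf [set e : R | 0 < e /\ (P (L0_dist_ge X Y e) <= e%:E)%E].

Lemma measurable_mdist_lt (X : L0) (a : S) (r : R) :
  measurable [set w | mdist a (repr X w : S) < r].
Proof.
rewrite -[X in measurable X]setTI.
have mX : measurable_fun setT (repr X) by [].
apply: (mX measurableT [set y : S | mdist a y < r]).
rewrite -ballEmdist; apply: sub_gen_smallest => /=.
rewrite openE => y; rewrite ballEmdist /= => ayr.
apply/nbhs_ballP; exists (r - mdist a y); first by rewrite /= subr_gt0.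
move=> z; rewrite !ballEmdist /= ltrBrDl => yz.
exact: le_lt_trans (metric_triangle a y z) yz.
Qed.

Lemma measurable_L0_dist_ge X Y e : measurable (L0_dist_ge X Y e).
Proof.
rewrite -[X in measurable X]setCK; apply: measurableC.
have [D [/pfcard_geP cD dD]] := @separable _ S.
have [s sD] : exists s : nat -> S, D `<=` range s.
  case: cD => [->|/unsquash f]; first by exists (fun=> point).
  by exists f => x /(@surj _ _ _ _ f)[n _ <-]; exists n.
have -> : ~` L0_dist_ge X Y e =
    \bigcup_n \bigcup_(q : rat)
      ([set w | mdist (s n) (repr X w : S) < ratr q] `&`
       [set w | mdist (s n) (repr Y w : S) < e - ratr q]).
  apply/seteqP; split => w /=.
    move/negP; rewrite -ltNge.
    set x : S := repr X w; set y : S := repr Y w => XYe.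
    have de : 0 < (e - mdist x y) / 2 by rewrite divr_gt0// subr_gt0.
    have [||a [xa Da]] := dD (ball x ((e - mdist x y) / 2))°.
    - by exists x; exact: nbhsx_ballx.
    - exact: open_interior.
    have {}xa := interior_subset xa.
    have [q /andP[xq qe]] :
        exists q : rat, mdist x a < ratr q < (e - mdist x y) / 2.
      move: xa; rewrite ballEmdist /= => /rat_in_itvoo[q]; rewrite in_itv /=.
      by exists q.
    have [n _ sn] := sD _ Da.
    exists n => //; exists q => //; rewrite sn.
    split => /=; first by rewrite metric_sym.
    apply: le_lt_trans (metric_triangle a x y) _.
    rewrite (metric_sym a) ltrBrDr.
    have : ratr q + ratr q < e - mdist x y by rewrite [ltRHS]splitr ltrD.
    rewrite ltrBrDr; apply: le_lt_trans.
    by rewrite addrAC !lerD2r ltW.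
  move=> [n _ [q _ [/= Xq Yq]]]; apply/negP; rewrite -ltNge.
  apply: le_lt_trans (metric_triangle _ (s n : S) _) _.
  by rewrite metric_sym -(subrK (ratr q) e) addrC ltrD.
apply: bigcupT_measurable => n; apply: bigcupT_measurable_rat => q.
by apply: measurableI; exact: measurable_mdist_lt.
Qed.

Lemma L0_dist_has_inf X Y :
  has_inf [set e : R | 0 < e /\ (P (L0_dist_ge X Y e) <= e%:E)%E].
Proof.
split; last by exists 0 => e [/ltW].
by exists 1; split => //; apply: probability_le1; exact: measurable_L0_dist_ge.
Qed.

Lemma L0_dist_le X Y e : 0 < e -> (P (L0_dist_ge X Y e) <= e%:E)%E ->
  L0_dist X Y <= e.
Proof. by move=> *; apply: ge_inf => //; case: (L0_dist_has_inf X Y). Qed.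

Lemma L0_dist_lt X Y e : L0_dist X Y < e ->
  exists e', [/\ 0 < e', e' < e & (P (L0_dist_ge X Y e') <= e'%:E)%E].
Proof.
case/(inf_lt (proj1 (L0_dist_has_inf X Y))) => e' [e'0 Pe'] ee'.
by exists e'.
Qed.

Lemma L0_distxx X : L0_dist X X = 0.
Proof.
apply/eqP; rewrite eq_le; apply/andP; split.
  apply/ler_addgt0Pl => e e0; rewrite addr0; apply: L0_dist_le => //.
  rewrite (_ : L0_dist_ge X X e = set0) ?measure0 ?lee_fin ?ltW//.
  by rewrite -subset0 => w; rewrite /L0_dist_ge /= mdistxx leNgt e0.
apply: lb_le_inf; first by case: (L0_dist_has_inf X X).
by move=> e [/ltW].
Qed.

Lemma L0_dist_sym X Y : L0_dist X Y = L0_dist Y X.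
Proof.
congr inf; apply: eq_set => e; congr (_ /\ (P _ <= _)%E).
by apply: eq_set => w; rewrite metric_sym.
Qed.

Lemma L0_dist_triangle Y X Z : L0_dist X Z <= L0_dist X Y + L0_dist Y Z.
Proof.
apply/ler_addgt0Pl => e e0; rewrite addrC.
have e2 : 0 < e / 2 by rewrite divr_gt0.
have [a [a0 ae Pa]] : exists a, [/\ 0 < a, a < L0_dist X Y + e / 2 &
    (P (L0_dist_ge X Y a) <= a%:E)%E] by apply: L0_dist_lt; rewrite ltrDl.
have [b [b0 be Pb]] : exists b, [/\ 0 < b, b < L0_dist Y Z + e / 2 &
    (P (L0_dist_ge Y Z b) <= b%:E)%E] by apply: L0_dist_lt; rewrite ltrDl.
apply: (@le_trans _ _ (a + b)); last first.
  by rewrite [e]splitr addrACA lerD// ltW.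
apply: L0_dist_le; first exact: addr_gt0.
apply: (@le_trans _ _ (P (L0_dist_ge X Y a `|` L0_dist_ge Y Z b))).
  apply: le_measure; rewrite ?inE.
  - exact: measurable_L0_dist_ge.
  - by apply: measurableU; exact: measurable_L0_dist_ge.
  move=> w /= abXZ; case: (leP a (mdist (repr X w : S) (repr Y w : S))) => aXY.
    by left.
  right; rewrite /L0_dist_ge /= leNgt; apply/negP => bYZ.
  move: abXZ; rewrite /L0_dist_ge /= leNgt => /negP; apply.
  by apply: le_lt_trans (metric_triangle _ (repr Y w : S) _) _; rewrite ltrD.
rewrite EFinD; apply: le_trans (leeD Pa Pb).
by apply: measureU2; exact: measurable_L0_dist_ge.
Qed.

Lemma L0_dist_positivity X Y : L0_dist X Y = 0 -> X = Y.
Proof.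
move=> XY0.
have null e : 0 < e -> P (L0_dist_ge X Y e) = 0%E.
  move=> e0; apply/eqP; rewrite eq_le measure_ge0 andbT.
  apply/lee_addgt0Pr => r r0; rewrite add0e.
  have [|e' [e'0 + Pe']] := @L0_dist_lt X Y (Num.min e r).
    by rewrite XY0 lt_min e0.
  rewrite lt_min => /andP[e'e e'r].
  apply: le_trans (le_trans Pe' _); last by rewrite lee_fin ltW.
  apply: le_measure; rewrite ?inE; [exact: measurable_L0_dist_ge..|].
  by move=> w /=; rewrite /L0_dist_ge /=; apply: le_trans; exact: ltW.
rewrite -(reprK X) -(reprK Y); apply/eqquotP/asboolP.
apply: (@negligibleS _ _ _ _ (\bigcup_n L0_dist_ge X Y n.+1%:R^-1)); last first.
  apply: negligible_bigcup => n; apply/negligibleP.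
    exact: measurable_L0_dist_ge.
  by apply: null; rewrite invr_gt0.
move=> w /= XYw.
have : 0 < mdist (repr X w : S) (repr Y w : S).
  by rewrite mdist_gt0; apply/eqP => XY; apply: XYw => _.
move/ltr_add_invr => [n]; rewrite add0r => /ltW nXY.
by exists n.
Qed.

HB.instance Definition _ := isMetric.Build R L0
  L0_distxx L0_dist_positivity L0_dist_sym L0_dist_triangle.

End L0.

Definition nonatomic d (Omega : measurableType d) (R : realType)
    (P : probability Omega R) :=
  forall A, measurable A -> (0 < P A)%E ->
    exists B, [/\ measurable B, B `<=` A, (0 < P B)%E & (P B < P A)%E].

Definition cube (R : realType) (n : nat) : set 'rV[R]_n :=
  [set t | forall i, 0 <= t ord0 i <= 1].
Arguments cube : clear implicits.

Definition frontier (T : topologicalType) (A : set T) : set T :=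
  closure A `\` A°.

(* Main.v *)
From HB Require Import structures.
Require Import Defs.
From mathcomp Require Import all_boot all_order all_algebra.
From mathcomp Require Import all_classical all_reals all_analysis.
From mathcomp Require Import measurable_realfun giry ring lra zify.
Set Implicit Arguments.
Unset Strict Implicit.
Unset Printing Implicit Defensive.
Import Order.TTheory GRing.Theory Num.Theory.
Import numFieldNormedType.Exports.
Local Open Scope classical_set_scope.
Local Open Scope ring_scope.

(** The construction rests on a map [quantile mu : R -> S], defined for every
    law [mu] on [S], that has law [mu] at a uniform variable ([law_quantile])
    and is continuous in [mu] ([cvg_quantile]): the unit interval is cut into
    nested intervals whose lengths are the [mu]-integrals of products of
    members of partitions of unity at scales 2^-k, and [quantile mu u] is the
    limit of the centers of the pieces whose intervals contain [u].  If [V] is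
    uniform, then [t |-> quantile (alpha t) V] is a continuous lift of [alpha],
    but one that ignores [X].

    To come close to [X], part of the randomness is used to know [X] and the
    rest to draw values.  Since [P] has no atoms, there is a sequence of fair
    bits on [Omega] such that the first [m] bits determine [X x] up to a small
    error when [m] is large ([ex_generating_bits], [approx_frontier]), and the
    bits after the [m] first ones still contain independent uniform variables
    [V m] and [W m] ([ex_randomizers]).  Given a boundary point [x] and a law
    [mu], the conditional law of [X x] on each atom of the first [m] bits gives
    masses to the pieces of a partition of unity; [coupling] is a density with
    respect to [mu] that nearly reproduces these masses and averages to 1 over
    the atoms.  Drawing from the law with this density, by means of its
    quantile map at [V m], gives a variable [level] that has law [mu]
    ([law_level]), is close to [X x] as soon as [mu] is close to the law of
    [X x] ([level_close]), and depends continuously on [mu] and [X x]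
    ([cvg_level]).

    For [t] in the cube, [mu] is [alpha t] and [x] is the projection [radial t]
    of [t] from the center.  As the boundary is compact, there are parameters
    for which the error is of order 2^-k at all points close enough to the
    boundary ([ex_level]).  There remains to pass from level [k] to level
    [k + 1] when [t] approaches the boundary.  As [S] has no linear structure,
    the passage is made by switching from one to the other on an event
    independent of each, whose probability varies continuously with [t]
    ([glued]); this preserves the law ([law_glued]) and the continuity
    ([cvg_glued]).  At level 0 the density is 1, so that [X] does not enter;
    this is the level in force near the center, where [radial] is not
    continuous. *)

(** * Nonatomic probabilities: events of prescribed probability *)

(** Probabilities as real numbers, to compute with them in the field [R]. *)
Definition prob d (T : measurableType d) (R : realType)
  (P : probability T R) (A : set T) : R := fine (P A).

Section pr_theory.
Context d (T : measurableType d) (R : realType) (P : probability T R).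
Local Notation pr := (prob P).
Implicit Types A B C : set T.

Lemma prE A : measurable A -> P A = (pr A)%:E.
Proof. by move=> mA; rewrite /prob fineK// fin_num_measure. Qed.

Lemma pr_ge0 A : 0 <= pr A.
Proof. by rewrite /prob fine_ge0. Qed.

Lemma le_pr A B : measurable A -> measurable B -> A `<=` B -> pr A <= pr B.
Proof.
move=> mA mB AB; rewrite -lee_fin -!prE//.
by apply: le_measure; rewrite ?inE.
Qed.

Lemma prT : pr setT = 1.
Proof. by rewrite /prob probability_setT. Qed.

Lemma pr0 : pr set0 = 0.
Proof. by rewrite /prob measure0. Qed.

Lemma pr_le1 A : measurable A -> pr A <= 1.
Proof. by move=> mA; rewrite -prT; apply: le_pr. Qed.

Lemma prU A B : measurable A -> measurable B -> A `&` B = set0 ->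
  pr (A `|` B) = pr A + pr B.
Proof.
move=> mA mB AB; apply: EFin_inj; rewrite EFinD -!prE//; last exact: measurableU.
exact: measureU.
Qed.

Lemma prU_le A B : measurable A -> measurable B ->
  pr (A `|` B) <= pr A + pr B.
Proof.
move=> mA mB; rewrite -lee_fin EFinD -!prE//; last exact: measurableU.
exact: measureU2.
Qed.

Lemma prD A B : measurable A -> measurable B -> B `<=` A ->
  pr (A `\` B) = pr A - pr B.
Proof.
move=> mA mB BA.
have -> : pr A = pr (B `|` (A `\` B)) by rewrite setDUK.
rewrite prU//; [by rewrite addrAC subrr add0r|exact: measurableD|exact: setDIK].
Qed.

Lemma pr_split A B : measurable A -> measurable B ->
  pr A = pr (A `&` B) + pr (A `\` B).
Proof.
move=> mA mB; rewrite -prU ?setUIDK//; [exact: measurableI|exact: measurableD|].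
by rewrite -subset0 => x [[_ Bx] [_ /(_ Bx)]].
Qed.

Lemma prC A : measurable A -> pr (~` A) = 1 - pr A.
Proof. by move=> mA; rewrite -setTD prD// prT. Qed.

Lemma cvg_pr_bigcup (F : (set T)^nat) : (forall n, measurable (F n)) ->
  nondecreasing_seq F -> pr (F n) @[n --> \oo] --> pr (\bigcup_n F n).
Proof.
move=> mF ndF.
have mU := bigcupT_measurable _ mF.
have H : (P \o F) @ \oo --> (pr (\bigcup_n F n))%:E.
  by rewrite -prE//; exact: nondecreasing_cvg_mu.
exact: fine_cvg H.
Qed.

Lemma pr_bigsetU_le (I : Type) (s : seq I) (F : I -> set T) :
  (forall i, measurable (F i)) ->
  pr (\big[setU/set0]_(i <- s) F i) <= \sum_(i <- s) pr (F i).
Proof.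
move=> mF; elim: s => [|i s IH]; first by rewrite !big_nil pr0.
rewrite !big_cons; apply: le_trans (prU_le _ _) _ => //.
  exact: bigsetU_measurable.
by rewrite lerD2l.
Qed.

Lemma pr_bigsetU (I : choiceType) (s : seq I) (F : I -> set T) : uniq s ->
  (forall i, measurable (F i)) ->
  (forall i j, i != j -> F i `&` F j = set0) ->
  pr (\big[setU/set0]_(i <- s) F i) = \sum_(i <- s) pr (F i).
Proof.
move=> + mF dF; elim: s => [|i s IH]; first by rewrite !big_nil pr0.
move=> /= /andP[si us]; rewrite !big_cons prU ?IH//; first exact: bigsetU_measurable.
rewrite -subset0 => w [Fiw]; rewrite -bigcup_seq => -[j /= js Fjw].
have [ij|ij] := eqVneq i j; first by rewrite -ij in js; rewrite js in si.
by move: (dF _ _ ij); rewrite -subset0 => /(_ w); apply.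
Qed.

End pr_theory.

Lemma half_expn_lt (R : realType) (e : R) : 0 < e -> exists n, 2^-1 ^+ n < e.
Proof.
have c : (fun n => 2^-1 ^+ n : R) @ \oo --> 0.
  by apply: cvg_expr; rewrite ger0_norm ?invr_ge0// invf_lt1 ?ltr1n.
move=> e0; have /cvgrPdist_lt/(_ _ e0)[k _ /(_ k (leqnn k))/=] := c.
by rewrite sub0r normrN ger0_norm ?exprn_ge0 ?invr_ge0// => ke; exists k.
Qed.

Section sierpinski.
Context d (T : measurableType d) (R : realType) (P : probability T R).
Local Notation pr := (prob P).
Hypothesis Pna : nonatomic P.

(** Of the two parts of a proper splitting of [A], one has at most half of the
    probability of [A]. *)
Lemma nonatomic_pr (A : set T) : measurable A -> 0 < pr A ->
  exists B, [/\ measurable B, B `<=` A, 0 < pr B & pr B <= pr A / 2].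
Proof.
move=> mA A0.
have [|B [mB BA B0 BltA]] := Pna mA; first by rewrite prE// lte_fin.
have {}B0 : 0 < pr B by rewrite -lte_fin -prE.
have {}BltA : pr B < pr A by rewrite -lte_fin -!prE.
have [h|h] := leP (pr B) (pr A / 2); first by exists B.
exists (A `\` B); split; first exact: measurableD.
- by move=> x [].
- by rewrite prD// subr_gt0.
- by rewrite prD//; lra.
Qed.

Lemma nonatomic_small (A : set T) (e : R) : measurable A -> 0 < pr A -> 0 < e ->
  exists B, [/\ measurable B, B `<=` A, 0 < pr B & pr B <= e].
Proof.
move=> mA A0 e0.
have H n : exists B, [/\ measurable B, B `<=` A, 0 < pr B & pr B <= 2^-1 ^+ n].
  elim: n => [|n [B [mB BA B0 Bn]]].
    by exists A; split => //; rewrite expr0 pr_le1.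
  have [C [mC CB C0 Cn]] := nonatomic_pr mB B0.
  exists C; split => //; first exact: subset_trans BA.
  by rewrite exprS; lra.
have [n /ltW ne] := half_expn_lt e0.
have [B [mB BA B0 Bn]] := H n.
by exists B; split => //; apply: le_trans Bn ne.
Qed.

(** Greedy exhaustion: each step adjoins a subset whose probability is at least
    half of the largest one that still fits below [c].  The probabilities of the
    subsets adjoined tend to 0; if the union had probability less than [c], a
    small subset of the remainder would always fit, and bound them from below. *)
Lemma sierpinski (A : set T) (c : R) : measurable A -> 0 <= c <= pr A ->
  exists B, [/\ measurable B, B `<=` A & pr B = c].
Proof.
move=> mA /andP[c0 cA].
pose adm (B D : set T) := [/\ measurable D, D `<=` A `\` B & pr B + pr D <= c].
have step (B : set T) : exists D, measurable B -> B `<=` A -> pr B <= c ->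
    adm B D /\ forall D', adm B D' -> pr D' <= 2 * pr D.
  have [[mB [BA Bc]]|nB] := pselect (measurable B /\ B `<=` A /\ pr B <= c); last first.
    by exists set0 => mB BA Bc; exfalso; apply: nB.
  pose E := [set pr D | D in adm B].
  have adm0 : adm B set0 by split => //; rewrite pr0 addr0.
  have hE : has_sup E.
    split; first by exists (pr set0), set0.
    by exists 1 => _ [D [mD _ _] <-]; exact: pr_le1.
  have [s0|s0] := leP (sup E) 0.
    exists set0 => _ _ _; split => // D' aD'; rewrite pr0 mulr0.
    by apply: (le_trans _ s0); apply: ub_le_sup; [case: hE|exists D'].
  have [|_ [D aD <-] Ds] := @sup_adherent _ E (sup E / 2) _ hE; first by lra.
  exists D => _ _ _; split => // D' aD'.
  have : pr D' <= sup E by apply: ub_le_sup; [case: hE|exists D'].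
  by move: Ds; lra.
have [g gP] := choice step.
pose B := fix B n : set T := if n is n'.+1 then B n' `|` g (B n') else set0.
have BP n : [/\ measurable (B n), B n `<=` A & pr (B n) <= c].
  elim: n => [|n [mB BA Bc]]; first by split => //=; rewrite pr0.
  have [[mD DA Dc] _] := gP _ mB BA Bc; split => /=.
  - exact: measurableU.
  - by rewrite subUset; split => // x /DA[].
  - exact: (le_trans (prU_le P mB mD) Dc).
have mB n := let: And3 m _ _ := BP n in m.
have prS n : pr (B n.+1) = pr (B n) + pr (g (B n)).
  have [mBn BA Bc] := BP n; have [[mD DA Dc] _] := gP _ mBn BA Bc.
  by rewrite /= prU// -subset0 => x [Bx /DA[_ /(_ Bx)]].
have ndB : nondecreasing_seq B.
  by apply/nondecreasing_seqP => n; apply/subsetPset => x /= Bx; left.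
have cvB := cvg_pr_bigcup (P := P) mB ndB.
set U := \bigcup_n B n in cvB.
have mU : measurable U by exact: bigcupT_measurable.
have UA : U `<=` A by move=> x [n _]; have [_ + _] := BP n; apply.
have Uc : pr U <= c.
  rewrite -(cvg_lim (@Rhausdorff R) cvB); apply: limr_le; first by apply/cvg_ex; exists (pr U).
  by apply: nearW => n; have [] := BP n.
exists U; split => //; apply/eqP; rewrite eq_le Uc /= leNgt; apply/negP => Ultc.
have [| | |D [mD DAU D0 Dc]] := @nonatomic_small (A `\` U) (c - pr U).
- exact: measurableD.
- by rewrite prD// subr_gt0; apply: lt_le_trans cA.
- by rewrite subr_gt0.
have Dn n : pr D <= 2 * pr (g (B n)).
  have [mBn BA Bc] := BP n; have [_] := gP _ mBn BA Bc; apply; split => //.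
    by move=> x /DAU[Ax Ux]; split => // Bx; apply: Ux; exists n.
  have : pr (B n) <= pr U by apply: le_pr => // x Bx; exists n.
  by move: Dc; lra.
have : (fun n => pr (B n.+1) - pr (B n)) @ \oo --> pr U - pr U.
  by apply: cvgB => //; rewrite (cvg_shiftS (fun n => pr (B n))).
rewrite subrr => /cvgrPdist_lt/(_ (pr D / 2)) [|n _ /(_ n (leqnn n))/=]; first by lra.
rewrite sub0r normrN prS addrC addKr ger0_norm ?pr_ge0//.
by have := Dn n; lra.
Qed.

(** If [C] fills at least half of [E], then [H] is taken inside [C]; otherwise
    [E `\` H] is taken outside [C].  Either way, [C] splits at most one of the
    two halves of [E]. *)
Lemma halving (E C : set T) : measurable E -> measurable C ->
  exists H, [/\ measurable H, H `<=` E, pr H = pr E / 2 &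
    (H `<=` C \/ C `&` E `<=` H)].
Proof.
move=> mE mC; have mEC := measurableI _ _ mE mC.
have mED := measurableD mE mC.
have E0 := pr_ge0 P E.
have [h|h] := leP (pr E / 2) (pr (E `&` C)).
  have [|H [mH HEC Hc]] := @sierpinski _ (pr E / 2) mEC; first by lra.
  by exists H; split => //; [move=> x /HEC[]|left => x /HEC[]].
have [|H [mH HED Hc]] := @sierpinski _ (pr E / 2) mED.
  by have := pr_split P mE mC; lra.
exists (E `\` H); split.
- exact: measurableD.
- by move=> x [].
- by rewrite prD//; [lra|move=> x /HED[]].
- by right => x [Cx Ex]; split => // /HED[_]; apply.
Qed.

End sierpinski.

(** * Words of fair bits *)

Fixpoint bitseqs (n : nat) : seq (seq bool) :=
  if n is n'.+1 then map (cons true) (bitseqs n') ++ map (cons false) (bitseqs n')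
  else [:: [::]].

Lemma mem_bitseqs n v : (v \in bitseqs n) = (size v == n).
Proof.
elim: n v => [|n IH] [|b v] //=; rewrite mem_cat.
  by apply/negbTE; rewrite negb_or; apply/andP; split; apply/negP => /mapP[].
have inj b' : injective (@cons bool b') by move=> x y [].
rewrite eqSS -IH; case: b.
  rewrite (mem_map (inj _)) orbC; case: mapP => //= -[x _ //].
by rewrite (mem_map (inj _)); case: mapP => //= -[x _ //].
Qed.

Lemma uniq_bitseqs n : uniq (bitseqs n).
Proof.
elim: n => //= n IH; have inj b' : injective (@cons bool b') by move=> x y [].
rewrite cat_uniq !map_inj_uniq// IH andbT /=; apply/hasPn => _ /mapP[v _ ->].
by apply/mapP => -[].
Qed.

Lemma size_bitseqs n : size (bitseqs n) = (2 ^ n)%N.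
Proof. by elim: n => //= n IH; rewrite size_cat !size_map IH addnn -mul2n expnS. Qed.

Lemma count_bitseqsS (Q : pred (seq bool)) n :
  count Q (bitseqs n.+1) =
  (count (fun v => Q (true :: v)) (bitseqs n) +
   count (fun v => Q (false :: v)) (bitseqs n))%N.
Proof. by rewrite /= count_cat !count_map. Qed.

(** The latest bit comes first, so that atoms of level [n.+1] are obtained by
    consing one bit ([atom_cons]). *)
Fixpoint word (T : Type) (B : nat -> set T) (n : nat) (w : T) : seq bool :=
  if n is n'.+1 then `[< B n' w >] :: word B n' w else [::].

Lemma size_word T (B : nat -> set T) n w : size (word B n w) = n.
Proof. by elim: n => //= n ->. Qed.

Definition atom (T : Type) (B : nat -> set T) n (v : seq bool) : set T :=
  [set w | word B n w = v].

Lemma atom_cons T (B : nat -> set T) n b v :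
  atom B n.+1 (b :: v) = atom B n v `&` [set w | `[< B n w >] = b].
Proof. by apply/seteqP; split => w /=; rewrite /atom/=; [case=> <- <-|case=> -> ->]. Qed.

Lemma atom0 T (B : nat -> set T) : atom B 0 [::] = setT.
Proof. by apply/seteqP; split. Qed.

Lemma atomI T (B : nat -> set T) n u v : u != v -> atom B n u `&` atom B n v = set0.
Proof. by move=> /eqP uv; rewrite -subset0 => w [] /=; rewrite /atom/= => -> /uv. Qed.

Lemma asbool_bool_set (T : Type) (A : set T) b :
  [set w | `[< A w >] = b] = if b then A else ~` A.
Proof.
apply/seteqP; split => w /=; case: b => /=; first by move/asboolP.
- by move=> /negbT/asboolPn.
- by move=> ?; apply/asboolP.
- by move=> ?; apply/negbTE/asboolPn.
Qed.

(** On an atom that is not mixed, the bits decide whether [D] occurs. *)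
Definition mixed (T : Type) (B : nat -> set T) (D : set T) n (v : seq bool) : bool :=
  `[< (exists2 w, atom B n v w & D w) /\ (exists2 w, atom B n v w & ~ D w) >].

Lemma mixed_behead T (B : nat -> set T) D n b v :
  mixed B D n.+1 (b :: v) -> mixed B D n v.
Proof.
move=> /asboolP[[w1 + D1] [w2 + D2]]; rewrite !atom_cons => -[w1v _] [w2v _].
by apply/asboolP; split; [exists w1|exists w2].
Qed.

Lemma preimage_word (T : Type) (B : nat -> set T) (Q : pred (seq bool)) n :
  [set w | Q (word B n w)] = \big[setU/set0]_(v <- bitseqs n | Q v) atom B n v.
Proof.
rewrite -big_filter -bigcup_seq; apply/seteqP; split => w /=.
  by move=> Qw; exists (word B n w);
    rewrite /= ?mem_filter ?Qw ?mem_bitseqs /atom/= ?size_word.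
by move=> [v /=]; rewrite mem_filter mem_bitseqs /atom/= => /andP[Qv /eqP sv] ->.
Qed.

Section dyadic.
Context d (T : measurableType d) (R : realType) (P : probability T R).
Local Notation pr := (prob P).

(** The bits are fair and independent: the atoms of each level are equiprobable. *)
Definition dyadic (B : nat -> set T) :=
  (forall n, measurable (B n)) /\
  forall v, pr (atom B (size v) v) = 2^-1 ^+ size v.

Lemma measurable_atom (B : nat -> set T) n v : (forall n, measurable (B n)) ->
  measurable (atom B n v).
Proof.
move=> mB; elim: n v => [|n IH] [|b v].
- by rewrite atom0.
- by rewrite (_ : atom _ _ _ = set0)//; apply/seteqP; split.
- by rewrite (_ : atom _ _ _ = set0)//; apply/seteqP; split.
rewrite atom_cons; apply: measurableI => //.
by rewrite asbool_bool_set; case: b => //; exact: measurableC.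
Qed.

Lemma pr_word (B : nat -> set T) (Q : pred (seq bool)) n (A : set T) :
  (forall n, measurable (B n)) -> measurable A ->
  pr (A `&` [set w | Q (word B n w)]) =
  \sum_(v <- bitseqs n | Q v) pr (A `&` atom B n v).
Proof.
move=> mB mA; rewrite preimage_word -big_filter -[RHS]big_filter big_distrr/=.
apply: pr_bigsetU; first by rewrite filter_uniq// uniq_bitseqs.
  by move=> v; apply: measurableI => //; exact: measurable_atom.
by move=> u v uv; rewrite setIACA setIid atomI ?setI0.
Qed.

Lemma dyadic_word B (Q : pred (seq bool)) n : dyadic B ->
  pr [set w | Q (word B n w)] = (count Q (bitseqs n))%:R * 2^-1 ^+ n.
Proof.
move=> [mB dB]; rewrite -[X in pr X]setTI pr_word//.
rewrite big_seq_cond (eq_bigr (fun=> 2^-1 ^+ n)); last first.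
  by move=> v /andP[]; rewrite mem_bitseqs => /eqP vn _; rewrite setTI -vn dB vn.
by rewrite -big_seq_cond big_const_seq iter_addr addr0 mulr_natl.
Qed.

(** Cylinders constrain the bits at arbitrary positions, as opposed to the
    initial segments of the atoms; they separate the bits at even positions
    from those at odd positions. *)
Definition cyl (B : nat -> set T) (c : nat -> option bool) : set T :=
  [set w | forall j b, c j = Some b -> `[< B j w >] = b].

(** The condition on words that defines [cyl B c], so that the probability of a
    cylinder is a count of words ([dyadic_word]). *)
Fixpoint cylw (c : nat -> option bool) n (v : seq bool) : bool :=
  if n is n'.+1 then
    (if c n' is Some b then head false v == b else true) && cylw c n' (behead v)
  else true.

Lemma cylE B c n : (forall j, (n <= j)%N -> c j = None) ->
  cyl B c = [set w | cylw c n (word B n w)].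
Proof.
move=> cn.
have H m w : cylw c m (word B m w) <->
    forall j b, (j < m)%N -> c j = Some b -> `[< B j w >] = b.
  elim: m => [|m IH] //=; split.
    move=> /andP[cm /IH Hm] j b; rewrite ltnS leq_eqVlt => /predU1P[->|/Hm]; last exact.
    by move=> cb; move: cm; rewrite cb => /eqP.
  move=> Hm; apply/andP; split; last by apply/IH => j b jm; apply: Hm; exact: ltnW.
  by case E : (c m) => [b|//]; rewrite (Hm _ _ _ E).
apply/seteqP; split => w /=.
  by move=> cw; apply/H => j b _; exact: cw.
move/H => cw j b cj; apply: cw => //.
by rewrite ltnNge; apply/negP => /cn; rewrite cj.
Qed.

Lemma pr_cyl B c n : dyadic B -> (forall j, (n <= j)%N -> c j = None) ->
  pr (cyl B c) = \prod_(j < n) (if c j is Some _ then 2^-1 else 1).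
Proof.
move=> dB cn; rewrite (cylE B cn) dyadic_word// => {cn}.
elim: n => [|n IH]; first by rewrite big_ord0 expr0 mulr1.
rewrite big_ord_recr/= -IH count_bitseqsS/= exprS.
case: (c n) => [[]|] /=; rewrite ?count_pred0 ?addn0 ?add0n ?natrD.
- by ring.
- by ring.
- by field.
Qed.

Definition upd (c : nat -> option bool) p b : nat -> option bool :=
  fun j => if j == p then Some b else c j.

Lemma pr_cyl_upd B c n p b : dyadic B -> (forall j, (n <= j)%N -> c j = None) ->
  c p = None -> pr (cyl B (upd c p b)) = pr (cyl B c) / 2.
Proof.
move=> dB cn cp; pose N := maxn n p.+1.
have pN : (p < N)%N by rewrite leq_maxr.
have cN j : (N <= j)%N -> c j = None.
  by move=> Nj; apply: cn; apply: leq_trans Nj; rewrite leq_maxl.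
rewrite (@pr_cyl _ _ N)// ?(@pr_cyl _ c N)//; last first.
  move=> j Nj; rewrite /upd; case: eqP => [jp|_]; last exact: cN.
  by rewrite jp leqNgt pN in Nj.
rewrite (bigD1 (Ordinal pN))//= [in RHS](bigD1 (Ordinal pN))//= cp /upd eqxx mul1r mulrC.
congr (_ * _); apply: eq_bigr => j jp.
by rewrite (negbTE (_ : val j != p))//; apply: contra jp => /eqP jp; apply/eqP/val_inj.
Qed.

Lemma cyl_upd B c p b : c p = None ->
  cyl B (upd c p b) = cyl B c `&` [set w | `[< B p w >] = b].
Proof.
move=> cp; apply/seteqP; split => w /=.
  move=> H; split; last by apply: H; rewrite /upd eqxx.
  by move=> j b' cj; apply: H; rewrite /upd; case: eqP => // jp; rewrite jp cp in cj.
move=> [H1 H2] j b'; rewrite /upd; case: eqP => [-> [<-]//|_]; exact: H1.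
Qed.

Lemma measurable_cyl B c n : (forall n, measurable (B n)) ->
  (forall j, (n <= j)%N -> c j = None) -> measurable (cyl B c).
Proof.
move=> mB cn; rewrite (cylE B cn) preimage_word; apply: bigsetU_measurable => v _.
exact: measurable_atom.
Qed.

Lemma atom_cyl B v : exists2 c, (forall j, (size v <= j)%N -> c j = None) &
  atom B (size v) v = cyl B c.
Proof.
elim: v => [|b v [c cn cE]].
  exists (fun=> None) => //; rewrite atom0; apply/seteqP; split => // w _ j b //.
exists (upd c (size v) b).
  move=> j /= vj; rewrite /upd gtn_eqF//; apply: cn; exact: ltnW.
by rewrite /= atom_cons cE cyl_upd// cn.
Qed.

(** Given [A], the bits [b] are fair and independent; the equation is multiplied
    out so that [A] may be negligible. *)
Definition fair (A : set T) (b : nat -> set T) := forall v : seq bool,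
  pr (A `&` atom b (size v) v) = pr A * 2^-1 ^+ size v.

(** The conclusion provides a cylinder [c'] that leaves free the same positions as
    [c] outside the range of [pos], so that the lemma applies again to [c'] and
    to positions disjoint from [pos]. *)
Lemma cyl_fair B c n pos v : dyadic B -> (forall j, (n <= j)%N -> c j = None) ->
  injective pos -> (forall j, c (pos j) = None) ->
  exists c', [/\ exists n', forall j, (n' <= j)%N -> c' j = None,
   forall p, c p = None -> (forall j, p != pos j) -> c' p = None,
   cyl B c' = cyl B c `&` atom (B \o pos) (size v) v &
   pr (cyl B c') = pr (cyl B c) * 2^-1 ^+ size v].
Proof.
move=> dB cn posI cpos.
suff [c' [cn' _ c'P cE pE]] : exists c', [/\ exists n', forall j, (n' <= j)%N -> c' j = None,
   forall j, (size v <= j)%N -> c' (pos j) = None,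
   forall p, c p = None -> (forall j, p != pos j) -> c' p = None,
   cyl B c' = cyl B c `&` atom (B \o pos) (size v) v &
   pr (cyl B c') = pr (cyl B c) * 2^-1 ^+ size v] by exists c'.
elim: v => [|b v [c' [[n' cn'] vj c'P cE pE]]].
  by exists c; split => //; [by exists n| rewrite atom0 setIT|rewrite mulr1].
have cv := vj _ (leqnn _).
exists (upd c' (pos (size v)) b); split.
- exists (maxn n' (pos (size v)).+1) => j; rewrite geq_max => /andP[n'j pj].
  by rewrite /upd gtn_eqF// cn'.
- move=> j /= vltj; rewrite /upd; case: eqP => [/posI jv|_].
    by rewrite jv ltnn in vltj.
  by apply: vj; exact: ltnW.
- by move=> p cp pp; rewrite /upd (negbTE (pp _)); exact: c'P.
- by rewrite cyl_upd// cE -setIA /= atom_cons.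
- by rewrite (pr_cyl_upd _ dB cn')// pE /= exprS; field.
Qed.

End dyadic.

(** * Bits that decide countably many events *)

Section generating_bits.
Context d (T : measurableType d) (R : realType) (P : probability T R).
Local Notation pr := (prob P).
Hypothesis Pna : nonatomic P.
Variables (D : nat -> set T) (mD : forall i, measurable (D i)).

(** [logn 2] takes each value infinitely often, so that each event is the target
    of infinitely many levels. *)
Let target n := D (logn 2 n).

Lemma ex_half : exists half : nat -> set T -> set T, forall n E, measurable E ->
  [/\ measurable (half n E), half n E `<=` E, pr (half n E) = pr E / 2 &
    (half n E `<=` target n \/ target n `&` E `<=` half n E)].
Proof.
suff /choice[f fP] : forall nE : nat * set T, exists H : set T, measurable nE.2 ->
    [/\ measurable H, H `<=` nE.2, pr H = pr nE.2 / 2 &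
    (H `<=` target nE.1 \/ target nE.1 `&` nE.2 `<=` H)].
  by exists (fun n E => f (n, E)) => n E; exact: (fP (n, E)).
move=> [n E]; have [mE|nE] := pselect (measurable E); last by exists set0.
by have [H HP] := halving Pna mE (mD (logn 2 n)); exists H.
Qed.

(** The atoms of level [n] are halved by [halving] with respect to [target n].
    If the target is [D i], a mixed atom has at most one mixed child, so that the
    proportion of mixed atoms is halved; at the other levels it does not grow. *)
Lemma ex_generating_bits : exists2 B, dyadic P B &
  forall i e, 0 < e ->
   \forall m \near \oo, pr [set w | mixed B (D i) m (word B m w)] < e.
Proof.
have [half halfP] := ex_half.
pose node := fix node (v : seq bool) : set T := if v is b :: v' then
  (if b then half (size v') (node v') else node v' `\` half (size v') (node v'))
  else setT.
(* the word of bits of [w], computed from the tree and not from [B], which is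
   defined by means of it *)
pose hist := fix hist n w : seq bool := if n is n'.+1 then
  `[< half n' (node (hist n' w)) w >] :: hist n' w else [::].
pose B n : set T := [set w | half n (node (hist n w)) w].
have wordE n w : word B n w = hist n w by elim: n => //= n ->.
have sh n w : size (hist n w) = n by rewrite -wordE size_word.
have mnode v : measurable (node v).
  elim: v => [|[] v IH] //=; have [mH _ _ _] := halfP (size v) _ IH => //.
  exact: measurableD.
have nodeE v : node v = atom B (size v) v.
  elim: v => [|b v IH]; first by rewrite atom0.
  have [_ HE _ _] := halfP (size v) _ (mnode v).
  rewrite /= atom_cons -IH; apply/seteqP; split => w.
    case: b => [Hw|[nw Hw]]; split => //=; first exact: HE.
    - have : node v w by exact: HE.
      by rewrite IH /atom/= wordE => E; apply/asboolP; rewrite /B/= E.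
    - have : node v w by [].
      by rewrite IH /atom/= wordE => E; apply/negbTE/asboolPn; rewrite /B/= E.
  move=> [nw /=]; have := nw; rewrite {1}IH /atom/= wordE /B/= => ->.
  by case: b => [/asboolP//|/negbT/asboolPn ?]; split.
have mB n : measurable (B n).
  have -> : B n = \big[setU/set0]_(v <- bitseqs n) (atom B n v `&` half n (node v)).
    rewrite -bigcup_seq; apply/seteqP; split => w /=.
      move=> Bw; exists (word B n w) => /=; first by rewrite mem_bitseqs size_word.
      by split; rewrite // wordE.
    by move=> [v _ [/=]]; rewrite /atom/= wordE /B/= => ->.
  rewrite big_seq; apply: bigsetU_measurable => v; rewrite mem_bitseqs => /eqP <-.
  apply: measurableI; first by rewrite -nodeE.
  by have [] := halfP (size v) _ (mnode v).
have dB : dyadic P B.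
  split => // v; rewrite -nodeE; elim: v => [|b v IH] /=; first by rewrite prT expr0.
  have [mH HE Hp _] := halfP (size v) _ (mnode v).
  rewrite exprS; case: b; first by rewrite Hp IH mulrC.
  by rewrite prD// Hp IH; field.
exists B => // i e e0.
(* the probability of the union of the mixed atoms *)
pose f n : R := (count (mixed B (D i) n) (bitseqs n))%:R * 2^-1 ^+ n.
have fS n : f n.+1 <= f n /\ (target n = D i -> f n.+1 <= f n / 2).
  rewrite /f count_bitseqsS.
  have le b v : (mixed B (D i) n.+1 (b :: v) <= mixed B (D i) n v)%N.
    by case E : (mixed _ _ n.+1 _) => //; rewrite (mixed_behead E).
  split.
    rewrite exprS mulrA ler_wpM2r ?exprn_ge0// ?invr_ge0//.
    rewrite ler_pdivrMr// -natrM ler_nat muln2 -addnn leq_add//;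
      by apply: sub_count => v; exact: mixed_behead.
  move=> tn; rewrite exprS mulrCA mulrC ler_wpM2r ?invr_ge0//.
  rewrite ler_wpM2r ?exprn_ge0// ?invr_ge0// ler_nat.
  have cE (Q : pred (seq bool)) s : count Q s = (\sum_(v <- s) Q v)%N.
    by elim: s => [|v s IH]; rewrite ?big_nil// big_cons /= IH.
  rewrite !cE -big_split/= big_seq [in leqRHS]big_seq.
  apply: leq_sum => v; rewrite mem_bitseqs => /eqP vn.
  have [mH HE Hp Ht] := halfP (size v) _ (mnode v).
  have eT : node (true :: v) = half n (node v) by rewrite /= vn.
  have eF : node (false :: v) = node v `\` half n (node v) by rewrite /= vn.
  have := le true v; have := le false v.
  suff : ~~ (mixed B (D i) n.+1 (true :: v) && mixed B (D i) n.+1 (false :: v)).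
    by do 3!case: mixed.
  apply/negP => /andP[/asboolP[_ [w1 w1H nDw1]] /asboolP[[w2 w2H Dw2] _]].
  have nodeS b : node (b :: v) = atom B n.+1 (b :: v) by rewrite nodeE /= vn.
  rewrite -nodeS eT in w1H; rewrite -nodeS eF in w2H; rewrite vn in Ht.
  case: Ht => [/(_ _ w1H)|Ht]; first by rewrite tn.
  by case: w2H => nw2; apply; apply: Ht; split => //; rewrite tn.
have fle n n' : (n <= n')%N -> f n' <= f n.
  by move=> /subnK <-; elim: (n' - n)%N => [|k IH] //; apply: le_trans IH; case: (fS (k + n)%N).
have fk k : exists n, f n <= 2^-1 ^+ k.
  elim: k => [|k [n fn]].
    exists 0; rewrite /f !expr0 mulr1 (_ : 1 = 1%:R)// ler_nat.
    by apply: leq_trans (count_size _ _) _; rewrite size_bitseqs.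
  (* a level after [n] whose target is [D i] *)
  pose n' := (2 ^ i * n.*2.+1)%N.
  have nn' : (n <= n')%N.
    rewrite /n' (leq_trans (_ : n <= n.*2.+1)%N)//; first by rewrite -addnn -addSn leq_addl.
    by rewrite leq_pmull// expn_gt0.
  exists n'.+1; have [_] := fS n'.
  have -> : target n' = D i.
    rewrite /target /n' lognM ?expn_gt0// pfactorK//.
    rewrite (_ : logn 2 _ = 0)%N ?addn0//.
    by apply: logn_coprime; rewrite coprime2n/= odd_double.
  move=> /(_ erefl) fS'; rewrite exprS; have := fle _ _ nn'; lra.
have [k ke] := half_expn_lt e0.
have [n fn] := fk k; exists n => // m /= nm.
rewrite (dyadic_word _ _ dB); apply: le_lt_trans (fle _ _ nm) _.
exact: le_lt_trans fn ke.
Qed.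

End generating_bits.

(** * Dyadic values of words *)

Section binary_expansion.
Variable R : realType.

(** The first bit is the most significant one; [ex_uniform] reverses the words,
    whose first bit is the latest. *)
Fixpoint bval (v : seq bool) : R := if v is b :: v' then (b%:R + bval v') / 2 else 0.

Lemma bval_itv v : 0 <= bval v < 1.
Proof. by elim: v => [|[] v IH] /=; lra. Qed.

Lemma bval_rcons v b : bval (rcons v b) = bval v + b%:R * 2^-1 ^+ (size v).+1.
Proof. by elim: v => [|a v IH] /=; rewrite ?IH ?exprS ?expr0; lra. Qed.

Definition clamp (x : R) := Num.max 0 (Num.min 1 x).

Lemma clamp_id x : 0 <= x <= 1 -> clamp x = x.
Proof. by move=> /andP[x0 x1]; rewrite /clamp min_r// max_r. Qed.

Lemma clamp0 x : x <= 0 -> clamp x = 0.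
Proof. by move=> x0; rewrite /clamp min_r ?max_l//; apply: le_trans x0 _. Qed.

Lemma clamp1 x : 1 <= x -> clamp x = 1.
Proof. by move=> x1; rewrite /clamp min_l ?max_r. Qed.

Lemma clamp_itv x : 0 <= clamp x <= 1.
Proof. by rewrite /clamp le_max lexx/= ge_max ler01/= ge_min lexx. Qed.

Lemma clamp_cases x (Q : R -> Prop) :
  (x <= 0 -> Q 0) -> (0 <= x <= 1 -> Q x) -> (1 <= x -> Q 1) -> Q (clamp x).
Proof.
move=> h0 h h1; have [x0|/ltW x0] := leP x 0; first by rewrite clamp0//; exact: h0.
have [x1|/ltW x1] := leP x 1; first by rewrite clamp_id ?x0//; apply: h; rewrite x0.
by rewrite clamp1//; exact: h1.
Qed.

(** The first bit places the value in one of the two halves of the unit interval,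
    where the induction hypothesis is rescaled to [2 * x] or [2 * x - 1]. *)
Lemma count_bval J x :
  clamp x <= (count (fun v => bval v < x) (bitseqs J))%:R * 2^-1 ^+ J
    <= clamp x + 2^-1 ^+ J.
Proof.
elim: J x => [|J IH] x.
  rewrite /= addn0 expr0 mulr1; have := clamp_itv x.
  by have [x0|x0] := ltP 0 x; [|rewrite clamp0//]; rewrite ?mulr1n ?mulr0n; lra.
rewrite count_bitseqsS natrD mulrDl exprS.
rewrite (eq_count (a2 := fun v => bval v < 2 * x - 1)); last first.
  by move=> v /=; apply/idP/idP; lra.
rewrite [in X in _ + X](eq_count (a2 := fun v => bval v < 2 * x)); last first.
  by move=> v /=; apply/idP/idP; lra.
have e0 : 0 < 2^-1 ^+ J :> R by rewrite exprn_gt0// invr_gt0.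
have [x2|x2] := leP x 2^-1.
  rewrite [count (fun v => _ < 2 * x - 1) _](_ : _ = 0)%N; last first.
    apply/eqP; rewrite -leqn0 leqNgt -has_count; apply/hasPn => v _.
    by have := bval_itv v; rewrite -leNgt; lra.
  have := IH (2 * x).
  have -> : clamp (2 * x) = 2 * clamp x.
    pattern (clamp x); apply: clamp_cases => ?.
    - by rewrite clamp0; lra.
    - by rewrite clamp_id; lra.
    - by exfalso; lra.
  by set c := (count _ _)%:R; lra.
rewrite [count (fun v => _ < 2 * x) _](_ : _ = 2 ^ J)%N; last first.
  rewrite -size_bitseqs; apply/eqP; rewrite -all_count; apply/allP => v _.
  by have := bval_itv v; lra.
have := IH (2 * x - 1).
have -> : clamp (2 * x - 1) = 2 * clamp x - 1.
  pattern (clamp x); apply: clamp_cases => ?.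
  - by exfalso; lra.
  - by rewrite clamp_id; lra.
  - by rewrite clamp1; lra.
have : (2 ^ J)%:R * 2^-1 ^+ J = 1 :> R.
  by rewrite natrX -exprMn mulfV// expr1n.
by set c := (count _ _)%:R; rewrite mulrCA mulrA; lra.
Qed.

Lemma count_bitseqs_rev (Q : pred (seq bool)) J :
  count (fun v => Q (rev v)) (bitseqs J) = count Q (bitseqs J).
Proof.
rewrite -(count_map rev); apply/permP; apply: uniq_perm.
- by rewrite map_inj_uniq ?uniq_bitseqs//; exact: inv_inj (@revK _).
- exact: uniq_bitseqs.
move=> v; apply/mapP/idP; first by move=> [u + ->]; rewrite !mem_bitseqs size_rev.
by move=> vJ; exists (rev v); rewrite ?revK// mem_bitseqs size_rev -mem_bitseqs.
Qed.

End binary_expansion.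
Arguments clamp : clear implicits.
Arguments bval : clear implicits.

(** * Uniform variables read off the bits *)

Lemma measurable_lt_cst d (T : measurableType d) (R : realType) (f : T -> R) y :
  measurable_fun setT f -> measurable [set w | f w < y].
Proof.
move=> mf; have := mf measurableT `]-oo, y[%classic (measurable_itv _).
by rewrite setTI (_ : _ @^-1` _ = [set w | f w < y])//; apply/seteqP; split => w /=; rewrite in_itv.
Qed.

Section uniform.
Context d (T : measurableType d) (R : realType) (P : probability T R).
Local Notation pr := (prob P).

(** Uniformity on the unit interval given [A], multiplied out so that [A] may be
    negligible. *)
Definition uniform_on (A : set T) (V : T -> R) :=
  forall a b, 0 <= a -> a <= b -> b <= 1 ->
    pr (A `&` [set w | a <= V w < b]) = pr A * (b - a).

(** The variable with binary digits [b]. *)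
Lemma ex_uniform (b : nat -> set T) : (forall j, measurable (b j)) ->
  exists V : T -> R, [/\ measurable_fun setT V, forall w, 0 <= V w < 1 &
    forall A, measurable A -> fair P A b -> uniform_on A V].
Proof.
move=> mb.
pose x J w := bval R (rev (word b J w)).
have xS J w : x J.+1 w = x J w + (`[< b J w >])%:R * 2^-1 ^+ J.+1.
  by rewrite /x /= rev_cons bval_rcons size_rev size_word.
have x01 J w : 0 <= x J w < 1 by exact: bval_itv.
have e0 J : 0 < 2^-1 ^+ J :> R by rewrite exprn_gt0// invr_gt0.
have ndx w : nondecreasing_seq (x ^~ w).
  by apply/nondecreasing_seqP => J; rewrite xS lerDl mulr_ge0// ltW.
have nix w : nonincreasing_seq (fun J => x J w + 2^-1 ^+ J).
  apply/nonincreasing_seqP => J; rewrite xS exprS; have := e0 J.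
  by case: `[< b J w >]; rewrite ?mulr1n ?mulr0n; lra.
have cx w : cvgn (x ^~ w).
  apply: nondecreasing_is_cvgn => //; exists 1 => _ [J _ <-].
  by have /andP[_ /ltW] := x01 J w.
pose V0 w := limn (x ^~ w).
have xV J w : x J w <= V0 w by apply: nondecreasing_cvgn_le.
have Vx J w : V0 w <= x J w + 2^-1 ^+ J.
  apply: limr_le => //; exists J => // J' /= JJ'.
  have := nix w _ _ JJ'; have := e0 J'; lra.
have mx J : measurable_fun setT (x J).
  elim: J => [|J IH].
    by rewrite (_ : x 0%N = cst 0)//; exact: measurable_cst.
  rewrite (_ : x J.+1 = x J \+ (fun w => \1_(b J) w * 2^-1 ^+ J.+1)).
    apply: measurable_funD => //; apply: measurable_funM => //.
  apply/funext => w; rewrite xS/= indicE (_ : (w \in b J) = `[< b J w >])//.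
have mV0 : measurable_fun setT V0.
  apply: (measurable_fun_cvg (fun J => mx J)) => w _; exact: cx.
(* all digits may be 1, but only on an event that is negligible given [A] *)
pose V w := if V0 w < 1 then V0 w else 0.
have V00 w : 0 <= V0 w by apply: le_trans (xV 0%N w); have /andP[] := x01 0%N w.
have mV : measurable_fun setT V.
  apply: measurable_fun_ifT => //.
  by apply: measurable_fun_ltr => //; exact: measurable_cst.
exists V; split => //.
- by move=> w; rewrite /V; case: ifPn => [->|_]; rewrite ?V00// lexx ltr01.
move=> A mA fA.
have mlt y : measurable [set w | V0 w < y].
  exact: measurable_lt_cst.
have prx J y : clamp R y * pr A <= pr (A `&` [set w | x J w < y]) <= (clamp R y + 2^-1 ^+ J) * pr A.
  rewrite (pr_word _ (fun v => bval R (rev v) < y))//.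
  rewrite big_seq_cond (eq_bigr (fun=> pr A * 2^-1 ^+ J)); last first.
    by move=> v /andP[]; rewrite mem_bitseqs => /eqP {1 2}<- _; exact: fA.
  rewrite -big_seq_cond big_const_seq iter_addr addr0 (count_bitseqs_rev (fun v => bval R v < y)).
  set c := count _ _.
  have -> : (pr A * 2^-1 ^+ J) *+ c = (c%:R * 2^-1 ^+ J) * pr A.
    by rewrite -mulr_natl mulrCA mulrC.
  by have /andP[h1 h2] := count_bval J y; rewrite !ler_wpM2r ?pr_ge0.
have mAx J y : measurable (A `&` [set w | x J w < y]).
  apply: measurableI => //.
  exact: measurable_lt_cst.
have pV0 y : 0 <= y <= 1 -> pr (A `&` [set w | V0 w < y]) = pr A * y.
  move=> y01; have mAV := measurableI _ _ mA (mlt y).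
  have A1 : pr A <= 1 by exact: pr_le1.
  have A0 := pr_ge0 P A.
  apply/eqP; rewrite eq_le; apply/andP; split; apply/ler_addgt0Pr => e /half_expn_lt[J Je].
    have /andP[_] := prx J y; rewrite clamp_id// => h.
    apply: (@le_trans _ _ (pr (A `&` [set w | x J w < y]))).
      apply: le_pr => // w [Aw Vy]; split => //=; exact: le_lt_trans (xV J w) Vy.
    apply: le_trans h _; rewrite mulrDl mulrC lerD2l (le_trans _ (ltW Je))//.
    by have := e0 J; nra.
  have /andP[+ _] := prx J (y - 2^-1 ^+ J).
  have yJ : y - 2^-1 ^+ J <= clamp R (y - 2^-1 ^+ J).
    by have := e0 J; pattern (clamp R (y - 2^-1 ^+ J)); apply: clamp_cases; lra.
  have : pr (A `&` [set w | x J w < y - 2^-1 ^+ J]) <= pr (A `&` [set w | V0 w < y]).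
    apply: le_pr => // w [Aw xy]; split => //=; have := Vx J w.
    by move: xy => /=; lra.
  by have := e0 J; nra.
have pA1 : pr (A `&` [set w | ~ V0 w < 1]) = 0.
  have := pr_split P mA (mlt 1); rewrite pV0 ?lexx ?ler01// mulr1.
  by rewrite setDE (_ : ~` [set w | V0 w < 1] = [set w | ~ V0 w < 1])//; lra.
have mge : measurable [set w | ~ V0 w < 1].
  by rewrite (_ : [set w | _] = ~` [set w | V0 w < 1])//; exact: measurableC.
have mVlt y : measurable [set w | V w < y].
  exact: measurable_lt_cst.
have pV y : 0 <= y <= 1 -> pr (A `&` [set w | V w < y]) = pr A * y.
  move=> y01; rewrite -(pV0 _ y01).
  have mA1 := measurableI _ _ mA (mlt y); have mA2 := measurableI _ _ mA (mVlt y).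
  have mA3 := measurableI _ _ mA mge.
  apply/eqP; rewrite eq_le; apply/andP; split.
    have : pr (A `&` [set w | V w < y]) <=
        pr ((A `&` [set w | V0 w < y]) `|` (A `&` [set w | ~ V0 w < 1])).
      apply: le_pr => //; first exact: measurableU.
      move=> w [Aw]; rewrite /= /V; case: ifPn => [V1 Vy|/negP nV _]; [by left|by right].
    by have := prU_le P mA1 mA3; lra.
  apply: le_pr => // w [Aw] /= Vy; split => //=; rewrite /V.
  have -> : V0 w < 1 by apply: lt_le_trans Vy _; case/andP: y01.
  by [].
move=> a c a0 ac c1.
rewrite (_ : [set w | _] = [set w | V w < c] `\` [set w | V w < a]); last first.
  apply/seteqP; split => w /=; first by move=> /andP[aV ->]; split => //; apply/negP; rewrite -leNgt.
  by move=> [-> /negP]; rewrite -leNgt => ->.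
rewrite (_ : _ `&` _ = (A `&` [set w | V w < c]) `\` (A `&` [set w | V w < a])); last first.
  by apply/seteqP; split => w /=; [move=> [Aw [h1 h2]]; split=> // -[]|
    move=> [[Aw h1] h2]; do 2!split => //; move=> h3; exact: h2].
rewrite prD ?pV//; [lra|by rewrite a0 (le_trans ac)|by rewrite c1 (le_trans a0)| | |].
- exact: measurableI.
- exact: measurableI.
- by move=> w [Aw /= Va]; split => //=; exact: lt_le_trans Va ac.
Qed.

End uniform.

Section independent_uniforms.
Context d (T : measurableType d) (R : realType) (P : probability T R).
Local Notation pr := (prob P).

(** [V m] reads the bits at even positions from [2 * m] on, and [W m'] those at
    odd positions from [2 * m' + 1] on.  These positions are disjoint, and as
    [m <= m'] they avoid the [m] bits that determine an atom of level [m]. *)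
Lemma ex_randomizers (B : nat -> set T) : dyadic P B ->
  exists V W : nat -> T -> R,
  [/\ forall m, measurable_fun setT (V m) /\ measurable_fun setT (W m),
      forall m w, 0 <= V m w < 1 /\ 0 <= W m w < 1 &
      forall m m' v th, size v = m -> (m <= m')%N -> 0 <= th <= 1 ->
        pr (atom B m v `&` [set w | W m' w < th]) = 2^-1 ^+ m * th /\
        uniform_on P (atom B m v `&` [set w | W m' w < th]) (V m)].
Proof.
move=> dB; have [mB _] := dB.
pose vp m j := (2 * (m + j))%N; pose wp m j := (2 * (m + j)).+1.
have [V VP] := choice (fun m => ex_uniform P (fun j => mB (vp m j))).
have [W WP] := choice (fun m => ex_uniform P (fun j => mB (wp m j))).
exists V, W; split.
- by move=> m; split; [have [] := VP m|have [] := WP m].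
- by move=> m w; split; [have [_ + _] := VP m|have [_ + _] := WP m]; apply.
move=> m m' v th vm mm' th01.
have [mV V01 VU] := VP m; have [mW W01 WU] := WP m'.
have [c cn cE] := atom_cyl B v; rewrite vm in cn cE.
have vpI k : injective (vp k) by move=> i j; rewrite /vp; lia.
have wpI k : injective (wp k) by move=> i j; rewrite /wp; lia.
have cV j : c (vp m j) = None by apply: cn; rewrite /vp; lia.
have cW j : c (wp m' j) = None by apply: cn; rewrite /wp; lia.
have WE a : [set w | 0 <= W m' w < a] = [set w | W m' w < a].
  by apply/seteqP; split => w /=; have /andP[-> _] := W01 w.
have [th0 th1] := andP th01.
have mAv : measurable (atom B m v) by exact: measurable_atom.
have mWth : measurable [set w | W m' w < th].
  exact: measurable_lt_cst.
have pE : pr (atom B m v `&` [set w | W m' w < th]) = 2^-1 ^+ m * th.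
  rewrite -WE (WU _ mAv) ?subr0//; last first.
    by move=> u; have [c' [_ _ E ]] := cyl_fair u dB cn (wpI m') cW; rewrite cE E.
  by have [_ /(_ v)] := dB; rewrite vm => ->.
split=> //; apply: VU; first exact: measurableI.
move=> u; rewrite pE -setIA (setIC [set w | _]) setIA.
have [c' [[n' c'n] c'P c'E pc']] := cyl_fair u dB cn (vpI m) cV.
have c'E' : cyl B c `&` atom (fun j => B (vp m j)) (size u) u = cyl B c' by rewrite c'E.
rewrite cE c'E' -WE (WU (cyl B c')) ?subr0//; last 2 first.
- exact: (measurable_cyl mB c'n).
- move=> u'; have [|c'' [_ _ E]] := cyl_fair u' dB c'n (wpI m') _; last by rewrite E.
  by move=> j; apply: c'P => // i; apply/eqP; rewrite /vp /wp; lia.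
by rewrite pc' -cE; have [_ /(_ v)] := dB; rewrite vm => ->; rewrite mulrAC.
Qed.

End independent_uniforms.

(** * Bounded measurable functions *)

Lemma bounded_funE (T : Type) (R : realType) (f : T -> R) :
  bounded_fun f <-> exists M, forall x, `|f x| <= M.
Proof.
split; first by move=> [M [_ HM]]; exists (M + 1) => x; apply: HM => //; rewrite ltrDl.
by move=> [M HM]; exists M; split; [exact: num_real|move=> y My x _; apply: le_trans (HM x) (ltW My)].
Qed.

Section bounded_measurable.
Context d (T : measurableType d) (R : realType).

(** A class of functions integrable with respect to every probability measure and
    stable under the algebraic operations. *)
Definition bmf (f : T -> R) := measurable_fun setT f /\ exists M, forall x, `|f x| <= M.

Lemma bmf_cst c : bmf (fun=> c).
Proof. by split; [exact: measurable_cst|exists `|c|]. Qed.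

Lemma bmfD f g : bmf f -> bmf g -> bmf (fun x => f x + g x).
Proof.
move=> [mf [M HM]] [mg [N HN]]; split; first exact: measurable_funD.
by exists (M + N) => x; apply: le_trans (ler_normD _ _) _; apply: lerD.
Qed.

Lemma bmfM f g : bmf f -> bmf g -> bmf (fun x => f x * g x).
Proof.
move=> [mf [M HM]] [mg [N HN]]; split; first exact: measurable_funM.
by exists (M * N) => x; rewrite normrM ler_pM.
Qed.

Lemma bmfZ c f : bmf f -> bmf (fun x => c * f x).
Proof. by move=> bf; apply: bmfM => //; exact: bmf_cst. Qed.

Lemma bmfB f g : bmf f -> bmf g -> bmf (fun x => f x - g x).
Proof.
move=> bf bg; have := bmfD bf (bmfZ (-1) bg).
by under eq_fun do rewrite mulN1r.
Qed.

Lemma bmf_sum (I : Type) (s : seq I) (f : I -> T -> R) : (forall i, bmf (f i)) ->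
  bmf (fun x => \sum_(i <- s) f i x).
Proof.
move=> bf; elim: s => [|i s IH].
  by under eq_fun do rewrite big_nil; exact: bmf_cst.
by under eq_fun do rewrite big_cons; exact: bmfD.
Qed.

Lemma bmf_indic A : measurable A -> bmf (\1_A).
Proof.
move=> mA; split; first exact: measurable_indic.
by exists 1 => x; rewrite indicE; case: (_ \in _); rewrite ?normr1 ?normr0.
Qed.

Lemma bmf01 (f : T -> R) : measurable_fun setT f -> (forall x, 0 <= f x <= 1) -> bmf f.
Proof. by move=> mf f01; split => //; exists 1 => x; have /andP[? ?] := f01 x; rewrite ger0_norm. Qed.

Variable mu : probability T R.

Lemma bmf_integrable f : bmf f -> mu.-integrable setT (EFin \o f).
Proof.
move=> [mf bf]; apply: measurable_bounded_integrable => //.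
  exact: le_lt_trans (probability_le1 mu measurableT) (ltry 1).
exact/bounded_funE.
Qed.

Lemma RintD f g : bmf f -> bmf g ->
  \int[mu]_x (f x + g x) = \int[mu]_x f x + \int[mu]_x g x.
Proof. by move=> bf bg; apply: RintegralD => //; exact: bmf_integrable. Qed.

Lemma RintZ c f : bmf f -> \int[mu]_x (c * f x) = c * \int[mu]_x f x.
Proof. by move=> bf; apply: RintegralZl => //; exact: bmf_integrable. Qed.

Lemma RintB f g : bmf f -> bmf g ->
  \int[mu]_x (f x - g x) = \int[mu]_x f x - \int[mu]_x g x.
Proof. by move=> bf bg; apply: RintegralB => //; exact: bmf_integrable. Qed.

Lemma Rint_cst c : \int[mu]_x c = c.
Proof. by rewrite Rintegral_cst// -[fine _]/(prob mu setT) prT mulr1. Qed.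

Lemma le_Rint f g : bmf f -> bmf g -> (forall x, f x <= g x) ->
  \int[mu]_x f x <= \int[mu]_x g x.
Proof. by move=> bf bg fg; apply: le_Rintegral => //; exact: bmf_integrable. Qed.

Lemma Rint_sum (I : Type) (s : seq I) (f : I -> T -> R) : (forall i, bmf (f i)) ->
  \int[mu]_x (\sum_(i <- s) f i x) = \sum_(i <- s) \int[mu]_x f i x.
Proof.
move=> bf; elim: s => [|i s IH].
  rewrite big_nil -[RHS](Rint_cst 0); apply: eq_Rintegral => x _; exact: big_nil.
rewrite big_cons -IH -RintD//; last exact: bmf_sum.
by apply: eq_Rintegral => x _; rewrite big_cons.
Qed.

Lemma Rint_indic A : measurable A -> \int[mu]_x (\1_A x) = prob mu A.
Proof. by move=> mA; rewrite /Rintegral integral_indic// setIT. Qed.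

Lemma Rint_ge0 (f : T -> R) : (forall x, 0 <= f x) -> 0 <= \int[mu]_x f x.
Proof. by move=> f0; apply: Rintegral_ge0. Qed.

Lemma cvg_Rint (f_ : nat -> T -> R) (f : T -> R) M : (forall n, measurable_fun setT (f_ n)) ->
  measurable_fun setT f -> (forall n x, `|f_ n x| <= M) ->
  (forall x, f_ n x @[n --> \oo] --> f x) ->
  \int[mu]_x f_ n x @[n --> \oo] --> \int[mu]_x f x.
Proof.
move=> mf_ mf fM cf.
have [|||||_ _ H] := @dominated_convergence _ _ _ mu setT measurableT
  (fun n => EFin \o f_ n) (EFin \o f) (cst M%:E).
- by move=> n; exact/measurable_EFinP.
- exact/measurable_EFinP.
- by apply: aeW => x _ /=; apply: cvg_EFin; [exact: nearW|exact: cf].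
- by apply: bmf_integrable; exact: bmf_cst.
- by apply: aeW => x n _ /=; rewrite lee_fin.
have bf : bmf f.
  split => //; exists M => x.
  have /cvg_norm cn := cf x; rewrite -(cvg_lim (@Rhausdorff R) cn).
  by apply: limr_le; [apply/cvg_ex; exists (`|f x|)|apply: nearW => n; exact: fM].
apply: fine_cvg; rewrite fineK//.
by apply: (@integrable_fin_num _ _ _ mu) => //; exact: bmf_integrable.
Qed.

End bounded_measurable.

(** * Borel sets and partitions of unity of a Polish space *)

Section polish.
Context (R : realType) (S : polishMetricType R).
Implicit Types (x y z : S) (U : set S).

Lemma ex_dense_seq : exists s : nat -> S, forall y e, 0 < e -> exists n, mdist (s n) y < e.
Proof.
have [D [/pfcard_geP cD dD]] := @separable _ S.
have [s sD] : exists s : nat -> S, D `<=` range s.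
  case: cD => [->|/unsquash f]; first by exists (fun=> point).
  by exists f => x /(@surj _ _ _ _ f)[n _ <-]; exists n.
exists s => y e e0; have [||a [ya Da]] := dD (ball y e)°.
- by exists y; exact: nbhsx_ballx.
- exact: open_interior.
have [n _ sn] := sD _ Da; exists n; rewrite sn.
by move: (interior_subset ya); rewrite ballEmdist /= metric_sym.
Qed.

Lemma nbhs_mdist x e : 0 < e -> \forall y \near x, mdist x y < e.
Proof. by move=> e0; apply/nbhs_ballP; exists e => //= y; rewrite ballEmdist. Qed.

Lemma open_mdistP U : open U <-> forall x, U x -> exists2 e, 0 < e & forall y, mdist x y < e -> U y.
Proof.
rewrite openE; split => H x Ux.
  have /nbhs_ballP[e e0 eU] := H x Ux; exists e => // y; move: (eU y).
  by rewrite ballEmdist.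
have [e e0 eU] := H x Ux; apply/nbhs_ballP; exists e => // y.
by rewrite ballEmdist; exact: eU.
Qed.

Lemma open_borel U : open U -> measurable (U : set (borel S)).
Proof. exact: sub_gen_smallest. Qed.

Lemma continuous_borel (f : S -> R) : continuous f ->
  measurable_fun setT (f : borel S -> R).
Proof.
move=> cf; apply: (measurability _ (RGenOInfty.measurableE R)) => //.
move=> _ [_ [a ->] <-]; rewrite setTI; apply: open_borel.
by apply: open_comp => //; move=> x _; exact: cf.
Qed.

Lemma lipschitz_continuous (f : S -> R) k :
  (forall x y, `|f x - f y| <= k * mdist x y) -> continuous f.
Proof.
move=> fk x; apply/cvgrPdist_lt => e e0.
have k0 : 0 < `|k| + 1 by rewrite ltr_wpDl.
near=> y; have d : mdist x y < e / (`|k| + 1).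
  by near: y; apply: nbhs_mdist; rewrite divr_gt0.
apply: le_lt_trans (fk _ _) _; apply: (@le_lt_trans _ _ ((`|k| + 1) * mdist x y)).
  by rewrite ler_wpM2r ?mdist_ge0// (le_trans (ler_norm k))// lerDl.
by rewrite mulrC -ltr_pdivlMr.
Unshelve. all: by end_near. Qed.

Lemma lipschitz_mdist z x y : `|mdist z x - mdist z y| <= 1 * mdist x y.
Proof.
rewrite mul1r ler_norml; have := metric_triangle z x y; have := metric_triangle z y x.
by rewrite (metric_sym y x); lra.
Qed.

(** Closed sets that exhaust an open set and keep a margin inside it. *)
Definition erosion U (e : R) : set S := [set y | forall z, mdist y z < e -> U z].

Lemma open_erosionC U e : open (~` erosion U e).
Proof.
apply/open_mdistP => y /existsNP[z /not_implyP[yz Uz]].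
exists (e - mdist y z) => [|y' yy'] /=; first by rewrite subr_gt0.
apply/existsNP; exists z; apply/not_implyP; split => //.
by apply: le_lt_trans (metric_triangle _ y _) _; rewrite (metric_sym y'); lra.
Qed.

Lemma measurable_erosion U e : measurable (erosion U e : set (borel S)).
Proof.
rewrite -[erosion U e]setCK; apply: measurableC; apply: open_borel.
exact: open_erosionC.
Qed.

Lemma erosion_sub U e : 0 < e -> erosion U e `<=` U.
Proof. by move=> e0 y; apply; rewrite mdistxx. Qed.

Lemma bigcup_erosion U : open U -> \bigcup_k erosion U (2 * 2^-1 ^+ k) = U.
Proof.
move=> oU; apply/seteqP; split => y.
  by move=> [k _]; apply: erosion_sub; rewrite mulr_gt0// exprn_gt0// invr_gt0.
move=> Uy; have [e e0 eU] := (open_mdistP U).1 oU y Uy.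
have [|k ke] := @half_expn_lt R (e / 2); first by rewrite divr_gt0.
by exists k => // z yz; apply: eU; apply: lt_trans yz _; lra.
Qed.

Lemma nd_erosion U : nondecreasing_seq (fun k => erosion U (2 * 2^-1 ^+ k)).
Proof.
apply/nondecreasing_seqP => k; apply/subsetPset => y Uy z yz; apply: Uy.
apply: lt_le_trans yz _; rewrite exprS.
by have : 0 <= 2^-1 ^+ k :> R by [rewrite exprn_ge0// invr_ge0|]; lra.
Qed.

(** The inequality on open sets becomes the opposite one on closed sets by taking
    complements, hence also on open sets, which are increasing unions of the
    closed sets [erosion U e].  Open sets form a pi-system generating the Borel
    sets. *)
Lemma open_le_measure_eq (m1 m2 : {measure set (borel S) -> \bar R}) :
  (m1 setT < +oo)%E -> m1 setT = m2 setT ->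
  (forall U : set S, open U -> m1 U <= m2 U)%E ->
  forall B, measurable B -> m1 B = m2 B.
Proof.
move=> fin1 eqT leU.
have eqU (U : set S) : open U -> m1 U = m2 U.
  move=> oU; apply/eqP; rewrite eq_le leU//=.
  have leC k : (m2 (erosion U (2 * 2^-1 ^+ k) : set (borel S)) <= m1 U)%E.
    set C : set (borel S) := erosion U _.
    have mC : measurable C by exact: measurable_erosion.
    apply: (@le_trans _ _ (m1 C)); last first.
      apply: le_measure; rewrite ?inE//; first exact: open_borel.
      by apply: erosion_sub; rewrite mulr_gt0// exprn_gt0// invr_gt0.
    have oC : open (~` C : set S) by exact: open_erosionC.
    have h (m : {measure set (borel S) -> \bar R}) : m setT = (m C + m (~` C))%E.
      by rewrite -measureU ?setUv ?setICr//; exact: measurableC.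
    have fin2 : (m2 setT < +oo)%E by rewrite -eqT.
    have f (m : {measure set (borel S) -> \bar R}) A : (m setT < +oo)%E ->
        measurable A -> m A \is a fin_num.
      move=> mT mA; rewrite ge0_fin_numE//; apply: le_lt_trans mT.
      by apply: le_measure; rewrite ?inE.
    have := leU _ oC; have := eqT; rewrite !h.
    have mC' := measurableC mC.
    rewrite -(fineK (f m1 C fin1 mC)) -(fineK (f m2 C fin2 mC)).
    rewrite -(fineK (f m1 _ fin1 mC')) -(fineK (f m2 _ fin2 mC')).
    by rewrite -!EFinD !lee_fin => -[]; lra.
  have mI k : measurable (erosion U (2 * 2^-1 ^+ k) : set (borel S)) by exact: measurable_erosion.
  have : (m2 \o (fun k => erosion U (2 * 2^-1 ^+ k))) @ \oo --> m2 (\bigcup_k (erosion U (2 * 2^-1 ^+ k))).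
    apply: nondecreasing_cvg_mu => //; [exact: bigcupT_measurable|exact: nd_erosion].
  rewrite bigcup_erosion// => /cvg_lim <-//.
  apply: lime_le; first by apply: ereal_nondecreasing_is_cvgn => m n mn;
    apply: le_measure; rewrite ?inE//; apply/subsetPset; exact: nd_erosion.
  by apply: nearW => k; exact: leC.
move=> B mB; apply: (@g_sigma_algebra_measure_unique _ R (borel S) (@open S) _ (fun=> setT)) => //.
- exact: open_borel.
- by move=> _; exact: openT.
- by apply/seteqP; split => // x _; exists 0%N.
- by move=> U V; exact: openI.
Qed.

Variable s : nat -> S.
Hypothesis sP : forall y e, 0 < e -> exists n, mdist (s n) y < e.

(** Equal to 1 within distance [e / 2] of [s n], and to 0 beyond [e]. *)
Definition bump (e : R) n y : R := clamp R (2 - 2 * mdist (s n) y / e).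

Fixpoint bumps (e : R) n y : R :=
  if n is n'.+1 then Num.max (bumps e n' y) (bump e n' y) else 0.

(** The increments of the running maxima [bumps] form a partition of unity, as
    every point lies within [e / 2] of some [s n]; the increment of index [n]
    vanishes outside the ball of radius [e] around [s n]. *)
Definition punity e n y := bumps e n.+1 y - bumps e n y.

Lemma bumps_itv e n y : 0 <= bumps e n y <= 1.
Proof.
elim: n => [|n /andP[IH0 IH1]] /=; first by rewrite lexx ler01.
by have /andP[b0 b1] := clamp_itv (2 - 2 * mdist (s n) y / e); rewrite le_max IH0 ge_max IH1.
Qed.

Lemma nd_bumps e y : nondecreasing_seq (bumps e ^~ y).
Proof. by apply/nondecreasing_seqP => n /=; rewrite le_max lexx. Qed.

Lemma bumps_eq1 e y : 0 < e -> exists n, forall m, (n <= m)%N -> bumps e m y = 1.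
Proof.
move=> e0; have [|n sn] := sP y (e := e / 2); first by rewrite divr_gt0.
exists n.+1 => m nm; apply/eqP; rewrite eq_le; have /andP[_ ->] /= := bumps_itv e m y.
apply: le_trans (nd_bumps e y nm); rewrite /= le_max; apply/orP; right.
rewrite /bump clamp1// lerBrDr addrC -lerBrDr ler_pdivrMr//; lra.
Qed.

Lemma punity_itv e n y : 0 <= punity e n y <= 1.
Proof.
rewrite /punity subr_ge0; have := nd_bumps e y (leqnSn n) => ->; rewrite andTb.
by have := bumps_itv e n.+1 y; have := bumps_itv e n y; lra.
Qed.

Lemma punity_neq0 e n y : 0 < e -> punity e n y != 0 -> mdist (s n) y < e.
Proof.
move=> e0; rewrite ltNge; apply: contraNN => ey; rewrite /punity /= subr_eq0.
apply/eqP/max_l; rewrite /bump clamp0; first by case/andP: (bumps_itv e n y).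
by rewrite subr_le0 ler_pdivlMr//; lra.
Qed.

Lemma sum_punity e n y : \sum_(j < n) punity e j y = bumps e n y.
Proof.
elim: n => [|n IH]; first by rewrite big_ord0.
by rewrite big_ord_recr/= IH /punity addrC subrK.
Qed.

Lemma lipschitz_clamp (x y : R) : `|clamp R x - clamp R y| <= `|x - y|.
Proof.
have h1 := ler_norm (x - y); have := ler_norm (- (x - y)); rewrite normrN => h2.
by rewrite ler_norml; pattern (clamp R x); apply: clamp_cases => ?;
  pattern (clamp R y); apply: clamp_cases => ?; lra.
Qed.

Lemma lipschitz_max (a b c d : R) k : `|a - b| <= k -> `|c - d| <= k ->
  `|Num.max a c - Num.max b d| <= k.
Proof. by rewrite !ler_norml !maxEle => h1 h2; do 2![case: ifPn => ?]; lra. Qed.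

Lemma lipschitz_bumps e n y z : 0 < e -> `|bumps e n y - bumps e n z| <= (2 / e) * mdist y z.
Proof.
move=> e0; elim: n => [|n IH] /=.
  by rewrite subrr normr0 mulr_ge0 ?mdist_ge0// divr_ge0// ltW.
apply: lipschitz_max => //; apply: le_trans (lipschitz_clamp _ _) _.
have -> : 2 - 2 * mdist (s n) y / e - (2 - 2 * mdist (s n) z / e) =
  (2 / e) * (mdist (s n) z - mdist (s n) y) by field; rewrite gt_eqF.
rewrite normrM ger0_norm ?divr_ge0 ?(ltW e0)// ler_wpM2l ?divr_ge0 ?(ltW e0)//.
by rewrite distrC; have := lipschitz_mdist (s n) y z; rewrite mul1r.
Qed.

Lemma lipschitz_punity e n y z : 0 < e ->
  `|punity e n y - punity e n z| <= (4 / e) * mdist y z.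
Proof.
move=> e0; have := lipschitz_bumps n y z e0; have := lipschitz_bumps n.+1 y z e0.
rewrite /punity !ler_norml => /andP[h1 h2] /andP[h3 h4].
have -> : 4 / e * mdist y z = 2 / e * mdist y z + 2 / e * mdist y z.
  by rewrite -mulrDl -mulrDl -natrD.
by apply/andP; split; lra.
Qed.

Lemma continuous_bumps e n : 0 < e -> continuous (bumps e n).
Proof. by move=> e0; apply: (@lipschitz_continuous _ (2 / e)) => y z; exact: lipschitz_bumps. Qed.

Lemma continuous_punity e n : 0 < e -> continuous (punity e n).
Proof. by move=> e0; apply: (@lipschitz_continuous _ (4 / e)) => y z; exact: lipschitz_punity. Qed.

End polish.

(** * Quantile maps of laws on a Polish space *)

Section section_of_law.
Context (R : realType) (S : polishMetricType R).
Variable s : nat -> S.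
Hypothesis sP : forall y e, 0 < e -> exists n, mdist (s n) y < e.

Let sc k : R := 2^-1 ^+ k.
Let sc0 k : 0 < sc k. Proof. by rewrite exprn_gt0// invr_gt0. Qed.

(** A word of indices, latest first, designates a piece of [S]: its index of rank
    [k] selects a member of the partition of unity at scale 2^-k.  The weight is
    the product of these members. *)
Fixpoint weight (i : seq nat) (y : S) : R :=
  if i is j :: i' then weight i' y * punity s (sc (size i')) j y else 1.

Lemma weight_itv i y : 0 <= weight i y <= 1.
Proof.
elim: i => [|j i /andP[IH0 IH1]] /=; first by rewrite ler01 lexx.
have /andP[p0 p1] := punity_itv s (sc (size i)) j y.
by rewrite mulr_ge0//= mulr_ile1.
Qed.

Lemma continuous_weight i : continuous (weight i).
Proof.
elim: i => [|j i IH] y /=; first exact: cvg_cst.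
by apply: cvgM; [exact: IH|exact: continuous_punity].
Qed.

Lemma continuous_weight_bumps i k j : continuous (fun y => weight i y * bumps s (sc k) j y).
Proof.
by move=> y; apply: cvgM; [exact: continuous_weight|exact: continuous_bumps].
Qed.

Lemma weight_bumps_itv i k j y : 0 <= weight i y * bumps s (sc k) j y <= 1.
Proof.
have /andP[w0 w1] := weight_itv i y; have /andP[b0 b1] := bumps_itv s (sc k) j y.
by rewrite mulr_ge0//= mulr_ile1.
Qed.

Lemma bmf_weight i : bmf (weight i : borel S -> R).
Proof.
by apply: bmf01; [by apply: continuous_borel; exact: continuous_weight|exact: weight_itv].
Qed.

Lemma bmf_weight_bumps i k j : bmf ((fun y => weight i y * bumps s (sc k) j y) : borel S -> R).
Proof.
apply: bmf01; [by apply: continuous_borel; exact: continuous_weight_bumps|exact: weight_bumps_itv].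
Qed.

Section fixed_law.
Variable mu : probability (borel S) R.

(** The piece [i] is cut further at scale 2^-(size i); this is the total length of
    the intervals of [0 :: i], ..., [j.-1 :: i]. *)
Definition mass i j : R := \int[mu]_y (weight i y * bumps s (sc (size i)) j y).

(** The interval of the word [i] starts at [lft i] and has length [len i]; those
    of the words [j :: i] subdivide it.  The endpoints are built from integrals
    of continuous functions, whence the continuity of [quantile] in [mu]. *)
Fixpoint lft (i : seq nat) : R := if i is j :: i' then lft i' + mass i' j else 0.

Definition len i : R := \int[mu]_y weight i y.

Lemma mass0 i : mass i 0 = 0.
Proof.
rewrite /mass -[RHS](Rint_cst mu 0); apply: eq_Rintegral => y _ /=; exact: mulr0.
Qed.

Lemma nd_mass i : nondecreasing_seq (mass i).
Proof.
move=> j j' jj'; apply: le_Rint; [exact: bmf_weight_bumps|exact: bmf_weight_bumps|].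
by move=> y; rewrite ler_wpM2l ?nd_bumps//; case/andP: (weight_itv i y).
Qed.

Lemma mass_le i j : 0 <= mass i j <= len i.
Proof.
apply/andP; split; first by apply: Rint_ge0 => y; case/andP: (weight_bumps_itv i (size i) j y).
apply: le_Rint; [exact: bmf_weight_bumps|exact: bmf_weight|].
move=> y; apply: ler_piMr; first by case/andP: (weight_itv i y).
by case/andP: (bumps_itv s (sc (size i)) j y).
Qed.

Lemma cvg_mass i : mass i j @[j --> \oo] --> len i.
Proof.
apply: (@cvg_Rint _ _ _ mu _ _ 1).
- by move=> j; apply: continuous_borel; exact: continuous_weight_bumps.
- apply: continuous_borel; exact: continuous_weight.
- by move=> j y; have /andP[? ?] := weight_bumps_itv i (size i) j y; rewrite ger0_norm.
move=> y; rewrite -[X in _ --> X]mulr1; apply: cvgM; first exact: cvg_cst.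
have [n nP] := bumps_eq1 sP y (sc0 (size i)).
apply: cvg_near_cst; exists n => // m /= nm; exact: nP.
Qed.

Lemma len_cons j i : len (j :: i) = mass i j.+1 - mass i j.
Proof.
rewrite -RintB; [|exact: bmf_weight_bumps..].
by apply: eq_Rintegral => y _; rewrite /= /punity mulrBr.
Qed.

Lemma len_ge0 i : 0 <= len i.
Proof. by apply: Rint_ge0 => y; case/andP: (weight_itv i y). Qed.

Lemma lft_itv i : 0 <= lft i /\ lft i + len i <= 1.
Proof.
elim: i => [|j i [IH1 IH2]] /=.
  by rewrite lexx add0r /len /= Rint_cst lexx.
have /andP[m0 m1] := mass_le i j; have /andP[_ m2] := mass_le i j.+1.
by rewrite len_cons; split; lra.
Qed.

(** The index of the subinterval of [i] that contains [u]; the default value is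
    never used for [u] in the interval of [i], by [cvg_mass]. *)
Definition idx i u : nat :=
  if pselect (exists j, u < lft i + mass i j.+1) is left e then ex_minn e else 0%N.

Fixpoint pre k u : seq nat :=
  if k is k'.+1 then idx (pre k' u) u :: pre k' u else [::].

Lemma size_pre k u : size (pre k u) = k.
Proof. by elim: k => //= k ->. Qed.

Lemma idxP i j u : lft i <= u < lft i + len i ->
  (idx i u == j) = (lft i + mass i j <= u < lft i + mass i j.+1).
Proof.
move=> /andP[Lu uR]; rewrite /idx; case: pselect => [e|]; last first.
  move=> ne; exfalso; apply: ne.
  have := @cvg_mass i => /cvgrPdist_lt/(_ (lft i + len i - u)).
  rewrite subr_gt0 => /(_ uR)[n _ /(_ n.+1 (leqnSn n))/= h]; exists n.
  by have := ler_norm (len i - mass i n.+1); lra.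
case: ex_minnP => j0 uj0 j0min; apply/eqP/andP => [<-|[ju uj]].
  split => //; case: j0 uj0 j0min => [|j0] uj0 j0min; first by rewrite mass0 addr0.
  rewrite leNgt; apply/negP => /j0min; rewrite ltnn//.
apply/eqP; rewrite eqn_leq j0min//= leqNgt; apply/negP => j0j.
have := nd_mass i j0j; lra.
Qed.

Lemma preP i u : 0 <= u < 1 -> pre (size i) u = i <-> lft i <= u < lft i + len i.
Proof.
move=> u01; elim: i => [|j i IH] /=.
  by rewrite add0r /len /= Rint_cst u01.
have /andP[m0 m1] := mass_le i j; have /andP[_ m2] := mass_le i j.+1.
have -> : lft i + mass i j + len (j :: i) = lft i + mass i j.+1 by rewrite len_cons; ring.
split.
  by move=> [+ /[dup] pi /IH iu]; rewrite pi => /eqP; rewrite idxP.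
move=> iu; have iu' : lft i <= u < lft i + len i by lra.
by have -> := IH.2 iu'; congr (_ :: _); apply/eqP; rewrite idxP.
Qed.

(** An interval containing [u] is not empty, hence the integral of its weight is
    not 0. *)
Lemma pre_weight k u : 0 <= u < 1 -> exists y, weight (pre k u) y != 0.
Proof.
move=> u01; have /(preP _ u01) : pre (size (pre k u)) u = pre k u by rewrite size_pre.
set i := pre k u => iu; apply: contrapT => /forallNP w0.
suff : len i = 0 by lra.
rewrite /len -[RHS](Rint_cst mu 0); apply: eq_Rintegral => y _.
by apply/eqP; rewrite -[_ == _]negbK; exact/negP/w0.
Qed.

Definition locus k u : S := s (idx (pre k u) u).

(** The members of the partitions of unity selected by [u] up to scale 2^-k do not
    vanish at a common point [y]. *)
Lemma locus_near k u : 0 <= u < 1 ->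
  exists y, forall l, (l < k)%N -> mdist (locus l u) y < sc l.
Proof.
move=> /(pre_weight k)[y]; elim: k => [|k IH] /= wy; first by exists y.
exists y => l; rewrite ltnS leq_eqVlt.
suff H : forall k, weight (pre k u) y != 0 -> forall l, (l < k)%N -> mdist (locus l u) y < sc l.
  by move=> h; apply: (H k.+1 wy); rewrite ltnS leq_eqVlt.
elim=> [|k' IH'] //=; rewrite mulf_eq0 negb_or => /andP[w1 w2] l'.
rewrite ltnS leq_eqVlt => /predU1P[->|]; last exact: IH'.
by rewrite size_pre in w2; apply: punity_neq0 w2.
Qed.

(** The Blackwell-Dubins section; on the real line, the quantile function has the
    same properties. *)
Definition quantile u : S := lim (locus k u @[k --> \oo]).

(** By [locus_near] the centers selected at scales 2^-l and 2^-l' have a point at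
    distance less than 2^-l from one and 2^-l' from the other, so they form a
    Cauchy sequence. *)
Lemma locus_quantile k u : 0 <= u < 1 -> mdist (locus k u) (quantile u) <= sc k.
Proof.
move=> u01.
have dl l l' : mdist (locus l u) (locus l' u) < sc l + sc l'.
  have [y yP] := locus_near (maxn l l').+1 u01.
  apply: le_lt_trans (metric_triangle _ y _) _; apply: ltrD.
    by apply: yP; rewrite ltnS leq_maxl.
  by rewrite metric_sym; apply: yP; rewrite ltnS leq_maxr.
have sle l l' : (l <= l')%N -> sc l' <= sc l.
  by move=> ll'; apply: ler_wiXn2l => //; rewrite ?invr_ge0// invf_le1// ler1n.
have cc : cvg (locus k u @[k --> \oo]).
  apply/cauchy_cvgP/cauchy_ballP => e e0.
  have [|l le] := @half_expn_lt R (e / 2); first by rewrite divr_gt0.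
  exists ([set locus m u | m in [set m | (l <= m)%N]], [set locus m u | m in [set m | (l <= m)%N]]) => /=.
    by split; exists l => // m /= lm; exists m.
  move=> [_ _] [[m lm <-] [m' lm' <-]] /=; rewrite ballEmdist/=.
  by apply: lt_trans (dl _ _) _; have := sle _ _ lm; have := sle _ _ lm'; rewrite /sc; lra.
apply/ler_addgt0Pr => e e0.
have [|l le] := @half_expn_lt R (e / 2); first by rewrite divr_gt0.
have e2 : 0 < e / 2 by rewrite divr_gt0.
have /(_ _ (nbhs_mdist _ e2))[n _ nP] := cc.
have := nP (maxn l n) (leq_maxr _ _) => /=.
rewrite metric_sym => dbd.
apply: le_trans (metric_triangle _ (locus (maxn l n) u) _) _.
have := dl k (maxn l n); have := sle _ _ (leq_maxl l n); rewrite /sc in le *; lra.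
Qed.

End fixed_law.

End section_of_law.

(** * The law of a quantile map at a uniform variable *)

Fixpoint natseqs (k N : nat) : seq (seq nat) :=
  if k is k'.+1 then [seq j :: i | j <- iota 0 N, i <- natseqs k' N] else [:: [::]].

Lemma uniq_natseqs k N : uniq (natseqs k N).
Proof.
elim: k => //= k IH; apply: allpairs_uniq => //; first exact: iota_uniq.
by move=> [j i] [j' i'] _ _ [-> ->].
Qed.

Lemma size_natseqs k N i : i \in natseqs k N -> size i = k.
Proof. by elim: k i => [|k IH] i /=; [rewrite inE => /eqP->|move=> /allpairsP[[j i'] /= [_ /IH <- ->]]]. Qed.

Section randomization.
Context (R : realType) (S : polishMetricType R).
Variable s : nat -> S.
Hypothesis sP : forall y e, 0 < e -> exists n, mdist (s n) y < e.
Let sc k : R := 2^-1 ^+ k.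
Let sc0 k : 0 < sc k. Proof. by rewrite exprn_gt0// invr_gt0. Qed.
Context d (T : measurableType d) (P : probability T R).
Variables (V : T -> R) (mV : measurable_fun setT V) (V01 : forall w, 0 <= V w < 1).
Local Notation pr := (prob P).

Lemma measurable_itvV a b : measurable [set w | a <= V w < b].
Proof.
rewrite (_ : [set w | _] = [set w | V w < b] `\` [set w | V w < a]).
  by apply: measurableD; exact: measurable_lt_cst.
apply/seteqP; split => w /=; first by move=> /andP[aV ->]; split => //; apply/negP; rewrite -leNgt.
by move=> [-> /negP]; rewrite -leNgt => ->.
Qed.

Section fixed_law.
Variable mu : probability (borel S) R.
Local Notation pre := (pre s mu).
Local Notation lft := (lft s mu).
Local Notation len := (len s mu).
Local Notation locus := (locus s mu).
Local Notation quantile := (quantile s mu).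

Lemma pre_event i : [set w | pre (size i) (V w) = i] = [set w | lft i <= V w < lft i + len i].
Proof. by apply/seteqP; split => w /(preP sP _ _ (V01 w)). Qed.

Lemma measurable_pre i : measurable [set w | pre (size i) (V w) = i].
Proof. by rewrite pre_event; exact: measurable_itvV. Qed.

Lemma measurable_pre_in k (Q : set (seq nat)) : measurable [set w | Q (pre k (V w))].
Proof.
rewrite (_ : [set w | _] =
    \bigcup_i (if (size i == k) && `[< Q i >] then [set w | pre (size i) (V w) = i] else set0)).
  apply: countable_bigcupT_measurable; first exact: countableP.
  by move=> i; case: ifP => // _; exact: measurable_pre.
apply/seteqP; split => w /=.
  by move=> Qw; exists (pre k (V w)) => //; rewrite size_pre eqxx/= ifT//; apply/asboolP.
by move=> [i _]; case: ifPn => // /andP[/eqP <- /asboolP Qi] /= ->.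
Qed.

(** [quantile] lies in the open set [U] when some selected center has a ball inside
    [U], with radius the scale: a condition on the word of [V w], hence measurable. *)
Lemma quantile_open (U : set S) : open U -> [set w | U (quantile (V w))] =
  \bigcup_k [set w | (fun i => forall z, mdist (s (head 0%N i)) z <= sc k -> U z) (pre k.+1 (V w))].
Proof.
move=> /open_mdistP oU; apply/seteqP; split => w /=; last first.
  by move=> [k _] /(_ (quantile (V w))); apply; exact: (locus_quantile sP).
move=> Uw; have [e e0 eU] := oU _ Uw.
have [|k ke] := @half_expn_lt R (e / 2); first by rewrite divr_gt0.
exists k => // z /= dz; apply: eU; apply: le_lt_trans (metric_triangle _ (locus k (V w)) _) _.
by have := locus_quantile sP mu k (V01 w); rewrite metric_sym /locus /sc in dz *; lra.
Qed.

Lemma measurable_quantile : measurable_fun setT (quantile \o V : T -> borel S).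
Proof.
apply: (@measurability _ _ T (borel S) setT (quantile \o V) (@open S)) => //.
move=> _ [U oU <-]; rewrite setTI [X in measurable X](quantile_open oU).
apply: bigcupT_measurable => k.
exact: (measurable_pre_in k.+1 (fun i => forall z, mdist (s (head 0%N i)) z <= sc k -> U z)).
Qed.

Variables (A : set T) (mA : measurable A) (AV : uniform_on P A V).

Lemma pr_pre i : pr (A `&` [set w | pre (size i) (V w) = i]) = pr A * len i.
Proof.
have [l0 l1] := lft_itv s mu i; have l2 := len_ge0 s mu i.
by rewrite pre_event AV//; [congr (_ * _); ring|lra].
Qed.

(** By [open_le_measure_eq], an inequality on open sets is enough.  It suffices to
    bound the measure of the points [y] at which [U] has a margin and the first
    [N] members of the partitions of unity at scales at least 2^-k already sum
    to 1.  At such [y], the weights of the words of length [k.+1] in indices less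
    than [N] sum to 1, and the nonzero ones have a latest center with a ball
    inside [U].  Hence the measure is at most the sum of the lengths of the intervals of
    these words, on which [quantile] lies in [U]. *)
Lemma law_quantile_ge (U : set S) : open U ->
  pr A * fine (mu U) <= pr (A `&` [set w | U (quantile (V w))]).
Proof.
move=> oU.
have mUw : measurable [set w | U (quantile (V w))].
  rewrite -[X in measurable X]setTI.
  by apply: (measurable_quantile measurableT (Y := U)); exact: open_borel.
have mAU := measurableI _ _ mA mUw.
have mI k : measurable (erosion U (2 * sc k) : set (borel S)) by exact: measurable_erosion.
have A0 := pr_ge0 P A.
suff H k : pr A * prob mu (erosion U (2 * sc k)) <= pr (A `&` [set w | U (quantile (V w))]).
  have : prob mu (erosion U (2 * sc k)) @[k --> \oo] --> prob mu U.
    rewrite -[X in _ --> prob _ X](bigcup_erosion oU).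
    by apply: cvg_pr_bigcup => //; exact: nd_erosion.
  move=> c; have cA : pr A * prob mu (erosion U (2 * sc k)) @[k --> \oo] --> pr A * prob mu U.
    by apply: cvgM => //; exact: cvg_cst.
  rewrite -(cvg_lim (@Rhausdorff R) cA); apply: limr_le; first by apply/cvg_ex; eexists; exact: cA.
  by apply: nearW => k; exact: H.
pose G N : set (borel S) := erosion U (2 * sc k) `&` [set y | forall l, (l <= k)%N -> bumps s (sc l) N y = 1].
have mG N : measurable (G N).
  apply: measurableI => //.
  rewrite (_ : [set y | _] = \bigcap_l (if (l <= k)%N then [set y | bumps s (sc l) N y = 1] else setT)).
    apply: bigcapT_measurable => l; case: ifP => // _.
    rewrite (_ : [set y | _] = ~` [set y | bumps s (sc l) N y < 1]).
      apply: measurableC; apply: measurable_lt_cst; apply: continuous_borel; exact: continuous_bumps.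
    apply/seteqP; split => y /=; first by move=> ->; rewrite ltxx.
    by move/negP; rewrite -leNgt => b1; apply/eqP; rewrite eq_le b1; have /andP[_ ->] := bumps_itv s (sc l) N y.
  apply/seteqP; split => y /= Hy l; first by move=> _; case: ifPn => // lk; exact: Hy.
  by move=> lk; have := Hy l I; rewrite lk.
suff HN N : pr A * prob mu (G N) <= pr (A `&` [set w | U (quantile (V w))]).
  have ndG : nondecreasing_seq G.
    apply/nondecreasing_seqP => N; apply/subsetPset => y [Uy b1]; split => // l lk.
    apply/eqP; rewrite eq_le; have /andP[_ ->] /= := bumps_itv s (sc l) N.+1 y.
    by rewrite -(b1 l lk); exact: (nd_bumps s (sc l) y (leqnSn N)).
  have GU : \bigcup_N G N = erosion U (2 * sc k).
    apply/seteqP; split => y; first by move=> [N _ []].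
    move=> Uy; suff [N NP] : exists N, forall l, (l <= k)%N -> bumps s (sc l) N y = 1 by exists N.
    have [f fP] := choice (fun l => bumps_eq1 sP y (sc0 l)).
    exists (\max_(l < k.+1) f l)%N => l lk; apply: fP.
    by rewrite -ltnS in lk; exact: (leq_bigmax (Ordinal lk)).
  have c := cvg_pr_bigcup (P := mu) mG ndG; rewrite GU in c.
  have cA : pr A * prob mu (G N) @[N --> \oo] --> pr A * prob mu (erosion U (2 * sc k)).
    by apply: cvgM => //; exact: cvg_cst.
  rewrite -(cvg_lim (@Rhausdorff R) cA); apply: limr_le; first by apply/cvg_ex; eexists; exact: cA.
  by apply: nearW => N; exact: HN.
pose Q i := `[< forall z, mdist (s (head 0%N i)) z <= sc k -> U z >].
pose F := [seq i <- natseqs k.+1 N | Q i].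
have szF i : i \in F -> size i = k.+1 by rewrite mem_filter => /andP[_ /size_natseqs].
have sumF y : G N y -> \sum_(i <- F) weight s i y = 1.
  move=> [Uy b1]; rewrite big_filter.
  have H m : (m <= k.+1)%N -> \sum_(i <- natseqs m N) weight s i y = 1.
    elim: m => [|m IH] mk; first by rewrite big_seq1.
    rewrite big_allpairs_dep /= exchange_big/=.
    rewrite -[RHS](IH (ltnW mk)); rewrite big_seq [RHS]big_seq; apply: eq_bigr => i /size_natseqs ->.
    rewrite -mulr_sumr -[X in \sum_(j <- iota 0 X) _]subn0 -/(index_iota _ _) big_mkord sum_punity.
    by rewrite b1// mulr1.
  rewrite -[RHS](H k.+1)// [RHS](bigID Q)/= [X in _ = _ + X]big1_seq ?addr0// => i /andP[nQ iN].
  have := @size_natseqs k.+1 N i iN.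
  move=> {iN}; case: i nQ => //= j i nQ [sz]; apply/eqP; rewrite mulf_eq0; apply/orP; right; rewrite sz.
  apply: contraNT nQ => /(punity_neq0 (sc0 k)) jy; apply/asboolP => z /= jz; apply: Uy.
  by apply: le_lt_trans (metric_triangle _ (s j) _) _; rewrite metric_sym /sc in jy jz *; lra.
have mpre i : measurable (A `&` [set w | pre k.+1 (V w) = i]).
  by apply: measurableI => //; exact: (measurable_pre_in k.+1 (fun x => x = i)).
apply: (@le_trans _ _ (pr (\big[setU/set0]_(i <- F) (A `&` [set w | pre k.+1 (V w) = i])))); last first.
  apply: le_pr => //; first exact: bigsetU_measurable.
  rewrite -bigcup_seq => w [i iF [Aw /= pw]]; split => //=; rewrite (_ : U _ = [set w | U (quantile (V w))] w)//.
  rewrite quantile_open//; exists k => //=.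
  have : i \in F by exact: iF.
  by rewrite /F mem_filter => /andP[/asboolP + _]; rewrite -pw; exact.
rewrite pr_bigsetU//; last 2 first.
- by rewrite filter_uniq// uniq_natseqs.
- by move=> i i' /eqP ii'; rewrite -subset0 => w [[_ e1] [_ e2]]; apply: ii'; rewrite -e1 -e2.
rewrite big_seq (eq_bigr (fun i => pr A * len i)); last first.
  by move=> i /szF iF; rewrite -pr_pre iF.
rewrite -big_seq -mulr_sumr ler_wpM2l// -Rint_sum; last by move=> i; exact: bmf_weight.
rewrite -Rint_indic//; apply: le_Rint; [exact: bmf_indic|by apply: bmf_sum => i; exact: bmf_weight|].
move=> y; rewrite indicE; have [yG|_] := boolP (y \in G N).
  by rewrite sumF//; rewrite inE in yG.
by apply: sumr_ge0 => i _; case/andP: (weight_itv s i y).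
Qed.

End fixed_law.
End randomization.

(** * Continuity of quantile maps in the law *)

Lemma cvg_sumr (R : realType) (I : Type) (r : seq I) (T : Type) (F : set_system T) (FF : Filter F)
    (f : I -> T -> R) (a : I -> R) : (forall i, f i x @[x --> F] --> a i) ->
  \sum_(i <- r) f i x @[x --> F] --> \sum_(i <- r) a i.
Proof.
move=> fa; elim: r => [|i r IH].
  by rewrite big_nil; under eq_fun do rewrite big_nil; exact: cvg_cst.
by rewrite big_cons; under eq_fun do rewrite big_cons; exact: cvgD.
Qed.

Section measurable_pairs.
Context (R : realType) (S : polishMetricType R) d (T : measurableType d).
Implicit Types f g : T -> borel S.

Lemma measurable_mdist_lt_cst f (a : S) (r : R) : measurable_fun setT f ->
  measurable [set w | mdist a (f w : S) < r].
Proof.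
move=> mf; rewrite -[X in measurable X]setTI.
apply: (mf measurableT [set y : S | mdist a y < r]); apply: open_borel.
apply/open_mdistP => y /= ay; exists (r - mdist a y); first by rewrite subr_gt0.
by move=> z yz; apply: le_lt_trans (metric_triangle _ y _) _; lra.
Qed.

Lemma measurable_mdist_ge f g (e : R) : measurable_fun setT f -> measurable_fun setT g ->
  measurable [set w | e <= mdist (f w : S) (g w : S)].
Proof.
move=> mf mg; rewrite -[X in measurable X]setCK; apply: measurableC.
have [s sP] := @ex_dense_seq R S.
rewrite (_ : ~` _ = \bigcup_n \bigcup_(q : rat)
   ([set w | mdist (s n) (f w : S) < ratr q] `&` [set w | mdist (s n) (g w : S) < e - ratr q])).
  apply: bigcupT_measurable => n; apply: bigcupT_measurable_rat => q.
  by apply: measurableI; exact: measurable_mdist_lt_cst.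
apply/seteqP; split => w /=.
  move/negP; rewrite -ltNge => fg.
  have [|n sn] := sP (f w) ((e - mdist (f w : S) (g w : S)) / 2); first by rewrite divr_gt0// subr_gt0.
  have [q] := rat_in_itvoo sn; rewrite in_itv /= => /andP[q1 q2].
  exists n => //; exists q => //; split => //=.
  by apply: le_lt_trans (metric_triangle _ (f w : S) _) _; lra.
move=> [n _ [q _ [/= h1 h2]]]; apply/negP; rewrite -ltNge.
by apply: le_lt_trans (metric_triangle _ (s n) _) _; rewrite metric_sym; lra.
Qed.

End measurable_pairs.

Section modes_of_convergence.
Context (R : realType) (S : polishMetricType R) d (T : measurableType d) (P : probability T R).
Local Notation pr := (prob P).

Definition cvg_prob (I : Type) (F : set_system I) (Y : I -> T -> borel S) (Y0 : T -> borel S) :=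
  forall e, 0 < e -> \forall i \near F, pr [set w | e <= mdist (Y i w : S) (Y0 w : S)] <= e.

Definition cvg_law (I : Type) (F : set_system I) (mu : I -> probability (borel S) R)
    (mu0 : probability (borel S) R) :=
  forall f : S -> R, continuous f -> bounded_fun f ->
    \int[mu i]_x f x @[i --> F] --> \int[mu0]_x f x.

End modes_of_convergence.

Definition to_mfun d d' (T : measurableType d) (T' : measurableType d') (f : T -> T')
  (mf : measurable_fun setT f) : {mfun T >-> T'} :=
  HB.pack_for {mfun T >-> T'} f (isMeasurableFun.Build _ _ _ _ f mf).

Section randomization.
Context (R : realType) (S : polishMetricType R).
Variable s : nat -> S.
Hypothesis sP : forall y e, 0 < e -> exists n, mdist (s n) y < e.
Let sc k : R := 2^-1 ^+ k.
Context d (T : measurableType d) (P : probability T R).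
Variables (V : T -> R) (mV : measurable_fun setT V) (V01 : forall w, 0 <= V w < 1).
Local Notation pr := (prob P).
Variables (A : set T) (mA : measurable A) (AV : uniform_on P A V).

(** Both sides are measures in [B], with the same total mass [pr A]. *)
Lemma law_quantile (mu : probability (borel S) R) (B : set (borel S)) : measurable B ->
  pr (A `&` [set w | B (quantile s mu (V w))]) = pr A * prob mu B.
Proof.
move=> mB; have A0 := pr_ge0 P A.
pose X := to_mfun (measurable_quantile sP mV V01 mu).
have mX (C : set (borel S)) : measurable C -> measurable [set w | C (quantile s mu (V w))].
  move=> mC; rewrite -[X in measurable X]setTI.
  exact: (measurable_quantile sP mV V01 mu measurableT mC).
pose m1 : {measure set (borel S) -> \bar R} := mscale (NngNum A0) mu.
pose m2' : {measure set (borel S) -> \bar R} := pushforward (mrestr P mA) X.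
pose m2 := m2' (measurable_quantile sP mV V01 mu).
have m1E C : measurable C -> m1 C = (pr A * prob mu C)%:E.
  by move=> mC; rewrite EFinM -(@prE _ _ _ mu C mC).
have m2E C : measurable C -> m2 C = (pr (A `&` [set w | C (quantile s mu (V w))]))%:E.
  move=> mC; rewrite -(@prE _ _ _ P); last by apply: measurableI => //; exact: mX.
  by rewrite setIC.
suff : m1 B = m2 B by rewrite m1E// m2E// => -[].
apply: open_le_measure_eq => //.
- by rewrite m1E// ltry.
- by rewrite m1E// m2E// prT mulr1; congr (pr _)%:E; rewrite -[LHS]setIT.
- move=> U oU; have mU := open_borel oU; rewrite m1E// m2E// lee_fin; exact: law_quantile_ge.
Qed.

Lemma uniform_symdiff a b a' b' : 0 <= a' <= 1 -> 0 <= b' <= 1 -> 0 <= a -> b <= 1 ->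
  pr (A `&` [set w | a <= V w < b] `\` [set w | a' <= V w < b']) <= `|a' - a| + `|b' - b|.
Proof.
move=> a'01 b'01 a0 b1.
have A1 : pr A <= 1 by exact: pr_le1.
have A0 := pr_ge0 P A.
have mI x y : measurable (A `&` [set w | x <= V w < y]) by apply: measurableI => //; exact: measurable_itvV.
have H x y : 0 <= x -> y <= 1 -> pr (A `&` [set w | x <= V w < y]) <= `|y - x|.
  move=> x0 y1; have [xy|yx] := leP x y.
    by rewrite AV// ger0_norm ?subr_ge0// ler_piMl// subr_ge0.
  rewrite (_ : _ `&` _ = set0) ?pr0//.
  by rewrite -subset0 => w [_ /= h]; lra.
have h1 := H a a'; have h2 := H b' b.
apply: (@le_trans _ _ (pr ((A `&` [set w | a <= V w < a']) `|` (A `&` [set w | b' <= V w < b])))).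
  apply: le_pr; [by apply: measurableD => //; exact: measurable_itvV|exact: measurableU|].
  move=> w [[Aw /= /andP[aw wb]] /negP]; rewrite negb_and -!ltNge -leNgt => /orP[?|?].
    by left; split => //=; rewrite aw.
  by right; split => //=; rewrite wb andbT.
apply: le_trans (prU_le _ _ _) _ => //; apply: lerD; first by apply: h1; lra.
by rewrite distrC; apply: h2; lra.
Qed.

(** Up to a small probability, [V] lies in one of finitely many intervals of
    words of length [k.+1] for [kappa0].  The endpoints converge, so [V] lies with
    high probability in the interval of the same word for [kappa i]; then both
    quantiles are within 2^-k of the same center. *)
Lemma cvg_quantile (I : Type) (F : set_system I) (FF : Filter F)
    (kappa : I -> probability (borel S) R) (kappa0 : probability (borel S) R) e e' :
  cvg_law F kappa kappa0 -> 0 < e -> 0 < e' ->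
  \forall i \near F,
    pr (A `&` [set w | e <= mdist (quantile s (kappa i) (V w)) (quantile s kappa0 (V w))]) <= e'.
Proof.
move=> ck e0 e'0.
have bw01 (f : S -> R) : (forall y, 0 <= f y <= 1) -> bounded_fun f.
  by move=> f01; apply/bounded_funE; exists 1 => y; have /andP[? ?] := f01 y; rewrite ger0_norm.
have clen i : len s (kappa t) i @[t --> F] --> len s kappa0 i.
  by apply: ck; [exact: continuous_weight|apply: bw01; exact: weight_itv].
have cmass i j : mass s (kappa t) i j @[t --> F] --> mass s kappa0 i j.
  by apply: ck; [exact: continuous_weight_bumps|apply: bw01; exact: weight_bumps_itv].
have clft i : lft s (kappa t) i @[t --> F] --> lft s kappa0 i.
  by elim: i => [|j i IH] /=; [exact: cvg_cst|exact: cvgD].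
pose rgt mu i := lft s mu i + len s mu i.
have crgt i : rgt (kappa t) i @[t --> F] --> rgt kappa0 i by exact: cvgD.
pose gap t i := `|lft s (kappa t) i - lft s kappa0 i| + `|rgt (kappa t) i - rgt kappa0 i|.
have cgap i : gap t i @[t --> F] --> 0.
  rewrite (_ : 0 = `|lft s kappa0 i - lft s kappa0 i| + `|rgt kappa0 i - rgt kappa0 i|); last first.
    by rewrite !subrr normr0 addr0.
  by apply: cvgD; apply: cvg_norm; apply: cvgB => //; exact: cvg_cst.
have [|k ke] := @half_expn_lt R (e / 2); first by rewrite divr_gt0.
(* words are enumerated by [pickle], and [N n] selects the first [n] ones *)
pose N n := A `&` [set w | (pickle (pre s kappa0 k.+1 (V w)) < n)%N].
have mN n : measurable (N n).
  by apply: measurableI => //; exact: (measurable_pre_in sP mV V01 kappa0 k.+1 (fun i => (pickle i < n)%N)).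
have NA : \bigcup_n N n = A.
  apply/seteqP; split => w; first by move=> [n _ []].
  by move=> Aw; exists (pickle (pre s kappa0 k.+1 (V w))).+1 => //; split => //=.
have ndN : nondecreasing_seq N.
  by move=> n m nm; apply/subsetPset => w [Aw /= wn]; split => //=; exact: leq_trans wn nm.
have := cvg_pr_bigcup (P := P) mN ndN; rewrite NA => /cvgrPdist_lt/(_ (e' / 2)).
rewrite divr_gt0// => /(_ isT)[n _ /(_ n (leqnn n))/= Nn].
pose v l : seq nat := odflt [::] (unpickle l).
have : (\sum_(l < n) gap t (v l)) @[t --> F] --> (0 : R).
  have := @cvg_sumr _ _ (index_enum 'I_n) _ F FF (fun (l : 'I_n) t => gap t (v l)) (fun=> 0) (fun l => cgap _).
  by rewrite big1.
move=> /cvgrPdist_lt/(_ (e' / 2)); rewrite divr_gt0// => /(_ isT); apply: filterS => t /=.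
rewrite sub0r normrN => gapt.
have {}gapt := le_lt_trans (ler_norm _) gapt.
pose D l := A `&` [set w | lft s kappa0 (v l) <= V w < rgt kappa0 (v l)] `\`
  [set w | lft s (kappa t) (v l) <= V w < rgt (kappa t) (v l)].
have mD l : measurable (D l).
  by apply: measurableD; [apply: measurableI => //|]; exact: measurable_itvV.
have prDl l : pr (D l) <= gap t (v l).
  have [l1 l2] := lft_itv s (kappa t) (v l); have l3 := len_ge0 s (kappa t) (v l).
  have [l4 l5] := lft_itv s kappa0 (v l); have l6 := len_ge0 s kappa0 (v l).
  by rewrite /D /gap; apply: uniform_symdiff; rewrite /rgt; lra.
have mAN := measurableD mA (mN n).
have mbig : measurable (\big[setU/set0]_(l <- iota 0 n) D l) by exact: bigsetU_measurable.
apply: (@le_trans _ _ (pr ((A `\` N n) `|` \big[setU/set0]_(l <- iota 0 n) D l))).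
  apply: le_pr; [|exact: measurableU|].
    apply: measurableI => //.
    exact: (measurable_mdist_ge e (measurable_quantile sP mV V01 _) (measurable_quantile sP mV V01 _)).
  move=> w [Aw /= ew].
  have [wn|wn] := boolP (pickle (pre s kappa0 k.+1 (V w)) < n)%N; last first.
    by left; split => // -[_ /=]; apply/negP.
  right; rewrite -bigcup_seq; exists (pickle (pre s kappa0 k.+1 (V w))).
    by rewrite /= mem_iota.
  have sz mu : size (pre s mu k.+1 (V w)) = k.+1 by exact: size_pre.
  rewrite /D /v pickleK [odflt _ _]/=; split; first split => //.
    by apply/(preP sP) => //; rewrite sz.
  set i := pre s kappa0 k.+1 (V w) => /(preP sP (kappa t) i (V01 w)); rewrite sz => -[+ _].
  move=> idxE; have := locus_quantile sP (kappa t) k (V01 w); have := locus_quantile sP kappa0 k (V01 w).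
  rewrite /locus idxE => h1 h2.
  have := metric_triangle (quantile s (kappa t) (V w)) (s (idx s kappa0 (pre s kappa0 k (V w)) (V w))) (quantile s kappa0 (V w)).
  by rewrite (metric_sym (quantile s (kappa t) (V w)) (s _)); move: ke ew; lra.
apply: le_trans (prU_le _ mAN mbig) _; rewrite [leRHS](splitr e'); apply: lerD.
  have NnA : N n `<=` A by move=> w [].
  by rewrite prD//; have := ler_norm (pr A - pr (N n)); lra.
apply: le_trans (pr_bigsetU_le P _ mD) _.
rewrite -[n]subn0 -/(index_iota _ _) big_mkord; apply: le_trans (ltW gapt).
by apply: ler_sum => l _; exact: prDl.
Qed.

End randomization.

(** * Measures with a density *)

Section density_measure.
Context d (T : measurableType d) (R : realType) (mu : probability T R).
Variable h : T -> R.

Definition prob_density := [/\ bmf h, forall x, 0 <= h x & \int[mu]_x h x = 1].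

Section construction.
Hypothesis hP : prob_density.

Let kappa (A : set T) : \bar R := (\int[mu]_(x in A) (h x)%:E)%E.

Let mh : measurable_fun setT (EFin \o h).
Proof. by apply/measurable_EFinP; have [[]] := hP. Qed.

Let kappa0 : kappa set0 = 0%E. Proof. exact: integral_set0. Qed.

Let kappa_ge0 A : (0 <= kappa A)%E.
Proof. by apply: integral_ge0 => x _; rewrite lee_fin; have [_ + _] := hP; apply. Qed.

Let kappa_sigma_additive : semi_sigma_additive kappa.
Proof.
apply: semi_sigma_additive_nng_induced => //= x.
by rewrite lee_fin; have [_ + _] := hP; apply.
Qed.

HB.instance Definition _ := isMeasure.Build _ _ _ kappa kappa0 kappa_ge0 kappa_sigma_additive.

Let kappaE B : measurable B -> kappa B = (\int[mu]_x (\1_B x * h x))%:E.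
Proof.
move=> mB; have [bh _ _] := hP.
have iB : mu.-integrable B (EFin \o h).
  by apply: (integrableS measurableT) => //; exact: bmf_integrable.
rewrite /kappa -[LHS]fineK; last exact: integrable_fin_num.
congr EFin; rewrite -[LHS]/(\int[mu]_(x in B) h x) Rintegral_mkcond.
apply: eq_Rintegral => x _; rewrite patchE indicE.
by case: ifP => _; rewrite ?mul1r ?mul0r.
Qed.

Let kappaT : kappa setT = 1%E.
Proof.
rewrite kappaE//; have [_ _ <-] := hP; congr EFin; apply: eq_Rintegral => x _.
by rewrite indicE in_setT mul1r.
Qed.

HB.instance Definition _ := Measure_isProbability.Build _ _ _ kappa kappaT.

Lemma ex_density_subproof : exists nu : probability T R,
  forall B, measurable B -> prob nu B = \int[mu]_x (\1_B x * h x).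
Proof. by exists kappa => B mB; exact: (congr1 fine (kappaE mB)). Qed.

End construction.

(** If [h] is not a probability density then [mu] serves as a default value, which
    makes [density] a total function of [h]. *)
Lemma ex_density : exists nu : probability T R, prob_density ->
  (forall B, measurable B -> prob nu B = \int[mu]_x (\1_B x * h x)) /\
  (forall f, bmf f -> \int[nu]_x f x = \int[mu]_x (f x * h x)).
Proof.
have [hP|nhP] := pselect prob_density; last by exists mu.
have [nu nuE] := ex_density_subproof hP; exists nu => _; split => // f bf.
have [bh h0 h1] := hP.
(* an affine change reduces to functions with values in the unit interval *)
suff H01 (g : T -> R) : measurable_fun setT g -> (forall x, 0 <= g x <= 1) ->
    \int[nu]_x g x = \int[mu]_x (g x * h x).
  have [mf [M fM]] := bf.
  have M0 : 0 < `|M| + 1 by rewrite ltr_wpDl.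
  pose g x := (2 * (`|M| + 1))^-1 * (f x + (`|M| + 1)).
  have bg : bmf g by apply: bmfZ; apply: bmfD => //; exact: bmf_cst.
  have fE x : f x = 2 * (`|M| + 1) * g x - (`|M| + 1).
    by rewrite /g mulrA mulfV ?mul1r ?addrK// mulf_neq0// gt_eqF.
  have g01 x : 0 <= g x <= 1.
    have := fM x; rewrite ler_norml => /andP[f1 f2]; have := ler_norm M => M1.
    rewrite /g mulrC ler_pdivrMr ?mulr_gt0// divr_ge0 ?mulr_ge0 ?(ltW M0)//; lra.
  have Hg := H01 g bg.1 g01; set c := `|M| + 1 in fE M0.
  have bgh : bmf (fun x => g x * h x) by exact: bmfM.
  transitivity (\int[nu]_x (2 * c * g x - c)).
    by apply: eq_Rintegral => x _; rewrite -fE.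
  transitivity (\int[mu]_x (2 * c * (g x * h x) - c * h x)); last first.
    by apply: eq_Rintegral => x _; rewrite [in RHS]fE mulrBl mulrA.
  have b1 : bmf (fun x => 2 * c * g x) by exact: bmfZ.
  have b2 : bmf (fun x => 2 * c * (g x * h x)) by exact: bmfZ.
  have b3 : bmf (fun x => c * h x) by exact: bmfZ.
  rewrite (RintB nu b1 (bmf_cst _ c)) (RintB mu b2 b3) (RintZ nu _ bg) (RintZ mu _ bgh) (RintZ mu _ bh).
  by rewrite Rint_cst Hg h1 mulr1.
move=> mg g01.
have e0 J : 0 < 2^-1 ^+ J :> R by rewrite exprn_gt0// invr_gt0.
pose D v := [set x | bval R v < g x].
have mD v : measurable (D v).
  rewrite (_ : D v = ~` [set x | g x <= bval R v]).
    apply: measurableC; have := mg measurableT `]-oo, bval R v]%classic (measurable_itv _).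
    by rewrite setTI (_ : _ @^-1` _ = [set x | g x <= bval R v])//; apply/seteqP; split => x /=; rewrite in_itv.
  by apply/seteqP; split => x /=; rewrite /D/= ltNge => /negP.
(* the dyadic approximation of [g] from above, a combination of indicators *)
pose gJ J x : R := \sum_(v <- bitseqs J) 2^-1 ^+ J * \1_(D v) x.
have bD v : bmf (\1_(D v) : T -> R) by exact: bmf_indic.
have bgJ J : bmf (gJ J) by apply: bmf_sum => v; exact: bmfZ.
have gJE J x : g x <= gJ J x <= g x + 2^-1 ^+ J.
  have := count_bval J (g x); rewrite clamp_id//.
  suff -> : gJ J x = (count (fun v => bval R v < g x) (bitseqs J))%:R * 2^-1 ^+ J by [].
  rewrite /gJ -mulr_sumr mulrC -sum1_count natr_sum; congr (_ * _).
  rewrite [RHS]big_mkcond; apply: eq_bigr => v _; rewrite indicE /D.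
  by case: ifPn => gv; [rewrite mem_set|rewrite memNset//=; apply/negP].
have gJI J : \int[nu]_x gJ J x = \int[mu]_x (gJ J x * h x).
  rewrite Rint_sum; last by move=> v; exact: bmfZ.
  rewrite [RHS](@eq_Rintegral _ _ _ mu setT (fun x => \sum_(v <- bitseqs J) 2^-1 ^+ J * (\1_(D v) x * h x))); last first.
    by move=> x _; rewrite mulr_suml; apply: eq_bigr => v _; rewrite mulrA.
  rewrite Rint_sum; last by move=> v; apply: bmfZ; exact: bmfM.
  apply: eq_bigr => v _; rewrite !RintZ//; last exact: bmfM.
  by rewrite Rint_indic// nuE.
have bg : bmf g by exact: bmf01.
have n1 J : \int[nu]_x g x <= \int[nu]_x gJ J x <= \int[nu]_x g x + 2^-1 ^+ J.
  apply/andP; split; first by apply: le_Rint => // x; case/andP: (gJE J x).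
  rewrite -[X in _ + X](Rint_cst nu) -RintD//; last exact: bmf_cst.
  by apply: le_Rint => //; [by apply: bmfD => //; exact: bmf_cst|move=> x; case/andP: (gJE J x)].
have n2 J : \int[mu]_x (g x * h x) <= \int[mu]_x (gJ J x * h x) <= \int[mu]_x (g x * h x) + 2^-1 ^+ J.
  apply/andP; split.
    by apply: le_Rint; [exact: bmfM|exact: bmfM|move=> x; rewrite ler_wpM2r//; case/andP: (gJE J x)].
  have b1 : bmf (fun x => g x * h x) by exact: bmfM.
  have b2 : bmf (fun x => 2^-1 ^+ J * h x) by exact: bmfZ.
  have b3 : bmf (fun x => gJ J x * h x) by exact: bmfM.
  have -> : \int[mu]_x (g x * h x) + 2^-1 ^+ J = \int[mu]_x (g x * h x + 2^-1 ^+ J * h x).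
    by rewrite (RintD mu b1 b2) (RintZ mu _ bh) h1 mulr1.
  apply: le_Rint => //; first exact: bmfD.
  by move=> x; rewrite -mulrDl ler_wpM2r//; case/andP: (gJE J x).
apply/eqP; rewrite eq_le; apply/andP; split; apply/ler_addgt0Pr => e /half_expn_lt[J Je];
  by have := n1 J; have := n2 J; rewrite gJI; lra.
Qed.

Definition density : probability T R := sval (cid ex_density).

Lemma pr_density B : prob_density -> measurable B ->
  prob density B = \int[mu]_x (\1_B x * h x).
Proof. by rewrite /density; case: cid => nu /= H /H[+ _]; apply. Qed.

Lemma Rint_density f : prob_density -> bmf f ->
  \int[density]_x f x = \int[mu]_x (f x * h x).
Proof. by rewrite /density; case: cid => nu /= H /H[_]; apply. Qed.

End density_measure.

(** * Densities prescribing the masses of pieces *)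

Definition masses d (T : measurableType d) (R : realType) (mu : probability T R)
  (phi : nat -> T -> R) (i : nat) : R := \int[mu]_x phi i x.

Section coupling.
Context d (T : measurableType d) (R : realType).
Variables (N : nat) (phi : nat -> T -> R) (tau : R).

(** Let [mu] give mass [a i] to the piece [phi i], and let a cell, among cells of
    equal probability, have mass [q i] on it, with average [b i] over the cells.
    If [a = b], the density [\sum_i q i / a i * phi i] has mass about [q i] on
    the piece [i], and its average over the cells is [\sum_i phi i].  Dividing
    by [slope], which is at least [a i] and [b i] and is positive, keeps this
    average at most 1 and makes the formula continuous where masses vanish.  The
    rest of the average, up to 1, is shared among the cells in proportion to
    the mass that they miss, their [deficit]. *)
Definition slope (a b : nat -> R) i := Num.max (a i) (b i) + tau.
Definition deficit (a b q : nat -> R) := 1 - \sum_(i < N) q i * a i / slope a b i.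
Definition coupling (a b q : nat -> R) x :=
  \sum_(i < N) q i / slope a b i * phi i x +
  deficit a b q / deficit a b b * (1 - \sum_(i < N) b i / slope a b i * phi i x).

Hypothesis tau0 : 0 < tau.
Hypothesis bmf_phi : forall i, bmf (phi i).
Hypothesis phi_ge0 : forall i x, 0 <= phi i x.
Hypothesis phi_le1 : forall x, \sum_(i < N) phi i x <= 1.
Variable mu : probability T R.
Local Notation a := (masses mu phi).

Let a_ge0 i : 0 <= a i. Proof. exact: Rint_ge0. Qed.

Let sum_a : \sum_(i < N) a i <= 1.
Proof.
rewrite /masses -Rint_sum// -(Rint_cst mu 1); apply: le_Rint => //; [exact: bmf_sum|exact: bmf_cst].
Qed.

Section masses.
Variables b : nat -> R.
Hypothesis b_ge0 : forall i, 0 <= b i.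
Hypothesis sum_b : \sum_(i < N) b i <= 1.

Lemma slope_gt0 i : 0 < slope a b i.
Proof. by rewrite ltr_wpDl// le_max a_ge0. Qed.

Let a_slope i : 0 <= a i / slope a b i <= 1.
Proof.
rewrite divr_ge0 ?a_ge0 ?(ltW (slope_gt0 i))//= ler_pdivrMr ?slope_gt0// mul1r.
by rewrite /slope ler_wpDr ?(ltW tau0)// le_max lexx.
Qed.

Let b_slope i : 0 <= b i / slope a b i <= 1.
Proof.
rewrite divr_ge0 ?b_ge0 ?(ltW (slope_gt0 i))//= ler_pdivrMr ?slope_gt0// mul1r.
by rewrite /slope ler_wpDr ?(ltW tau0)// le_max lexx orbT.
Qed.

Let gbar_itv x : 0 <= \sum_(i < N) b i / slope a b i * phi i x <= 1.
Proof.
apply/andP; split; first by apply: sumr_ge0 => i _; rewrite mulr_ge0//; case/andP: (b_slope i).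
apply: le_trans (phi_le1 x); apply: ler_sum => i _; apply: ler_piMl => //.
by case/andP: (b_slope i).
Qed.

Let bmf_gbar : bmf (fun x => \sum_(i < N) b i / slope a b i * phi i x).
Proof. by apply: bmf_sum => i; exact: bmfZ. Qed.

Lemma deficit_ge0 (q : nat -> R) : (forall i, 0 <= q i) -> \sum_(i < N) q i <= 1 -> 0 <= deficit a b q.
Proof.
move=> q0 q1; rewrite subr_ge0; apply: le_trans q1; apply: ler_sum => i _.
by rewrite -mulrA; apply: ler_piMr => //; case/andP: (a_slope i).
Qed.

Lemma deficit_gt0 : 0 < deficit a b b.
Proof.
rewrite subr_gt0; apply: (@le_lt_trans _ _ (\sum_(i < N) a i / (1 + tau))).
  apply: ler_sum => i _; have -> : b i * a i / slope a b i = a i * (b i / slope a b i) by ring.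
  apply: ler_wpM2l; first exact: a_ge0.
  have b1 : b i <= 1.
    apply: le_trans sum_b; rewrite (bigD1 i)//= lerDl; exact: sumr_ge0.
  rewrite ler_pdivrMr ?slope_gt0// mulrC ler_pdivlMr ?addr_gt0// /slope.
  have : b i <= Num.max (a i) (b i) by rewrite le_max lexx orbT.
  have : b i * tau <= tau by rewrite ler_piMl// ltW.
  by rewrite mulrDr mulr1; lra.
rewrite -mulr_suml ltr_pdivrMr ?addr_gt0// mul1r; have := sum_a; have := tau0; lra.
Qed.

Lemma coupling_density (q : nat -> R) : (forall i, 0 <= q i) -> \sum_(i < N) q i <= 1 ->
  prob_density mu (coupling a b q).
Proof.
move=> q0 q1; have d0 := deficit_ge0 q0 q1.
have bq : bmf (fun x => \sum_(i < N) q i / slope a b i * phi i x).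
  by apply: bmf_sum => i; exact: bmfZ.
have b1 : bmf (fun x => 1 - \sum_(i < N) b i / slope a b i * phi i x).
  by apply: bmfB => //; exact: bmf_cst.
have b2 : bmf (fun x => deficit a b q / deficit a b b * (1 - \sum_(i < N) b i / slope a b i * phi i x)).
  exact: bmfZ.
split; first exact: bmfD.
  move=> x; apply: addr_ge0.
    by apply: sumr_ge0 => i _; rewrite mulr_ge0// divr_ge0// ltW// slope_gt0.
  by rewrite mulr_ge0 ?divr_ge0 ?(ltW deficit_gt0)// subr_ge0; case/andP: (gbar_itv x).
rewrite (RintD mu bq b2) (RintZ mu _ b1) (RintB mu (bmf_cst _ 1) bmf_gbar) Rint_cst.
rewrite !Rint_sum; [|by move=> i; exact: bmfZ..].
have E (c : nat -> R) : \sum_(i < N) \int[mu]_x (c i / slope a b i * phi i x) = 1 - deficit a b c.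
  rewrite /deficit subKr; apply: eq_bigr => i _; rewrite RintZ// -/(masses mu phi i); ring.
by rewrite !E (subKr 1 (deficit a b b)) divfK ?gt_eqF ?deficit_gt0// subrK.
Qed.

(** Of the two terms of the density, the first gives [B] only the masses of the
    pieces that meet it, and the second has total mass [deficit a b q]. *)
Lemma coupling_mass (q : nat -> R) (bad : pred nat) B : (forall i, 0 <= q i) ->
  \sum_(i < N) q i <= 1 -> measurable B ->
  (forall i x, ~~ bad i -> B x -> phi i x = 0) ->
  prob (density mu (coupling a b q)) B <=
    \sum_(i < N) (if bad i then q i else 0) + deficit a b q.
Proof.
move=> q0 q1 mB bad0; have d0 := deficit_ge0 q0 q1.
have dens := coupling_density q0 q1; have [bh h0 h1] := dens.
rewrite pr_density//.
pose c i := (if bad i then q i else 0) / slope a b i.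
have bc : bmf (fun x => \sum_(i < N) c i * phi i x).
  by apply: bmf_sum => i; exact: bmfZ.
have b1 : bmf (fun x => 1 - \sum_(i < N) b i / slope a b i * phi i x).
  by apply: bmfB => //; exact: bmf_cst.
have b2 : bmf (fun x => deficit a b q / deficit a b b * (1 - \sum_(i < N) b i / slope a b i * phi i x)).
  exact: bmfZ.
apply: (@le_trans _ _ (\int[mu]_x (\sum_(i < N) c i * phi i x + deficit a b q / deficit a b b *
    (1 - \sum_(i < N) b i / slope a b i * phi i x)))).
  apply: le_Rint; [by apply: bmfM => //; exact: bmf_indic|exact: bmfD|].
  move=> x; rewrite indicE; have [xB|_] := boolP (x \in B); last first.
    rewrite mul0r; apply: addr_ge0.
      apply: sumr_ge0 => i _; rewrite mulr_ge0// divr_ge0 ?(ltW (slope_gt0 i))//.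
      by case: ifP.
    by rewrite mulr_ge0 ?divr_ge0 ?(ltW deficit_gt0)// subr_ge0; case/andP: (gbar_itv x).
  rewrite mul1r lerD2r; apply: ler_sum => i _; rewrite /c.
  by case: ifPn => // nb; rewrite bad0 ?mulr0//; rewrite inE in xB.
rewrite (RintD mu bc b2) (RintZ mu _ b1) (RintB mu (bmf_cst _ 1) bmf_gbar) Rint_cst.
rewrite !Rint_sum; [|by move=> i; exact: bmfZ..].
have E : \sum_(i < N) \int[mu]_x (b i / slope a b i * phi i x) = 1 - deficit a b b.
  rewrite /deficit subKr; apply: eq_bigr => i _; rewrite RintZ// -/(masses mu phi i); ring.
rewrite E (subKr 1 (deficit a b b)) divfK ?gt_eqF ?deficit_gt0// lerD2r; apply: ler_sum => i _.
rewrite RintZ// -/(masses mu phi i) /c mulrAC -mulrA; apply: ler_piMr; first by case: ifP.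
by case/andP: (a_slope i).
Qed.

(** The three terms are the mass [b] misses, the distance between [a] and [b], and
    the effect of [tau]. *)
Lemma deficit_le : deficit a b b <=
  (1 - \sum_(i < N) b i) + \sum_(i < N) `|a i - b i| + N%:R * tau.
Proof.
suff : \sum_(i < N) b i <= \sum_(i < N) (b i * a i / slope a b i + `|a i - b i| + tau).
  by rewrite !big_split/= sumr_const card_ord -mulr_natl /deficit; lra.
apply: ler_sum => i _; rewrite -addrA -lerBlDr.
rewrite ler_pdivlMr ?slope_gt0// /slope.
have := a_ge0 i; have := b_ge0 i; have := tau0.
have [ab|ba] := leP (a i) (b i).
  by rewrite ler0_norm ?subr_le0//; nra.
by rewrite gtr0_norm ?subr_gt0//; nra.
Qed.

End masses.

Lemma deficit_avg (b : nat -> R) (I : Type) (W : seq I) (u : R) (q : I -> nat -> R) :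
  \sum_(w <- W) u = 1 -> (forall i, (i < N)%N -> \sum_(w <- W) u * q w i = b i) ->
  \sum_(w <- W) u * deficit a b (q w) = deficit a b b.
Proof.
move=> u1 qb; under eq_bigr do rewrite mulrBr mulr1; rewrite sumrB u1; congr (_ - _).
under eq_bigr do rewrite mulr_sumr; rewrite exchange_big/=; apply: eq_bigr => i _.
by rewrite -qb// !mulr_suml; apply: eq_bigr => w _; rewrite !mulrA.
Qed.

Lemma coupling_avg (b : nat -> R) (I : Type) (W : seq I) (u : R) (q : I -> nat -> R) x :
  (forall i, 0 <= b i) -> \sum_(i < N) b i <= 1 ->
  \sum_(w <- W) u = 1 -> (forall i, (i < N)%N -> \sum_(w <- W) u * q w i = b i) ->
  \sum_(w <- W) u * coupling a b (q w) x = 1.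
Proof.
move=> b0 b1 u1 qb.
have E (c : nat -> R) : \sum_(w <- W) u * (\sum_(i < N) q w i * c i) = \sum_(i < N) b i * c i.
  under eq_bigr do rewrite mulr_sumr; rewrite exchange_big/=; apply: eq_bigr => i _.
  by rewrite -qb// mulr_suml; apply: eq_bigr => w _; rewrite mulrA.
have D := deficit_avg u1 qb.
under eq_bigr do rewrite /coupling mulrDr !mulrA.
rewrite big_split/= -!mulr_suml D mulfV ?mul1r ?gt_eqF ?deficit_gt0//.
rewrite (_ : \sum_(w <- W) u * _ = \sum_(i < N) b i / slope a b i * phi i x) ?[RHS]addrC ?subrK//.
  by rewrite [LHS]addrC subrK.
transitivity (\sum_(i < N) b i * ((slope a b i)^-1 * phi i x)); last first.
  by apply: eq_bigr => i _; rewrite mulrA.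
rewrite -(E (fun i => (slope a b i)^-1 * phi i x)); apply: eq_bigr => w _; congr (_ * _).
by apply: eq_bigr => i _; rewrite mulrA.
Qed.

End coupling.

(** * Variables of given law close to a given variable *)

Lemma cvg_maxr (R : realType) (I : Type) (F : set_system I) (FF : Filter F)
    (f g : I -> R) a b : f i @[i --> F] --> a -> g i @[i --> F] --> b ->
  Num.max (f i) (g i) @[i --> F] --> Num.max a b.
Proof.
move=> /cvgrPdist_lt fa /cvgrPdist_lt gb; apply/cvgrPdist_le => e e0.
near=> i; apply: lipschitz_max.
  by apply: ltW; near: i; exact: fa.
by apply: ltW; near: i; exact: gb.
Unshelve. all: by end_near. Qed.

Section law_continuity.
Context (R : realType) (S : polishMetricType R) d (T : measurableType d) (P : probability T R).
Local Notation pr := (prob P).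

(** The integrands differ by at most [`|k| * e] off the event that [Y i] and [Y0]
    are at distance at least [e], and by at most 1 on it. *)
Lemma cvg_Rint_prob (I : Type) (F : set_system I) (FF : Filter F)
    (Y : I -> T -> borel S) (Y0 : T -> borel S)
    (g : S -> R) k (A : set T) :
  (forall i, measurable_fun setT (Y i)) -> measurable_fun setT Y0 ->
  (forall x, 0 <= g x <= 1) -> (forall x y, `|g x - g y| <= k * mdist x y) ->
  measurable A -> cvg_prob P F Y Y0 ->
  \int[P]_w (\1_A w * g (Y i w)) @[i --> F] --> \int[P]_w (\1_A w * g (Y0 w)).
Proof.
move=> mY mY0 g01 gk mA YY0.
have mg : measurable_fun setT (g : borel S -> R).
  by apply: continuous_borel; exact: lipschitz_continuous gk.
have bgY (Z : T -> borel S) : measurable_fun setT Z -> bmf (fun w => g (Z w)).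
  move=> mZ; apply: bmf01 => [|w]; last exact: g01.
  exact: (measurableT_comp mg mZ).
have bA := bmf_indic R mA.
apply/cvgrPdist_le => e e0.
have k0 : 0 < `|k| + 1 by rewrite ltr_wpDl.
pose e1 := e / (`|k| + 2).
have k2 : 0 < `|k| + 2 by rewrite ltr_wpDl.
have e10 : 0 < e1 by rewrite divr_gt0.
have eE : e = `|k| * e1 + 2 * e1 by rewrite -mulrDl mulrC divfK// gt_eqF.
have := YY0 _ e10; apply: filterS => i Yi.
set D := [set w | _] in Yi.
have mD : measurable D by exact: measurable_mdist_ge.
have b1 := bmfM bA (bgY _ mY0); have b2 := bmfM bA (bgY _ (mY i)).
have b3 : bmf (fun w => `|k| * e1 + \1_D w) by apply: bmfD; [exact: bmf_cst|exact: bmf_indic].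
have pt w : `|\1_A w * g (Y0 w) - \1_A w * g (Y i w)| <= `|k| * e1 + \1_D w.
  rewrite -mulrBr normrM.
  apply: (@le_trans _ _ `|g (Y0 w) - g (Y i w)|).
    by rewrite ler_piMl// indicE; case: (_ \in _); rewrite ?normr1 ?normr0.
  rewrite indicE; have [_|wD] := boolP (w \in D).
    have := g01 (Y0 w); have := g01 (Y i w); have : 0 <= `|k| * e1 by rewrite mulr_ge0// ltW.
    by rewrite mulr1n ler_norml; lra.
  rewrite mulr0n addr0; apply: le_trans (gk _ _) _.
  apply: (@le_trans _ _ (`|k| * mdist (Y0 w : S) (Y i w))).
    by rewrite ler_wpM2r ?mdist_ge0// ler_norm.
  rewrite ler_wpM2l// metric_sym ltW// ltNge; apply: contra wD => h.
  by rewrite inE.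
have le1 : `|\int[P]_w (\1_A w * g (Y0 w)) - \int[P]_w (\1_A w * g (Y i w))| <=
    \int[P]_w (`|k| * e1 + \1_D w).
  rewrite -(RintB P b1 b2) ler_norml; apply/andP; split.
    rewrite -mulN1r -(RintZ P _ b3); apply: le_Rint; [exact: bmfZ|exact: bmfB|].
    by move=> w; have := pt w; rewrite ler_norml; lra.
  by apply: le_Rint; [exact: bmfB|exact: b3|move=> w; have := pt w; rewrite ler_norml; lra].
apply: le_trans le1 _; rewrite (RintD P (bmf_cst _ _) (bmf_indic R mD)) Rint_cst Rint_indic//.
by lra.
Qed.

End law_continuity.

Section cells.
Context d (T : measurableType d) (R : realType) (P : probability T R).
Local Notation pr := (prob P).

Lemma sum_bitseqs m : \sum_(v <- bitseqs m) 2^-1 ^+ m = 1 :> R.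
Proof.
rewrite big_const_seq count_predT size_bitseqs iter_addr addr0 -[LHS]mulr_natl natrX -exprMn.
by rewrite mulfV// expr1n.
Qed.

Lemma pr_cells (B : nat -> set T) m (A : set T) : (forall n, measurable (B n)) ->
  measurable A -> pr A = \sum_(v <- bitseqs m) pr (atom B m v `&` A).
Proof.
move=> mB mA; have := pr_word P predT m mB mA.
rewrite (_ : [set w | _] = setT) ?setIT; last by apply/seteqP; split.
by move=> ->; apply: eq_bigr => v _; rewrite setIC.
Qed.

Lemma sum_cells (B : nat -> set T) m (f : seq bool -> R) w :
  \sum_(v <- bitseqs m) \1_(atom B m v) w * f v = f (word B m w).
Proof.
rewrite (bigD1_seq (word B m w)) ?uniq_bitseqs ?mem_bitseqs ?size_word//=.
rewrite indicE mem_set ?mul1r// big1 ?addr0// => v vw.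
by rewrite indicE memNset ?mul0r// /atom/= => E; rewrite E eqxx in vw.
Qed.

Lemma measurable_by_cells (B : nat -> set T) m d' (T' : measurableType d') (f : T -> T')
    (g : seq bool -> T -> T') : (forall n, measurable (B n)) ->
  (forall v, measurable_fun setT (g v)) -> (forall w, f w = g (word B m w) w) ->
  measurable_fun setT f.
Proof.
move=> mB mg fg _ C mC; rewrite setTI.
rewrite (_ : _ @^-1` _ = \big[setU/set0]_(v <- bitseqs m) (atom B m v `&` (g v @^-1` C))).
  apply: bigsetU_measurable => v _; apply: measurableI; first exact: measurable_atom.
  by rewrite -[X in measurable X]setTI; exact: mg.
rewrite -bigcup_seq; apply/seteqP; split => w /=.
  by rewrite fg => Cw; exists (word B m w) => //=; rewrite mem_bitseqs size_word.
by move=> [v _ [/= <-]]; rewrite fg.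
Qed.

End cells.

Section levels.
Context (R : realType) (S : polishMetricType R).
Variable s : nat -> S.
Hypothesis sP : forall y e, 0 < e -> exists n, mdist (s n) y < e.
Context d (T : measurableType d) (P : probability T R).
Local Notation pr := (prob P).
Variables (B : nat -> set T) (V W : nat -> T -> R).
Hypothesis dB : dyadic P B.
Hypothesis mVW : forall m, measurable_fun setT (V m) /\ measurable_fun setT (W m).
Hypothesis VW01 : forall m w, 0 <= V m w < 1 /\ 0 <= W m w < 1.
Hypothesis VWP : forall m m' v th, size v = m -> (m <= m')%N -> 0 <= th <= 1 ->
  pr (atom B m v `&` [set w | W m' w < th]) = 2^-1 ^+ m * th /\
  uniform_on P (atom B m v `&` [set w | W m' w < th]) (V m).

Variables (N : nat) (tau eps : R) (m : nat).
Hypotheses (tau0 : 0 < tau) (eps0 : 0 < eps).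

Let phi i : borel S -> R := punity s eps i.

(** The conditional expectation given the atom [v], whose probability is 2^-m. *)
Definition cell_mass (Y : T -> borel S) (v : seq bool) (i : nat) : R :=
  2 ^+ m * \int[P]_w (\1_(atom B m v) w * phi i (Y w)).

Definition total_mass (Y : T -> borel S) (i : nat) : R := \int[P]_w phi i (Y w).

Definition cell_density mu Y v := coupling N phi tau (masses mu phi) (total_mass Y) (cell_mass Y v).

(** On the atom [v], a value drawn from [mu] modified so as to imitate the
    conditional law of [Y]. *)
Definition level mu Y (w : T) : borel S :=
  quantile s (density mu (cell_density mu Y (word B m w))) (V m w).

Let mB n : measurable (B n). Proof. by have [] := dB. Qed.
Let mA v : measurable (atom B m v). Proof. exact: measurable_atom. Qed.
Let u0 : 0 < 2^-1 ^+ m :> R. Proof. by rewrite exprn_gt0// invr_gt0. Qed.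
Let uK : 2^-1 ^+ m * 2 ^+ m = 1 :> R. Proof. by rewrite -exprMn mulVf// expr1n. Qed.

Lemma bmf_phi i : bmf (phi i).
Proof. by apply: bmf01; [apply: continuous_borel; exact: continuous_punity|exact: punity_itv]. Qed.

Lemma phi_ge0 i x : 0 <= phi i x.
Proof. by case/andP: (punity_itv s eps i x). Qed.

Lemma phi_sum x : \sum_(i < N) phi i x <= 1.
Proof. by rewrite sum_punity; case/andP: (bumps_itv s eps N x). Qed.

Lemma atom_uniform v : size v = m ->
  pr (atom B m v) = 2^-1 ^+ m /\ uniform_on P (atom B m v) (V m).
Proof.
move=> vm; have [|E U] := VWP vm (leqnn m) (th := 1); first by rewrite ler01 lexx.
have atomE : atom B m v `&` [set w | W m w < 1] = atom B m v.
  by apply/seteqP; split => w; [case|move=> ?; split => //=; have [_ /andP[]] := VW01 m w].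
by move: E U; rewrite atomE mulr1.
Qed.

Section fixed.
Variables (mu : probability (borel S) R) (Y : T -> borel S) (mY : measurable_fun setT Y).

Let bphiY i : bmf (fun w => phi i (Y w)).
Proof.
apply: bmf01 => [|w]; last exact: punity_itv.
by apply: measurableT_comp mY; have [] := bmf_phi i.
Qed.

Let bAphiY v i : bmf (fun w => \1_(atom B m v) w * phi i (Y w)).
Proof. by apply: bmfM => //; exact: bmf_indic. Qed.

Lemma cell_mass_ge0 v i : 0 <= cell_mass Y v i.
Proof.
by rewrite mulr_ge0 ?exprn_ge0//; apply: Rint_ge0 => w; rewrite mulr_ge0 ?phi_ge0.
Qed.

Lemma total_mass_ge0 i : 0 <= total_mass Y i.
Proof. by apply: Rint_ge0 => w; exact: phi_ge0. Qed.

Lemma total_mass_sum : \sum_(i < N) total_mass Y i <= 1.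
Proof.
rewrite -Rint_sum// -(Rint_cst P 1); apply: le_Rint; [exact: bmf_sum|exact: bmf_cst|].
by move=> w; exact: phi_sum.
Qed.

Lemma cell_mass_sum v : size v = m -> \sum_(i < N) cell_mass Y v i <= 1.
Proof.
move=> vm; rewrite -mulr_sumr -Rint_sum//.
have E1 : 2 ^+ m * pr (atom B m v) = 1.
  by have [_ /(_ v)] := dB; rewrite vm => ->; rewrite mulrC uK.
rewrite -[leRHS]E1 ler_wpM2l ?exprn_ge0// -Rint_indic//; apply: le_Rint; [exact: bmf_sum|exact: bmf_indic|].
move=> w; rewrite -mulr_sumr; apply: ler_piMr; last exact: phi_sum.
by rewrite indicE; case: (_ \in _).
Qed.

Lemma cell_mass_avg i : \sum_(v <- bitseqs m) 2^-1 ^+ m * cell_mass Y v i = total_mass Y i.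
Proof.
rewrite (eq_bigr (fun v => \int[P]_w (\1_(atom B m v) w * phi i (Y w)))); last first.
  by move=> v _; rewrite /cell_mass mulrA uK mul1r.
rewrite -Rint_sum//; apply: eq_Rintegral => w _.
by rewrite (sum_cells B m (fun=> phi i (Y w))).
Qed.

Lemma cell_densityP v : size v = m -> prob_density mu (cell_density mu Y v).
Proof.
move=> vm; apply: coupling_density => //;
  do ?[exact: bmf_phi|exact: phi_ge0|exact: phi_sum|exact: total_mass_ge0|
       exact: total_mass_sum|exact: cell_mass_ge0|exact: cell_mass_sum].
Qed.

Lemma measurable_level : measurable_fun setT (level mu Y).
Proof.
have [mV _] := mVW m.
apply: (@measurable_by_cells _ T B m _ (borel S) _
  (fun v w => quantile s (density mu (cell_density mu Y v)) (V m w))) => // v.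
by apply: (measurable_quantile sP mV) => w; have [] := VW01 m w.
Qed.

(** The densities average to 1 over the atoms, and the event on [W m'] is
    independent of the atom and of [V m], from which [level] is computed. *)
Lemma law_level m' th (C : set (borel S)) : (m <= m')%N -> 0 <= th <= 1 -> measurable C ->
  pr ([set w | W m' w < th] `&` [set w | C (level mu Y w)]) = th * prob mu C.
Proof.
move=> mm' th01 mC; have [mV _] := mVW m; have [_ mW] := mVW m'.
have mWth : measurable [set w | W m' w < th] by exact: measurable_lt_cst.
have mCl : measurable [set w | C (level mu Y w)].
  by rewrite -[X in measurable X]setTI; exact: (measurable_level measurableT mC).
rewrite (pr_cells P m mB); last exact: measurableI.
rewrite big_seq (eq_bigr (fun v => th * (2^-1 ^+ m * \int[mu]_x (\1_C x * cell_density mu Y v x)))); last first.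
  move=> v; rewrite mem_bitseqs => /eqP vm.
  have [pE unif] := VWP vm mm' th01.
  rewrite (_ : _ `&` _ = (atom B m v `&` [set w | W m' w < th]) `&`
      [set w | C (quantile s (density mu (cell_density mu Y v)) (V m w))]); last first.
    apply/seteqP; split => w; rewrite /level/=.
      by move=> [E [h1]]; rewrite E => h2; split; [split; [exact: E|exact: h1]|exact: h2].
    by move=> [[E h1] h2]; split; [exact: E|split; [exact: h1|rewrite E; exact: h2]].
  rewrite (law_quantile sP mV) => //; [|by move=> w; have [] := VW01 m w|exact: measurableI].
  by rewrite pE pr_density//; [ring|exact: cell_densityP].
rewrite -big_seq -mulr_sumr; congr (_ * _).
have bh v : bmf (fun x => \1_C x * cell_density mu Y v x).
  apply: bmfM; first exact: bmf_indic.
  apply: bmfD; first by apply: bmf_sum => i; apply: bmfZ; exact: bmf_phi.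
  apply: bmfZ; apply: bmfB; first exact: bmf_cst.
  by apply: bmf_sum => i; apply: bmfZ; exact: bmf_phi.
under eq_bigr do rewrite -(RintZ mu _ (bh _)).
rewrite -Rint_sum; last by move=> v; exact: bmfZ.
rewrite -Rint_indic//; apply: eq_Rintegral => x _.
under eq_bigr do rewrite mulrCA; rewrite -mulr_sumr.
rewrite coupling_avg ?mulr1//;
  do ?[exact: bmf_phi|exact: phi_ge0|exact: phi_sum|exact: total_mass_ge0|
       exact: total_mass_sum|exact: sum_bitseqs].
by move=> i _; exact: cell_mass_avg.
Qed.

(** The variable [Y] is within [eps] of the constant [y v] on each atom [v], off an
    event of probability [eta].  Given [v], the pieces with a center farther than
    [2 * eps] from [y v] have total mass at most the conditional probability of
    that event, and all others stay within [3 * eps] of [y v].  By [coupling_mass],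
    [level] is farther than this from [y v] with probability at most [eta] plus
    the average deficit. *)
Lemma level_close (y : seq bool -> S) eta :
  pr [set w | eps <= mdist (Y w : S) (y (word B m w))] <= eta ->
  pr [set w | 4 * eps <= mdist (level mu Y w : S) (Y w : S)] <=
  2 * eta + ((1 - \sum_(i < N) total_mass Y i) +
    \sum_(i < N) `|masses mu phi i - total_mass Y i| + N%:R * tau).
Proof.
have [mV _] := mVW m.
have myw : measurable_fun setT (fun w => y (word B m w) : borel S).
  by apply: (@measurable_by_cells _ T B m _ (borel S) _ (fun v _ => y v)) => // v; exact: measurable_cst.
set D := [set w | eps <= _]; move=> Deta.
have mD : measurable D by exact: measurable_mdist_ge.
set D2 := [set w | _].
have mD2 : measurable D2 by apply: measurable_mdist_ge => //; exact: measurable_level.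
pose D3 := [set w | 3 * eps <= mdist (level mu Y w : S) (y (word B m w))].
have mD3 : measurable D3 by apply: measurable_mdist_ge => //; exact: measurable_level.
apply: (@le_trans _ _ (pr (D `|` D3))).
  apply: le_pr => //; first exact: measurableU.
  move=> w; rewrite /D2/= => h; have [h1|h1] := leP eps (mdist (Y w : S) (y (word B m w))).
    by left.
  right; rewrite /D3/=; have := metric_triangle (level mu Y w : S) (y (word B m w)) (Y w).
  by rewrite (metric_sym (y _)); lra.
apply: le_trans (prU_le _ mD mD3) _.
suff D3le : pr D3 <= eta + deficit N tau (masses mu phi) (total_mass Y) (total_mass Y).
  have := deficit_le N tau0 phi_ge0 mu total_mass_ge0.
  by lra.
rewrite (pr_cells P m mB mD3).
pose bad v : pred nat := fun i => 2 * eps < mdist (s i) (y v).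
pose far v : set (borel S) := [set x : S | 3 * eps <= mdist x (y v)].
have mfar v : measurable (far v).
  rewrite (_ : far v = ~` [set x : S | mdist (y v) x < 3 * eps]).
    apply: measurableC; apply: open_borel; apply/open_mdistP => x /= yx.
    exists (3 * eps - mdist (y v) x); first by rewrite subr_gt0.
    by move=> x' xx'; apply: le_lt_trans (metric_triangle _ x _) _; lra.
  by apply/seteqP; split => x /=; rewrite /far/= metric_sym leNgt => /negP.
apply: (@le_trans _ _ (\sum_(v <- bitseqs m) (2^-1 ^+ m *
    (\sum_(i < N) (if bad v i then cell_mass Y v i else 0) +
     deficit N tau (masses mu phi) (total_mass Y) (cell_mass Y v))))).
  rewrite big_seq [leRHS]big_seq; apply: ler_sum => v; rewrite mem_bitseqs => /eqP vm.
  have [pE unif] := atom_uniform vm.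
  rewrite (_ : _ `&` _ = atom B m v `&`
      [set w | far v (quantile s (density mu (cell_density mu Y v)) (V m w))]); last first.
    apply/seteqP; split => w /= [E]; first by rewrite /D3/= /level E.
    by rewrite /D3/= /level E.
  rewrite (law_quantile sP mV) => //; last by move=> w; have [] := VW01 m w.
  rewrite pE ler_wpM2l ?(ltW u0)//; apply: coupling_mass => //;
    do ?[exact: bmf_phi|exact: phi_ge0|exact: phi_sum|exact: total_mass_ge0|
       exact: total_mass_sum|exact: cell_mass_ge0|exact: cell_mass_sum].
  move=> i x nb xfar; apply/eqP; apply: contraNT nb => /(punity_neq0 eps0) ix.
  by have := metric_triangle x (s i) (y v); rewrite /bad (metric_sym x (s i)); move: xfar; rewrite /far/=; lra.
under eq_bigr do rewrite mulrDr; rewrite big_split/=; apply: lerD; last first.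
  rewrite deficit_avg; [by []|exact: sum_bitseqs|].
  by move=> i _; exact: cell_mass_avg.
pose g v w := \sum_(i < N) (if bad v i then phi i (Y w) else 0).
have bg v : bmf (g v).
  by apply: bmf_sum => i; case: (bad v i) => //; exact: bmf_cst.
have bAg v : bmf (fun w => \1_(atom B m v) w * g v w) by apply: bmfM => //; exact: bmf_indic.
rewrite (eq_bigr (fun v => \int[P]_w (\1_(atom B m v) w * g v w))); last first.
  move=> v _; rewrite mulr_sumr.
  transitivity (\int[P]_w (\sum_(i < N) (if bad v i then \1_(atom B m v) w * phi i (Y w) else 0))).
    rewrite Rint_sum; last by move=> i; case: (bad v i) => //; exact: bmf_cst.
    apply: eq_bigr => i _; case: (bad v i); first by rewrite /cell_mass mulrA uK mul1r.
    by rewrite mulr0 Rint_cst.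
  apply: eq_Rintegral => w _; rewrite mulr_sumr; apply: eq_bigr => i _.
  by case: ifP; rewrite ?mulr0.
rewrite -Rint_sum//; apply: le_trans Deta; rewrite -Rint_indic//.
apply: le_Rint; [exact: bmf_sum|exact: bmf_indic|].
move=> w; rewrite (sum_cells B m (g ^~ w)) indicE /g.
have [wD|wD] := boolP (w \in D).
  apply: le_trans (phi_sum (Y w)); apply: ler_sum => i _; case: ifP => // _; exact: phi_ge0.
rewrite big1// => i _; case: ifPn => // ib; apply/eqP; apply: contraNT wD => /(punity_neq0 eps0) iY.
rewrite inE /D/=; move: ib; rewrite /bad.
have := metric_triangle (s i) (Y w : S) (y (word B m w)); lra.
Qed.

End fixed.

(** The masses, hence the densities, depend continuously on [mu] and [Y], and
    [cvg_quantile] applies on each atom.  For [N = 0] the densities are constant,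
    whence the restriction on the convergence of [Y]. *)
Lemma cvg_level (I : Type) (F : set_system I) (FF : Filter F)
    (mu : I -> probability (borel S) R) mu0 (Y : I -> T -> borel S) Y0 :
  (forall i, measurable_fun setT (Y i)) -> measurable_fun setT Y0 ->
  cvg_law F mu mu0 -> ((0 < N)%N -> cvg_prob P F Y Y0) ->
  cvg_prob P F (fun i => level (mu i) (Y i)) (level mu0 Y0).
Proof.
move=> mY mY0 cmu cY.
have [mV _] := mVW m.
have phi01 i x : 0 <= phi i x <= 1 by exact: punity_itv.
have cphi i : continuous (phi i : S -> R) by exact: continuous_punity.
have bphi i : bounded_fun (phi i : S -> R).
  by apply/bounded_funE; exists 1 => y; have /andP[? ?] := phi01 i y; rewrite ger0_norm.
have cmass j : masses (mu i) phi j @[i --> F] --> masses mu0 phi j by exact: cmu.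
have ctot (j : 'I_N) : total_mass (Y i) j @[i --> F] --> total_mass Y0 j.
  have N0 : (0 < N)%N by exact: leq_ltn_trans (ltn_ord j).
  have := cvg_Rint_prob FF mY mY0 (phi01 j) (fun x y => lipschitz_punity s j x y eps0) measurableT (cY N0).
  rewrite /total_mass; under eq_fun do under eq_Rintegral do rewrite indicT mul1r.
  by under eq_Rintegral do rewrite indicT mul1r.
have ccell v (j : 'I_N) : cell_mass (Y i) v j @[i --> F] --> cell_mass Y0 v j.
  have N0 : (0 < N)%N by exact: leq_ltn_trans (ltn_ord j).
  apply: cvgM; first exact: cvg_cst.
  exact: (cvg_Rint_prob FF mY mY0 (phi01 j) (fun x y => lipschitz_punity s j x y eps0) (mA v) (cY N0)).
have slope0 mu' Y' j : measurable_fun setT Y' -> 0 < slope tau (masses mu' phi) (total_mass Y') j.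
  by move=> mY'; apply: slope_gt0 => //; exact: phi_ge0.
have cslope (j : 'I_N) : slope tau (masses (mu i) phi) (total_mass (Y i)) j @[i --> F] -->
    slope tau (masses mu0 phi) (total_mass Y0) j.
  by apply: cvgD; [exact: cvg_maxr|exact: cvg_cst].
have cdiv (f : I -> R) (a : R) (j : 'I_N) : f i @[i --> F] --> a ->
    f i / slope tau (masses (mu i) phi) (total_mass (Y i)) j @[i --> F] -->
    a / slope tau (masses mu0 phi) (total_mass Y0) j.
  by move=> fa; apply: cvgM => //; apply: cvgV => //; rewrite gt_eqF ?slope0.
have cdef (f : I -> nat -> R) (a : nat -> R) : (forall j : 'I_N, f i j @[i --> F] --> a j) ->
    deficit N tau (masses (mu i) phi) (total_mass (Y i)) (f i) @[i --> F] -->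
    deficit N tau (masses mu0 phi) (total_mass Y0) a.
  move=> fa; apply: cvgB; first exact: cvg_cst.
  by apply: cvg_sumr => j; apply: cdiv; apply: cvgM.
have claw v : size v = m ->
    cvg_law F (fun i => density (mu i) (cell_density (mu i) (Y i) v)) (density mu0 (cell_density mu0 Y0 v)).
  move=> vm f cf bf.
  have bmff : bmf (f : borel S -> R).
    by split; [exact: continuous_borel|exact/bounded_funE].
  have bfphi j : bmf (fun x : borel S => f x * phi j x) by apply: bmfM => //; exact: bmf_phi.
  have key mu' Y' : measurable_fun setT Y' ->
      \int[density mu' (cell_density mu' Y' v)]_x f x =
      \sum_(j < N) cell_mass Y' v j / slope tau (masses mu' phi) (total_mass Y') j *
         \int[mu']_x (f x * phi j x) +
      deficit N tau (masses mu' phi) (total_mass Y') (cell_mass Y' v) /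
      deficit N tau (masses mu' phi) (total_mass Y') (total_mass Y') *
      (\int[mu']_x f x - \sum_(j < N) total_mass Y' j / slope tau (masses mu' phi) (total_mass Y') j *
         \int[mu']_x (f x * phi j x)).
    move=> mY'; rewrite Rint_density//; last exact: cell_densityP.
    pose L (c : nat -> R) (x : borel S) : R := \sum_(j < N) c j * (f x * phi j x).
    have bL c : bmf (L c) by apply: bmf_sum => j; exact: bmfZ.
    have IL c : \int[mu']_x L c x = \sum_(j < N) c j * \int[mu']_x (f x * phi j x).
      rewrite Rint_sum; last by move=> j; exact: bmfZ.
      by apply: eq_bigr => j _; rewrite RintZ.
    have LE c x : L c x = f x * \sum_(j < N) c j * phi j x.
      by rewrite mulr_sumr; apply: eq_bigr => j _; rewrite mulrCA.
    pose c1 j := cell_mass Y' v j / slope tau (masses mu' phi) (total_mass Y') j.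
    pose c2 j := total_mass Y' j / slope tau (masses mu' phi) (total_mass Y') j.
    set r := _ / _.
    rewrite -(IL c1) -(IL c2) -(RintB mu' bmff (bL c2)).
    have b3 : bmf (fun x : borel S => f x - L c2 x) by exact: bmfB.
    rewrite -(RintZ mu' r b3) -RintD//; last exact: bmfZ.
    by apply: eq_Rintegral => x _; rewrite !LE /cell_density /coupling -/r mulrDr; congr (_ + _); ring.
  rewrite key//; under eq_fun do rewrite key//.
  have cfphi j : \int[mu i]_x (f x * phi j x) @[i --> F] --> \int[mu0]_x (f x * phi j x).
    apply: cmu; first by move=> x; apply: cvgM; [exact: cf|exact: cphi].
    by apply/bounded_funE; case: (bfphi j).
  apply: cvgD.
    by apply: cvg_sumr => j; apply: cvgM => //; apply: cdiv; exact: ccell.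
  apply: cvgM; last first.
    apply: cvgB; first exact: cmu.
    by apply: cvg_sumr => j; apply: cvgM => //; exact: cdiv.
  apply: cvgM; first exact: cdef.
  apply: cvgV; last exact: cdef.
  rewrite gt_eqF//; apply: deficit_gt0 => //;
    do ?[exact: bmf_phi|exact: phi_ge0|exact: phi_sum|exact: total_mass_ge0|exact: total_mass_sum].
move=> e e0.
pose D i := [set w | e <= mdist (level (mu i) (Y i) w : S) (level mu0 Y0 w)].
have mD i : measurable (D i) by apply: measurable_mdist_ge; exact: measurable_level.
have : (fun i => \sum_(v <- bitseqs m) pr (atom B m v `&` D i)) @ F --> (0 : R).
  have := @cvg_sumr R _ (bitseqs m) _ F FF (fun v i => pr (atom B m v `&` D i)) (fun=> 0).
  rewrite big1//; apply => v; apply/cvgrPdist_le => e' e'0.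
  have [vm|vm] := eqVneq (size v) m; last first.
    near=> i; rewrite (_ : atom B m v = set0) ?set0I ?pr0 ?subrr ?normr0 ?ltW//.
    by rewrite -subset0 => w; rewrite /atom/= => E; rewrite -E size_word eqxx in vm.
  have [_ U] := atom_uniform vm.
  have := cvg_quantile sP mV (fun w => (VW01 m w).1) (mA v) U FF (claw v vm) e0 e'0.
  have DE i : atom B m v `&` D i = atom B m v `&` [set w | e <=
      mdist (quantile s (density (mu i) (cell_density (mu i) (Y i) v)) (V m w))
            (quantile s (density mu0 (cell_density mu0 Y0 v)) (V m w))].
    apply/seteqP; split => w [E h]; (split; first exact: E);
      by move: h; rewrite /D /level /= E; apply.
  move=> H; near=> i; rewrite sub0r normrN ger0_norm; last exact: pr_ge0.
  by rewrite DE; near: i; exact: H.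
move=> /cvgrPdist_lt/(_ _ e0); apply: filterS => i.
rewrite -(pr_cells P m mB (mD i)) sub0r normrN => h.
exact: ltW (le_lt_trans (ler_norm _) h).
Unshelve. all: by end_near. Qed.

End levels.

(** * Gluing a sequence of variables *)

Section glue.
Context (R : realType) (S : polishMetricType R) d (T : measurableType d) (P : probability T R).
Local Notation pr := (prob P).
Variables (U : Type) (z_ : nat -> U -> T -> borel S) (W : nat -> T -> R) (theta : nat -> U -> R).
Variable mu : U -> probability (borel S) R.
Hypothesis mz : forall k t, measurable_fun setT (z_ k t).
Hypothesis mW : forall k, measurable_fun setT (W k).
Hypothesis W01 : forall k w, 0 <= W k w < 1.
Hypothesis unifW : forall k th, 0 <= th <= 1 -> pr [set w | W k w < th] = th.
Hypothesis theta01 : forall k t, 0 <= theta k t <= 1.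
Hypothesis lawz : forall k t th C, 0 <= th <= 1 -> measurable C ->
  pr ([set w | W k w < th] `&` [set w | C (z_ k t w)]) = th * prob (mu t) C /\
  pr ([set w | W k w < th] `&` [set w | C (z_ k.+1 t w)]) = th * prob (mu t) C.

(** The first level accepted, level [k] being accepted with probability
    [1 - theta k t]. *)
Definition stop t w : nat :=
  if pselect (exists k, theta k t <= W k w) is left e then ex_minn e else 0%N.

Definition glued t w := z_ (stop t w) t w.

(** Only the levels [k] and [k.+1] can be selected, with the event
    [W k w < theta k t] deciding between them ([gluedE]). *)
Definition active k t := [/\ forall j, (j < k)%N -> theta j t = 1, theta k t < 1 &
  forall j, (k < j)%N -> theta j t = 0].

Lemma stopE k t w : active k t -> stop t w = if theta k t <= W k w then k else k.+1.
Proof.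
move=> [lt1 _ gt0]; have W1 j : W j w < 1 by case/andP: (W01 j w).
have W0 j : 0 <= W j w by case/andP: (W01 j w).
rewrite /stop; case: pselect => [e|]; last first.
  by move=> ne; exfalso; apply: ne; exists k.+1; rewrite gt0.
case: ex_minnP => j tj jmin.
have kj : (k <= j)%N by rewrite leqNgt; apply/negP => jk; move: tj; rewrite lt1// leNgt W1.
case: ifPn => [tk|tk]; apply/eqP; rewrite eqn_leq.
  by rewrite kj jmin.
rewrite jmin ?gt0//= ltn_neqAle kj andbT; apply: contraNneq tk => -> //.
Qed.

Lemma gluedE k t w : active k t ->
  glued t w = if theta k t <= W k w then z_ k t w else z_ k.+1 t w.
Proof. by move=> kt; rewrite /glued (stopE w kt); case: ifP. Qed.

Lemma measurable_glued k t : active k t -> measurable_fun setT (glued t).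
Proof.
move=> kt; rewrite (_ : glued t = fun w => if theta k t <= W k w then z_ k t w else z_ k.+1 t w).
  apply: measurable_fun_ifT => //.
  by apply: measurable_fun_ler => //; exact: measurable_cst.
by apply/funext => w; exact: gluedE.
Qed.

Let mWlt k th : measurable [set w | W k w < th]. Proof. exact: measurable_lt_cst. Qed.

Let mzC k t (C : set (borel S)) : measurable C -> measurable [set w | C (z_ k t w)].
Proof. by move=> mC; rewrite -[X in measurable X]setTI; exact: (mz k t measurableT mC). Qed.

(** The event that decides between [z_ k] and [z_ k.+1] is independent of each. *)
Lemma law_glued k t C : active k t -> measurable C -> pr [set w | C (glued t w)] = prob (mu t) C.
Proof.
move=> kt mC; have [l1 _] := lawz k t (theta01 k t) mC.
have [_ l2] := lawz k t (theta01 k t) mC.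
have l01 : 0 <= (1 : R) <= 1 by rewrite ler01 lexx.
have [l3 _] := lawz k t l01 mC.
have {}l3 : pr [set w | C (z_ k t w)] = prob (mu t) C.
  rewrite -[RHS]mul1r -l3; congr pr.
  apply/seteqP; split => w; last by case.
  by move=> Cw; split; [rewrite /=; case/andP: (W01 k w)|exact: Cw].
have mCg : measurable [set w | C (glued t w)].
  by rewrite -[X in measurable X]setTI; exact: (measurable_glued kt measurableT mC).
rewrite (pr_split P mCg (mWlt k (theta k t))).
rewrite (_ : _ `&` _ = [set w | W k w < theta k t] `&` [set w | C (z_ k.+1 t w)]); last first.
  rewrite setIC; apply/seteqP; split => w [/= h]; rewrite (gluedE w kt) leNgt h /= => h2; by split.
rewrite (_ : _ `\` _ = [set w | C (z_ k t w)] `\` ([set w | W k w < theta k t] `&` [set w | C (z_ k t w)])).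
  rewrite prD; [by rewrite l1 l2 l3; ring|exact: mzC| |by move=> w []].
  by apply: measurableI => //; exact: mzC.
apply/seteqP; split => w [/= h1 h2].
  have tk : theta k t <= W k w by rewrite leNgt; apply/negP.
  by move: h1; rewrite (gluedE w kt) tk => h1; split => // -[].
have tk : theta k t <= W k w by rewrite leNgt; apply/negP => h; apply: h2.
by rewrite (gluedE w kt) tk; split => // h; apply: h2.
Qed.

Lemma glued_close k t j0 (Y : T -> borel S) e c : measurable_fun setT Y -> active k t ->
  (forall j, (j < j0.+1)%N -> theta j t = 1) ->
  (forall j, (j0 < j)%N -> 0 < theta j.-1 t ->
     pr [set w | e <= mdist (z_ j t w : S) (Y w)] <= c) ->
  pr [set w | e <= mdist (glued t w : S) (Y w)] <= 2 * c.
Proof.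
move=> mY kt th1 cl; have [lt1 k1 gt0] := kt.
have k0 : (j0 < k)%N.
  by rewrite ltnNge; apply/negP => kj; move: k1; rewrite th1// ltxx.
pose D k := [set w | e <= mdist (z_ k t w : S) (Y w)].
have mD j : measurable (D j) by exact: measurable_mdist_ge.
have Dk : pr (D k) <= c.
  by apply: cl => //; rewrite lt1 ?ltr01// prednK//; exact: leq_ltn_trans k0.
have c0 : 0 <= c by apply: le_trans Dk; exact: pr_ge0.
have mG : measurable [set w | e <= mdist (glued t w : S) (Y w)].
  by apply: measurable_mdist_ge => //; exact: measurable_glued kt.
have [t0|t0] := leP (theta k t) 0.
  apply: (@le_trans _ _ (pr (D k))); last by lra.
  apply: le_pr => // w /=; rewrite (gluedE w kt) ifT//; apply: le_trans t0 _.
  by case/andP: (W01 k w).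
have Dk1 : pr (D k.+1) <= c by apply: cl => //; exact: ltnW.
apply: (@le_trans _ _ (pr (D k `|` D k.+1))).
  apply: le_pr => //; first exact: measurableU.
  by move=> w /=; rewrite (gluedE w kt); case: ifP => _ h; [left|right].
by apply: le_trans (prU_le _ _ _) _ => //; lra.
Qed.

(** At [t0] no level after [J] is selected.  The selected level changes only if
    some [W j], with [j <= J], falls between [theta j t] and [theta j t0], which
    has small probability, and [z_ j] is continuous at [t0] for these [j]. *)
Lemma cvg_glued (F : set_system U) (FF : Filter F) t0 J :
  (exists k, active k t0) -> (\forall t \near F, exists k, active k t) ->
  theta J t0 = 0 ->
  (forall j, theta j t @[t --> F] --> theta j t0) ->
  (forall j, (j <= J)%N -> cvg_prob P F (z_ j) (z_ j t0)) ->
  cvg_prob P F glued (glued t0).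
Proof.
move=> [k0 kt0] act thJ cth cz e e0.
pose Sd j t := [set w | Num.min (theta j t) (theta j t0) <= W j w < Num.max (theta j t) (theta j t0)].
pose D j t := [set w | e <= mdist (z_ j t w : S) (z_ j t0 w)].
have mSd j t : measurable (Sd j t) by exact: measurable_itvV.
have mD j t : measurable (D j t) by exact: measurable_mdist_ge.
have pSd j t : pr (Sd j t) = `|theta j t - theta j t0|.
  have th1 := theta01 j t; have th2 := theta01 j t0.
  have E a b : a <= b -> 0 <= a <= 1 -> 0 <= b <= 1 -> pr [set w | a <= W j w < b] = b - a.
    move=> ab a01 b01; rewrite (_ : [set w | _] = [set w | W j w < b] `\` [set w | W j w < a]).
      rewrite prD//; [by rewrite !unifW|by move=> w /= h; exact: lt_le_trans h ab].
    apply/seteqP; split => w /=; first by move=> /andP[aW ->]; split => //; apply/negP; rewrite -leNgt.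
    by move=> [-> /negP]; rewrite -leNgt => ->.
  rewrite /Sd; have [h|h] := leP (theta j t) (theta j t0).
    by rewrite E// distrC ger0_norm// subr_ge0.
  by rewrite E ?(ltW h)// gtr0_norm// subr_gt0.
have incl t : [set w | e <= mdist (glued t w : S) (glued t0 w)] `<=`
    \big[setU/set0]_(j <- iota 0 J.+1) (Sd j t `|` D j t).
  have inJ j : (j <= J)%N -> j \in iota 0 J.+1 by move=> jJ; rewrite mem_iota.
  move=> w /= h; rewrite -bigcup_seq; apply: contrapT => nin.
  have nS j : (j <= J)%N -> (theta j t <= W j w) = (theta j t0 <= W j w).
    move=> jJ; have /not_orP[nS _] : ~ (Sd j t w \/ D j t w).
      by move=> h'; apply: nin; exists j => //; exact: inJ.
    move: nS; rewrite /Sd/= => /negP; rewrite negb_and -ltNge -leNgt.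
    rewrite lt_min ge_max => /orP[/andP[h1 h2]|/andP[-> ->]//].
    by rewrite !leNgt h1 h2.
  have W0 : theta J t0 <= W J w by rewrite thJ; case/andP: (W01 J w).
  have stopJ : stop t0 w = stop t w /\ (stop t0 w <= J)%N.
    rewrite /stop; case: pselect => [e1|[]]; last by exists J.
    case: pselect => [e2|[]]; last by exists J; rewrite nS.
    case: ex_minnP => j1 t1 min1; case: ex_minnP => j2 t2 min2.
    have j1J : (j1 <= J)%N by exact: min1.
    have j21 : (j2 <= j1)%N by apply: min2; rewrite nS.
    split=> //; apply/eqP; rewrite eqn_leq j21 andbT; apply: min1.
    by rewrite -nS//; exact: leq_trans j21 j1J.
  apply: nin; exists (stop t0 w); first by apply: inJ; case: stopJ.
  by right; rewrite /D/=; move: h; rewrite /glued; case: stopJ => ->.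
have csum : (fun t => \sum_(j <- iota 0 J.+1) (pr (Sd j t) + pr (D j t))) @ F --> (0 : R).
  have := @cvg_sumr R _ (iota 0 J.+1) _ F FF
    (fun j t => if (j <= J)%N then pr (Sd j t) + pr (D j t) else 0) (fun=> 0).
  rewrite big1//.
  rewrite (_ : (fun t => \sum_(j <- _) (if _ then _ else _)) =
     (fun t => \sum_(j <- iota 0 J.+1) (pr (Sd j t) + pr (D j t)))); last first.
    apply/funext => t; rewrite big_seq [RHS]big_seq; apply: eq_bigr => j.
    by rewrite mem_iota/= add0n ltnS => ->.
  apply => j; case: leqP => jJ; last exact: cvg_cst.
  rewrite -[X in _ --> X]addr0; apply: cvgD.
    under eq_fun do rewrite pSd.
    rewrite (_ : 0 = `|theta j t0 - theta j t0|); last by rewrite subrr normr0.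
    by apply: cvg_norm; apply: cvgB => //; exact: cvg_cst.
  apply/cvgrPdist_le => e' e'0.
  have m0 : 0 < Num.min e e' by rewrite lt_min e0.
  have := cz j jJ _ m0; apply: filterS => t h; rewrite sub0r normrN ger0_norm ?pr_ge0//.
  have mDD : measurable [set w | Num.min e e' <= mdist (z_ j t w : S) (z_ j t0 w)].
    exact: measurable_mdist_ge.
  apply: (le_trans _ (_ : Num.min e e' <= e')); last by rewrite ge_min lexx orbT.
  apply: le_trans h; apply: le_pr => // w; rewrite /D /= => h.
  by rewrite ge_min h.
move: csum => /cvgrPdist_lt/(_ _ e0); apply: filterS2 act => t [k kt].
rewrite sub0r normrN => /(le_lt_trans (ler_norm _))/ltW; apply: le_trans.
apply: (@le_trans _ _ (pr (\big[setU/set0]_(j <- iota 0 J.+1) (Sd j t `|` D j t)))).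
  apply: le_pr; last exact: incl.
    by apply: measurable_mdist_ge; [exact: measurable_glued kt|exact: measurable_glued kt0].
  by apply: bigsetU_measurable => j _; exact: measurableU.
apply: le_trans (pr_bigsetU_le _ _ _) _; first by move=> j; exact: measurableU.
by apply: ler_sum => j _; exact: prU_le.
Qed.

End glue.

(** * Geometry of the cube *)

Section cube_geometry.
Variables (R : realType) (n : nat).
Implicit Types t x : 'rV[R]_n.

Lemma rV_norm_le t r : 0 <= r -> (`|t| <= r) <-> (forall i, `|t ord0 i| <= r).
Proof.
move=> r0; rewrite [`|t|]mx_normrE; split.
  by move=> /bigmax_leP[_ H] i; exact: (H (ord0, i)).
by move=> H; apply/bigmax_leP; split => // -[i j] _ /=; rewrite ord1.
Qed.

Definition cube_center : 'rV[R]_n := const_mx 2^-1.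
(** The norm is the maximum norm, so that the cube is the closed ball of radius 1/2
    around its center. *)
Definition cube_radius t : R := `|t - cube_center|.
Definition depth t : R := 1 - 2 * cube_radius t.
(** The projection from the center onto the boundary, continuous except at the
    center. *)
Definition radial t : 'rV[R]_n := cube_center + (2 * cube_radius t)^-1 *: (t - cube_center).

Lemma radius_ge0 t : 0 <= cube_radius t. Proof. exact: normr_ge0. Qed.

Lemma cubeE t : cube R n t <-> cube_radius t <= 2^-1.
Proof.
rewrite /cube_radius rV_norm_le ?invr_ge0//; split => H i; have := H i; rewrite !mxE.
  by rewrite ler_norml; lra.
by rewrite ler_norml; lra.
Qed.

(** The filter is kept abstract, in order to be either [nbhs t] or its trace on the
    cube. *)
Section limits.
Variables (F : set_system 'rV[R]_n) (FF : Filter F) (t : 'rV[R]_n).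
Hypothesis Ft : t' @[t' --> F] --> t.

Lemma cvg_radius_filter : cube_radius t' @[t' --> F] --> cube_radius t.
Proof. by apply: cvg_norm; apply: cvgB; [exact: Ft|exact: cvg_cst]. Qed.

Lemma cvg_depth_filter : depth t' @[t' --> F] --> depth t.
Proof.
apply: cvgB; first exact: cvg_cst.
by apply: cvgM; [exact: cvg_cst|exact: cvg_radius_filter].
Qed.

Lemma cvg_radial_filter : cube_radius t != 0 -> radial t' @[t' --> F] --> radial t.
Proof.
move=> r0; apply: cvgD; first exact: cvg_cst.
apply: cvgZ; last by apply: cvgB; [exact: Ft|exact: cvg_cst].
apply: cvgV; first by rewrite mulf_neq0.
by apply: cvgM; [exact: cvg_cst|exact: cvg_radius_filter].
Qed.

End limits.

Lemma cvg_radius t : cube_radius t' @[t' --> t] --> cube_radius t.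
Proof. exact: (@cvg_radius_filter (nbhs t) _ t cvg_id). Qed.

Lemma cvg_radial t : cube_radius t != 0 -> radial t' @[t' --> t] --> radial t.
Proof. exact: (@cvg_radial_filter (nbhs t) _ t cvg_id). Qed.

Lemma continuous_radius : continuous cube_radius. Proof. exact: cvg_radius. Qed.

Lemma closed_cube : closed (cube R n).
Proof.
rewrite (_ : cube R n = cube_radius @^-1` [set y | y <= 2^-1]).
  by apply: closed_comp; [move=> t _; exact: continuous_radius|exact: closed_le].
by apply/seteqP; split => t /cubeE.
Qed.

Lemma interior_cube t : cube_radius t < 2^-1 -> \forall t' \near t, cube_radius t' < 2^-1.
Proof. by move=> rt; exact: (@cvgr_lt _ _ (nbhs t) _ cube_radius (cube_radius t) (@cvg_radius t) _ rt). Qed.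

Lemma frontier_cubeE t : frontier (cube R n) t <-> cube_radius t = 2^-1.
Proof.
rewrite /frontier -(closure_id _).1; last exact: closed_cube.
split => [[/cubeE rt nint]|rt].
  apply/eqP; rewrite eq_le rt /= leNgt; apply/negP => /interior_cube H; apply: nint.
  by near=> t'; apply/cubeE/ltW; near: t'.
split; first by apply/cubeE; rewrite rt.
move=> /nbhs_ballP[e /= e0 He].
pose t' := cube_center + (1 + e) *: (t - cube_center).
have r' : cube_radius t' = (1 + e) * 2^-1.
  by rewrite /cube_radius /t' addrAC subrr add0r normrZ -/(cube_radius t) rt ger0_norm// addr_ge0// ltW.
have /He/cubeE : ball t e t'.
  rewrite -ball_normE /= (_ : t - t' = - (e *: (t - cube_center))).
    by rewrite normrN normrZ -/(cube_radius t) rt gtr0_norm//; lra.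
  by rewrite /t' scalerDl scale1r addrA [cube_center + _]addrC subrK opprD addrA subrr add0r.
by rewrite r'; lra.
Unshelve. all: by end_near. Qed.

Lemma radius_radial t : cube_radius t != 0 -> cube_radius (radial t) = 2^-1.
Proof.
move=> r0; rewrite /radial /cube_radius addrAC subrr add0r normrZ -/(cube_radius t).
have rp : 0 < cube_radius t by rewrite lt_neqAle eq_sym r0 radius_ge0.
rewrite ger0_norm ?invr_ge0 ?mulr_ge0 ?radius_ge0//; field; lra.
Qed.

Lemma frontier_radial t : cube_radius t != 0 -> frontier (cube R n) (radial t).
Proof. by move=> r0; apply/frontier_cubeE; exact: radius_radial. Qed.

Lemma radial_id t : frontier (cube R n) t -> radial t = t.
Proof.
move=> /frontier_cubeE rt; rewrite /radial rt mulfV// invr1 scale1r addrC subrK//.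
Qed.

Lemma dist_radial t : cube_radius t != 0 -> cube R n t -> `|t - radial t| = depth t / 2.
Proof.
move=> r0 /cubeE rt.
have rp : 0 < cube_radius t by rewrite lt_neqAle eq_sym r0 radius_ge0.
have -> : t - radial t = (1 - (2 * cube_radius t)^-1) *: (t - cube_center).
  by rewrite scalerBl scale1r /radial opprD addrA.
rewrite normrZ -/(cube_radius t) ler0_norm.
  by rewrite /depth; field; lra.
by rewrite subr_le0 invf_ge1 ?mulr_gt0//; lra.
Qed.

Lemma near_radius_neq0 t : cube_radius t != 0 -> \forall t' \near t, cube_radius t' != 0.
Proof.
move=> r0; have /cvgrPdist_lt/(_ (cube_radius t)) := @cvg_radius t.
rewrite lt_neqAle eq_sym r0 radius_ge0 => /(_ isT); apply: filterS => t'.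
by apply: contraTneq => ->; rewrite subr0 ger0_norm ?radius_ge0// ltxx.
Qed.

Lemma compact_frontier : compact (frontier (cube R n)).
Proof.
apply: (@subclosed_compact _ _ (cube R n)).
- rewrite (_ : frontier _ = cube_radius @^-1` [set 2^-1]).
    by apply: closed_comp; [move=> t _; exact: continuous_radius|exact: closed_eq].
  by apply/seteqP; split => t /frontier_cubeE.
- rewrite (_ : cube R n = [set v | forall i, `[0, 1]%classic (v ord0 i)]).
    by apply: (@rV_compact R n (fun=> `[0, 1]%classic)) => i; exact: segment_compact.
  by apply/seteqP; split => t H i; have := H i; rewrite /= in_itv.
- by move=> t /frontier_cubeE rt; apply/cubeE; rewrite rt.
Qed.

Lemma frontier_sub t : frontier (cube R n) t -> cube R n t.
Proof. by move=> /frontier_cubeE rt; apply/cubeE; rewrite rt. Qed.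

Lemma rational_dense t e : 0 < e -> exists q : 'rV[rat]_n, `|map_mx ratr q - t| < e.
Proof.
move=> e0; have H i : exists q : rat, t ord0 i < ratr q < t ord0 i + e / 2.
  have [|q] := @rat_in_itvoo R (t ord0 i) (t ord0 i + e / 2); first by rewrite ltrDl divr_gt0.
  by rewrite in_itv /=; exists q.
have [f fP] := choice H; exists (\row_i f i).
apply: (@le_lt_trans _ _ (e / 2)); last by lra.
apply/rV_norm_le => [|i]; first by rewrite divr_ge0// ltW.
by rewrite !mxE ger0_norm; have := fP i; lra.
Qed.

End cube_geometry.

(** * Random variables up to almost sure equality *)

Section L0_facts.
Local Open Scope quotient_scope.
Context d (T : measurableType d) (R : realType) (P : probability T R) (S : polishMetricType R).
Local Notation pr := (prob P).

Lemma pr_ae_eq (A A' : set T) : measurable A -> measurable A' ->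
  {ae P, forall w, A w <-> A' w} -> pr A = pr A'.
Proof.
move=> mA mA' [N [mN N0 HN]].
have prN : pr N = 0 by rewrite /prob N0.
have H (B C : set T) : measurable B -> measurable C -> (forall w, ~ N w -> B w -> C w) -> pr B <= pr C.
  move=> mB mC BC; apply: (@le_trans _ _ (pr (C `|` N))).
    apply: le_pr => //; first exact: measurableU.
    by move=> w Bw; have [Nw|Nw] := pselect (N w); [right|left; exact: BC].
  by have := prU_le P mC mN; rewrite prN addr0.
have HN' w : ~ N w -> A w <-> A' w by move=> Nw; apply: contrapT => h; apply: Nw; exact: HN.
by apply/eqP; rewrite eq_le !H// => w /HN' [].
Qed.

Lemma measurable_repr (X : L0 P S) : measurable_fun setT (repr X : T -> borel S).
Proof. exact: measurable_funPT. Qed.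

Definition L0_of (f : T -> borel S) (mf : measurable_fun setT f) : L0 P S :=
  \pi_(L0 P S) (to_mfun mf).

Lemma repr_L0_of (f : T -> borel S) (mf : measurable_fun setT f) : {ae P, forall w, repr (L0_of mf) w = f w}.
Proof.
have /eqquotP/asboolP : \pi_(L0 P S) (repr (L0_of mf)) = \pi_(L0 P S) (to_mfun mf).
  by rewrite reprK.
by apply: filterS => w; apply.
Qed.

Lemma pr_law (X : L0 P S) C : prob (law X) C = pr [set w | C (repr X w)].
Proof. by []. Qed.

Lemma law_L0_of (f : T -> borel S) (mf : measurable_fun setT f) (C : set (borel S)) : measurable C ->
  prob (law (L0_of mf)) C = pr [set w | C (f w)].
Proof.
move=> mC; rewrite pr_law; apply: pr_ae_eq.
- by rewrite -[X in measurable X]setTI; exact: (measurable_repr (L0_of mf) measurableT mC).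
- by rewrite -[X in measurable X]setTI; exact: (mf measurableT C mC).
- by have := repr_L0_of mf; apply: filterS => w /= ->.
Qed.

Lemma L0_dist_le_pr (X Y : L0 P S) (f g : T -> borel S) e :
  measurable_fun setT f -> measurable_fun setT g ->
  {ae P, forall w, repr X w = f w} -> {ae P, forall w, repr Y w = g w} -> 0 < e ->
  pr [set w | e <= mdist (f w : S) (g w)] <= e -> mdist X Y <= e.
Proof.
move=> mf mg Xf Yg e0 fg; rewrite [leLHS](_ : _ = L0_dist X Y)//; apply: L0_dist_le => //.
have mD := measurable_L0_dist_ge X Y e; rewrite prE// lee_fin.
rewrite (@pr_ae_eq _ [set w | e <= mdist (f w : S) (g w)])//.
  exact: measurable_mdist_ge.
by move: Xf Yg; apply: filterS2 => w /= Xw Yw; rewrite /L0_dist_ge /= Xw Yw.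
Qed.

Lemma L0_dist_lt_pr (X Y : L0 P S) e : mdist X Y < e ->
  pr [set w | e <= mdist (repr X w : S) (repr Y w)] <= e.
Proof.
move=> h; have : L0_dist X Y < e by [].
move=> /L0_dist_lt[e' [e'0 e'e]].
rewrite prE ?lee_fin; last exact: measurable_L0_dist_ge.
move=> He'; apply: le_trans (ltW e'e); apply: le_trans He'.
apply: le_pr; [exact: measurable_L0_dist_ge|exact: measurable_L0_dist_ge|].
by move=> w; rewrite /L0_dist_ge/=; apply: le_trans; exact: ltW.
Qed.

Lemma Rint_law (X : L0 P S) (f : borel S -> R) : bmf f -> (forall x, 0 <= f x) ->
  \int[law X]_x f x = \int[P]_w f (repr X w).
Proof.
move=> [mf _] f0; congr fine; rewrite /law /distribution.
rewrite ge0_integral_pushforward//; last first.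
- by move=> x _; rewrite lee_fin.
- exact/measurable_EFinP.
Qed.

End L0_facts.

Lemma eq_Rint_measure d (T : measurableType d) (R : realType) (m1 m2 : probability T R) f :
  measure_eq m1 m2 -> \int[m1]_x f x = \int[m2]_x f x.
Proof.
by move=> m12; congr fine; apply: eq_measure_integral => A mA _; exact: m12.
Qed.

Lemma cvg_metricP (R : realType) (I : Type) (F : set_system I) (FF : Filter F) (M : metricType R)
    (f : I -> M) a :
  f i @[i --> F] --> a <-> forall e, 0 < e -> \forall i \near F, mdist a (f i) <= e.
Proof.
split=> [fa e e0|H].
  have h : F [set i | ball a e (f i)] by apply: fa; exact: nbhsx_ballx.
  by apply: filterS h => i /=; rewrite ballEmdist => /ltW.
move=> A /nbhs_ballP[e /= e0 eA]; have := H (e / 2); rewrite divr_gt0// => /(_ isT).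
by apply: filterS => i h; apply: eA; rewrite ballEmdist /=; lra.
Qed.

(** * Approximation by functions of finitely many bits *)

Lemma weakProb_cvg (R : realType) (S : polishMetricType R) (I : Type) (F : set_system I)
    (FF : Filter F) (alpha : I -> weakProb S) (mu : weakProb S) :
  alpha i @[i --> F] --> mu -> cvg_law F alpha mu.
Proof.
move=> am f cf bf; pose g : bounded_continuous S := exist _ f (conj cf bf).
have c1 : {ptws, (fun i => @integrals R S (alpha i)) @ F --> @integrals R S mu}.
  by apply: cvg_comp am _; exact: (@initial_continuous _ _ (@integrals R S) mu).
exact: (cvg_comp _ _ c1 (@proj_continuous _ (fun=> R) g _)).
Qed.

Lemma bigsetU_iotaP (T : Type) (D : nat -> set T) J w :
  (\big[setU/set0]_(j <- iota 0 J) D j) w <-> exists2 j, (j < J)%N & D j w.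
Proof.
rewrite -bigcup_seq; split => -[j jJ Dj]; exists j => //.
  by have : j \in iota 0 J by []; rewrite mem_iota.
by have : j \in iota 0 J by rewrite mem_iota.
Qed.

Section approximation.
Context (R : realType) (S : polishMetricType R).
Variable s : nat -> S.
Hypothesis sP : forall y e, 0 < e -> exists n, mdist (s n) y < e.
Context d (T : measurableType d) (P : probability T R).
Local Notation pr := (prob P).
Variable (B : nat -> set T).
Hypothesis mB : forall n, measurable (B n).

Lemma measurable_mixed D m : measurable [set w | mixed B D m (word B m w)].
Proof. by rewrite preimage_word; apply: bigsetU_measurable => v _; exact: measurable_atom. Qed.

(** Up to a small probability, [Y] lies in finitely many balls of small radius
    around points of [s].  The atoms mixed for one of these balls have small
    probability, and every other atom that meets a ball is contained in it, so
    that the center of the ball approximates [Y] on this atom. *)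
Lemma approx_word (Y : T -> borel S) : measurable_fun setT Y ->
  (forall j l e, 0 < e -> \forall m \near \oo,
     pr [set w | mixed B [set w | mdist (s j) (Y w : S) < l.+1%:R^-1] m (word B m w)] < e) ->
  forall eps, 0 < eps -> \forall m \near \oo, exists y : seq bool -> S,
    pr [set w | eps <= mdist (Y w : S) (y (word B m w))] <= eps.
Proof.
move=> mY mixedP eps eps0.
have [l le] : exists l : nat, l.+1%:R^-1 < eps.
  have := eps0 => /ltr_add_invr[l]; rewrite add0r => h; by exists l.
pose D j := [set w | mdist (s j) (Y w : S) < l.+1%:R^-1].
have mD j : measurable (D j) by exact: measurable_mdist_lt_cst.
pose U J := \big[setU/set0]_(j <- iota 0 J) D j.
have mU J : measurable (U J) by exact: bigsetU_measurable.
have ndU : nondecreasing_seq U.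
  apply/nondecreasing_seqP => J; apply/subsetPset => w /bigsetU_iotaP[j jJ Dj].
  by apply/bigsetU_iotaP; exists j => //; exact: ltnW.
have UT : \bigcup_J U J = setT.
  apply/seteqP; split => // w _.
  have [|j jw] := sP (Y w) (e := l.+1%:R^-1); first by rewrite invr_gt0.
  by exists j.+1 => //; apply/bigsetU_iotaP; exists j.
have := cvg_pr_bigcup (P := P) mU ndU; rewrite UT prT => /cvgrPdist_lt/(_ (eps / 2)).
rewrite divr_gt0// => /(_ isT)[J _ /(_ J (leqnn J))/= UJ].
have J0 : 0 < eps / 2 / J.+1%:R by rewrite !divr_gt0.
have near_all : \forall m \near \oo, forall j, (j < J)%N ->
    pr [set w | mixed B (D j) m (word B m w)] < eps / 2 / J.+1%:R.
  elim: J {UJ} (eps / 2 / J.+1%:R) J0 => [|J IH] e e0; first by apply: nearW.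
  have := IH e e0; apply: filterS2 (mixedP J l e e0) => m h1 h2 j.
  by rewrite ltnS leq_eqVlt => /predU1P[->//|]; exact: h2.
apply: filterS near_all => m mixm.
pose good v := [set j | (j < J)%N /\ atom B m v `<=` D j].
exists (fun v => s (xget 0%N (good v))).
set E := [set w | _].
have mE : measurable E.
  apply: measurable_mdist_ge => //.
  by apply: (@measurable_by_cells _ T B m _ (borel S) _ (fun v _ => s (xget 0%N (good v)))) => // v;
    exact: measurable_cst.
have mM j : measurable [set w | mixed B (D j) m (word B m w)] by exact: measurable_mixed.
have mMs : measurable (\big[setU/set0]_(j <- iota 0 J) [set w | mixed B (D j) m (word B m w)]).
  exact: bigsetU_measurable.
have mCU : measurable (~` U J) by exact: measurableC.
apply: (@le_trans _ _ (pr (~` U J `|` \big[setU/set0]_(j <- iota 0 J) [set w | mixed B (D j) m (word B m w)]))).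
  apply: le_pr => //; first exact: measurableU.
  move=> w Ew; have [Uw|nU] := pselect (U J w); last by left.
  right; move: Uw => /bigsetU_iotaP[j jJ Djw].
  apply/bigsetU_iotaP; exists j => //; apply/asboolP; split; first by exists w.
  apply: contrapT => h.
  have gj : good (word B m w) j.
    split; first exact: jJ.
    by move=> w' aw'; apply: contrapT => nD; apply: h; exists w'.
  have [_ /(_ w erefl)] := xgetPex 0%N (ex_intro _ j gj).
  rewrite /D/= => dw; move: Ew; rewrite /E/= metric_sym leNgt => /negP; apply.
  exact: lt_trans dw le.
apply: le_trans (prU_le _ mCU mMs) _; rewrite [leRHS](splitr eps); apply: lerD.
  by rewrite prC//; have := ler_norm (1 - pr (U J)); lra.
apply: le_trans (pr_bigsetU_le P _ mM) _.
apply: (@le_trans _ _ (\sum_(j <- iota 0 J) (eps / 2 / J.+1%:R))).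
  rewrite big_seq [leRHS]big_seq; apply: ler_sum => j; rewrite mem_iota/= add0n => jJ.
  exact: ltW (mixm j jJ).
rewrite big_const_seq count_predT size_iota iter_addr addr0 -[leLHS]mulr_natr.
by rewrite -mulrA ler_piMr ?divr_ge0 ?(ltW eps0)// mulrC ler_pdivrMr// mul1r ler_nat.
Qed.

End approximation.

(** * Uniform estimates near the boundary of the cube *)

Section boundary_approximation.
Context (R : realType) (S : polishMetricType R).
Variable s : nat -> S.
Hypothesis sP : forall y e, 0 < e -> exists n, mdist (s n) y < e.
Context d (T : measurableType d) (P : probability T R).
Local Notation pr := (prob P).
Variable n : nat.
Local Notation bd := (frontier (cube R n)).
Variables (alpha : 'rV[R]_n -> probability (borel S) R) (X : 'rV[R]_n -> L0 P S).
Hypothesis alpha_cvg : forall t0, cube R n t0 ->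
  cvg_law (within (cube R n) (nbhs t0)) alpha (alpha t0).
Hypothesis X_cvg : forall x, bd x -> X t @[t --> within bd (nbhs x)] --> X x.
Hypothesis lawX : forall t, bd t -> measure_eq (law (X t)) (alpha t).

Lemma X_radial_cvg t0 : cube_radius t0 != 0 -> X (radial t) @[t --> t0] --> X (radial t0).
Proof.
move=> r0; apply: (@cvg_comp _ _ _ (@radial R n) X (nbhs t0) (within bd (nbhs (radial t0)))); last first.
  by apply: X_cvg; exact: frontier_radial.
move=> A; rewrite /within/= => Ar.
have h1 : \forall t \near t0, cube_radius t != 0.
  exact: near_radius_neq0.
have h2 : \forall t \near t0, bd (radial t) -> A (radial t) by exact: (cvg_radial r0 Ar).
by apply: filterS2 h1 h2 => t rt; apply; exact: frontier_radial.
Qed.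

(** Through the projection, [X x] is compared with [X] at points that need not lie
    on the boundary, such as points with rational coordinates. *)
Lemma X_radial_near x e : bd x -> 0 < e -> exists2 r, 0 < r &
  forall t, `|t - x| < r -> cube_radius t != 0 /\ mdist (X x) (X (radial t)) <= e.
Proof.
move=> bx e0; have rx : cube_radius x != 0 by rewrite (frontier_cubeE x).1// invr_eq0.
have /cvg_metricP/(_ e e0) := X_radial_cvg rx; rewrite (radial_id bx) => h1.
have h2 : \forall t \near x, cube_radius t != 0.
  exact: near_radius_neq0.
have /nbhs_ballP[r /= r0 rP] : nbhs x [set t | cube_radius t != 0 /\ mdist (X x) (X (radial t)) <= e].
  by apply: filterS2 h2 h1.
by exists r => // t tx; apply: rP; rewrite -ball_normE /= distrC.
Qed.

Section bits.
Variable (B : nat -> set T).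
Hypothesis mB : forall n, measurable (B n).
Hypothesis mixedP : forall (q : 'rV[rat]_n) j l e, 0 < e -> \forall m \near \oo,
  pr [set w | mixed B [set w | mdist (s j) (repr (X (radial (map_mx ratr q))) w : S) < l.+1%:R^-1] m
        (word B m w)] < e.

(** Near [x], all [X x'] are close to [X (radial q)] for one rational point [q], to
    which [approx_word] applies; compactness makes [m] uniform. *)
Lemma approx_frontier eps : 0 < eps -> \forall m \near \oo, forall x, bd x ->
  exists y : seq bool -> S, pr [set w | eps <= mdist (repr (X x) w : S) (y (word B m w))] <= eps.
Proof.
move=> eps0.
have /compact_near_coveringP/near_covering_withinP cov := @compact_frontier R n.
apply: (cov nat \oo (fun m x => exists y : seq bool -> S,
  pr [set w | eps <= mdist (repr (X x) w : S) (y (word B m w))] <= eps)) => x bx.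
have e8 : 0 < eps / 8 by rewrite divr_gt0.
have [r r0 rP] := X_radial_near bx e8.
have [q qx] := rational_dense x r0.
have [rq Xq] := rP _ qx.
have e2 : 0 < eps / 2 by rewrite divr_gt0.
have appr := approx_word sP mB (measurable_repr _) (mixedP q) e2.
exists ([set x' | `|x' - x| < r], [set m | exists y : seq bool -> S,
    pr [set w | eps / 2 <= mdist (repr (X (radial (map_mx ratr q))) w : S) (y (word B m w))] <= eps / 2]).
  split => //=; apply/nbhs_ballP; exists r => //= x'; rewrite -ball_normE /= distrC//.
move=> [x' m] [/= x'x [y yP]] bx'; exists y.
have [rx' Xx'] := rP _ x'x; rewrite radial_id// in Xx'.
set q' := X (radial _) in yP Xq.
have dd : mdist (X x') q' < eps / 2.
  by have := metric_triangle (X x') (X x) q'; rewrite (metric_sym (X x') (X x)); lra.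
have dpr := L0_dist_lt_pr dd.
have my : measurable_fun setT (fun w => y (word B m w) : borel S).
  by apply: (@measurable_by_cells _ T B m _ (borel S) _ (fun v _ => y v)) => // v; exact: measurable_cst.
have mr (Z : L0 P S) := measurable_repr Z.
have mge (Z Z' : T -> borel S) e : measurable_fun setT Z -> measurable_fun setT Z' ->
  measurable [set w | e <= mdist (Z w : S) (Z' w)] by exact: measurable_mdist_ge.
have m1 := mge _ _ (eps / 2) (mr (X x')) (mr q').
have m2 := mge _ _ (eps / 2) (mr q') my.
have m3 := mge _ _ eps (mr (X x')) my.
apply: (@le_trans _ _ (pr ([set w | eps / 2 <= mdist (repr (X x') w : S) (repr q' w)] `|`
   [set w | eps / 2 <= mdist (repr q' w : S) (y (word B m w))]))).
  apply: le_pr => //; first exact: measurableU.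
  move=> w /= h; have [h1|h1] := leP (eps / 2) (mdist (repr (X x') w : S) (repr q' w)); [by left|right].
  by have := metric_triangle (repr (X x') w : S) (repr q' w) (y (word B m w)); lra.
by apply: le_trans (prU_le _ m1 m2) _; lra.
Qed.

End bits.

Section partition.
Variables (eps : R) (eps0 : 0 < eps).
Let phi i : borel S -> R := punity s eps i.

Let cphi i : continuous (phi i : S -> R). Proof. exact: continuous_punity. Qed.
Let bphi i : bounded_fun (phi i : S -> R).
Proof.
apply/bounded_funE; exists 1 => y; have /andP[? ?] := punity_itv s eps i y.
by rewrite /phi ger0_norm.
Qed.

Let sum_masses N mu : \sum_(i < N) masses mu phi i = \int[mu]_x bumps s eps N x.
Proof.
rewrite -Rint_sum; last by move=> i; exact: bmf_phi.
by apply: eq_Rintegral => x _; rewrite sum_punity.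
Qed.

Let mbumps N : measurable_fun setT (bumps s eps N : borel S -> R).
Proof. by apply: continuous_borel; exact: continuous_bumps. Qed.

(** Tightness on the compact boundary: the integrals of the continuous functions
    [bumps], which increase to 1 with [N], are continuous in [x]. *)
Lemma mass_frontier e : 0 < e -> exists N, forall x, bd x ->
  1 - \sum_(i < N) masses (alpha x) phi i <= e.
Proof.
move=> e0.
have /compact_near_coveringP/near_covering_withinP cov := @compact_frontier R n.
suff [N _ /(_ N (leqnn N)) H] : \forall N \near \oo, forall x, bd x ->
    1 - \sum_(i < N) masses (alpha x) phi i <= e by exists N.
apply: (cov nat \oo (fun N x => 1 - \sum_(i < N) masses (alpha x) phi i <= e)) => x bx.
have : \int[alpha x]_y bumps s eps N y @[N --> \oo] --> \int[alpha x]_y (1 : R).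
  apply: (@cvg_Rint _ _ _ (alpha x) _ _ 1).
  - by move=> N; exact: mbumps.
  - exact: measurable_cst.
  - by move=> N y; have /andP[? ?] := bumps_itv s eps N y; rewrite ger0_norm.
  - move=> y; have [N NP] := bumps_eq1 sP y eps0.
    by apply: cvg_near_cst; exists N => // N' /= NN'; exact: NP.
rewrite Rint_cst => /cvgrPdist_lt/(_ (e / 2)); rewrite divr_gt0// => /(_ isT).
move=> [N0 _ /(_ N0 (leqnn N0))/= H0].
have H0' := le_lt_trans (ler_norm _) H0.
have bb : bounded_fun (bumps s eps N0).
  by apply/bounded_funE; exists 1 => y; have /andP[? ?] := bumps_itv s eps N0 y; rewrite ger0_norm.
have := alpha_cvg (frontier_sub bx) (@continuous_bumps _ _ s _ N0 eps0) bb.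
move=> /cvgrPdist_lt/(_ (e / 2)); rewrite divr_gt0// => /(_ isT) nx.
exists ([set x' | cube R n x' -> `|\int[alpha x]_y bumps s eps N0 y - \int[alpha x']_y bumps s eps N0 y| < e / 2],
   [set N | (N0 <= N)%N]).
  by split; [exact: nx|exists N0].
move=> [x' N] [/= x'x NN0] /frontier_sub/x'x h; have {h}h := le_lt_trans (ler_norm _) h.
rewrite sum_masses.
have : \int[alpha x']_y bumps s eps N0 y <= \int[alpha x']_y bumps s eps N y.
  apply: le_Rint; [by apply: bmf01; [exact: mbumps|exact: bumps_itv]..|].
  by move=> y; exact: nd_bumps.
by lra.
Qed.

(** Uniform continuity of [f] at the compact boundary, applied to [t] and its
    projection, which are at distance [depth t / 2]. *)
Lemma shift_frontier (f : 'rV[R]_n -> R) e : 0 < e ->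
  (forall t0, cube R n t0 -> f t @[t --> within (cube R n) (nbhs t0)] --> f t0) ->
  exists2 r, 0 < r & forall t, cube R n t -> cube_radius t != 0 -> depth t < r ->
    `|f t - f (radial t)| <= e.
Proof.
move=> e0 cf.
have /compact_near_coveringP/near_covering_withinP cov := @compact_frontier R n.
have [r /= r0 rP] : exists2 r, 0 < r & forall h : 'rV[R]_n, `|h| < r -> forall x, bd x ->
    cube R n (x + h) -> `|f (x + h) - f x| <= e.
  have /nbhs_ballP[r /= r0 rP] : \forall h \near (0 : 'rV[R]_n), forall x, bd x ->
      cube R n (x + h) -> `|f (x + h) - f x| <= e.
    apply: (cov _ (nbhs (0 : 'rV[R]_n)) (fun h x => cube R n (x + h) -> `|f (x + h) - f x| <= e)) => x bx.
    have := cf x (frontier_sub bx) => /cvgrPdist_lt/(_ (e / 2)); rewrite divr_gt0// => /(_ isT).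
    move=> /nbhs_ballP[r /= r0 rP].
    exists (ball x (r / 2), ball (0 : 'rV[R]_n) (r / 2)).
      by split; apply: nbhsx_ballx; rewrite divr_gt0.
    move=> [x' h] [/=]; rewrite -!ball_normE /= sub0r normrN => xx' hr bx' cxh.
    have h1 : `|f x - f (x' + h)| < e / 2.
      apply: rP cxh; rewrite -ball_normE /= opprD addrA.
      by apply: le_lt_trans (ler_normB _ _) _; lra.
    have h2 : `|f x - f x'| < e / 2.
      by apply: rP (frontier_sub bx'); rewrite -ball_normE /=; lra.
    by move: h1 h2; rewrite ltr_norml ltr_norml ler_norml; lra.
  by exists r => // h hr; apply: rP; rewrite -ball_normE /= sub0r normrN.
exists (2 * r); first by rewrite mulr_gt0.
move=> t ct rt dt; have := rP (t - radial t) _ (radial t) (frontier_radial rt).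
have -> : radial t + (t - radial t) = t by rewrite addrC subrK.
by rewrite (dist_radial rt ct); apply => //; lra.
Qed.

Lemma masses_cvg i t0 : cube R n t0 ->
  masses (alpha t) phi i @[t --> within (cube R n) (nbhs t0)] --> masses (alpha t0) phi i.
Proof. by move=> ct0; exact: (alpha_cvg ct0 (@cphi i) (bphi i)). Qed.

Lemma masses_shift N e : 0 < e ->
  exists2 r, 0 < r & forall t, cube R n t -> cube_radius t != 0 -> depth t < r ->
    \sum_(i < N) `|masses (alpha t) phi i - masses (alpha (radial t)) phi i| <= e.
Proof.
elim: N e => [|N IH] e e0; first by exists 1 => // t _ _ _; rewrite big_ord0 ltW.
have e2 : 0 < e / 2 by rewrite divr_gt0.
have [r1 r10 r1P] := IH _ e2.
have [r2 r20 r2P] := shift_frontier e2 (@masses_cvg N).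
exists (Num.min r1 r2); first by rewrite lt_min r10.
move=> t ct rt; rewrite lt_min => /andP[d1 d2]; rewrite big_ord_recr /=.
by rewrite [leRHS]splitr lerD// ?r1P// r2P.
Qed.

Variables (B : nat -> set T) (V W : nat -> T -> R).
Hypothesis dB : dyadic P B.
Hypothesis mVW : forall m, measurable_fun setT (V m) /\ measurable_fun setT (W m).
Hypothesis VW01 : forall m w, 0 <= V m w < 1 /\ 0 <= W m w < 1.
Hypothesis VWP : forall m m' v th, size v = m -> (m <= m')%N -> 0 <= th <= 1 ->
  pr (atom B m v `&` [set w | W m' w < th]) = 2^-1 ^+ m * th /\
  uniform_on P (atom B m v `&` [set w | W m' w < th]) (V m).
Hypothesis mixedP : forall (q : 'rV[rat]_n) j l e, 0 < e -> \forall m \near \oo,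
  pr [set w | mixed B [set w | mdist (s j) (repr (X (radial (map_mx ratr q))) w : S) < l.+1%:R^-1] m
        (word B m w)] < e.

(** The bound of [level_close] is at most [5 * eps]: [2 * eps] from the
    approximation of [X] on atoms, and [eps] from each of the mass missed by the
    first [N] pieces, the distance between [alpha t] and [alpha (radial t)], and
    [N * tau]. *)
Lemma ex_level : exists (N : nat) (tau : R) (m : nat) (r : R), [/\ 0 < tau, 0 < r &
  forall t, cube R n t -> cube_radius t != 0 -> depth t < r ->
   pr [set w | 4 * eps <= mdist (level s P B V N tau eps m (alpha t) (repr (X (radial t))) w : S)
                            (repr (X (radial t)) w)] <= 5 * eps].
Proof.
have [mB _] := dB.
have [N NP] := mass_frontier eps0.
have [r r0 rP] := masses_shift N eps0.
have [m _ /(_ m (leqnn m)) mP] := approx_frontier mB mixedP eps0.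
pose tau := eps / N.+1%:R.
have tau0 : 0 < tau by rewrite divr_gt0.
exists N, tau, m, r; split => // t ct rt dt.
have br := frontier_radial rt.
have [y yP] := mP _ br.
have totE i : total_mass s P eps (repr (X (radial t))) i = masses (alpha (radial t)) phi i.
  rewrite /total_mass -[RHS](eq_Rint_measure _ (lawX br)) Rint_law//; last exact: phi_ge0.
  exact: bmf_phi.
have := @level_close _ _ s sP _ _ P B V W dB mVW VW01 VWP N tau eps m tau0 eps0 (alpha t) _
  (measurable_repr (X (radial t))) y eps yP.
move=> h; apply: le_trans h _.
under eq_bigr do rewrite totE.
under [X in _ + (_ + X + _)]eq_bigr do rewrite totE.
have h1 := NP _ br; have h2 := rP t ct rt dt.
have h3 : N%:R * tau <= eps.
  by rewrite /tau mulrCA ler_piMr ?(ltW eps0)// ler_pdivrMr// mul1r ler_nat.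
by move: h1 h2; rewrite /phi; lra.
Qed.

End partition.
End boundary_approximation.

(** * The extension to the interior of the cube *)

Section layers.
Variables (R : realType) (n : nat) (r : nat -> R).
Hypothesis r0 : forall k, 0 < r k.

(** Between depths [threshold k.+1] and [threshold k], levels [k] and [k.+1] are
    mixed; as [threshold k <= r k.+1], level [k.+1] is used only where its
    estimate holds. *)
Fixpoint threshold (k : nat) : R :=
  if k is k'.+1 then Num.min (threshold k' / 2) (r k.+1) else Num.min 2^-1 (r 1).

Lemma threshold_gt0 k : 0 < threshold k.
Proof. by elim: k => [|k IH] /=; rewrite lt_min ?invr_gt0 ?divr_gt0 ?r0 ?ltr0n. Qed.

Lemma threshold_lt k : threshold k.+1 < threshold k.
Proof. by rewrite /= gt_min; apply/orP; left; have := threshold_gt0 k; lra. Qed.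

Lemma threshold_le k l : (k <= l)%N -> threshold l <= threshold k.
Proof.
move=> /subnK <-; elim: (l - k)%N => [|j IH] //.
by apply: le_trans IH; rewrite addSn ltW// threshold_lt.
Qed.

Lemma threshold_radius k : threshold k <= r k.+1.
Proof. by case: k => [|k] /=; rewrite ge_min lexx orbT. Qed.

Lemma threshold_half k : threshold k <= 2^-1 ^+ k.+1.
Proof.
elim: k => [|k IH] /=; first by rewrite expr1 ge_min lexx.
by rewrite ge_min exprS; apply/orP; left; lra.
Qed.

Definition layer (k : nat) (t : 'rV[R]_n) : R :=
  clamp R ((threshold k - depth t) / (threshold k - threshold k.+1)).

Let width k : 0 < threshold k - threshold k.+1.
Proof. by rewrite subr_gt0 threshold_lt. Qed.

Lemma layer01 k t : 0 <= layer k t <= 1. Proof. exact: clamp_itv. Qed.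

Lemma layer_eq1 k t : depth t <= threshold k.+1 -> layer k t = 1.
Proof. by move=> h; apply: clamp1; rewrite ler_pdivlMr// mul1r; lra. Qed.

Lemma layer_eq0 k t : threshold k <= depth t -> layer k t = 0.
Proof. by move=> h; apply: clamp0; rewrite ler_pdivrMr// mul0r; lra. Qed.

Lemma layer_gt0 k t : 0 < layer k t -> depth t < threshold k.
Proof. by rewrite ltNge => h; rewrite ltNge; apply: contra h => /layer_eq0 ->. Qed.

Lemma active_layer t : 0 < depth t -> exists k, active layer k t.
Proof.
move=> d0; have e : exists k, threshold k.+1 < depth t.
  have [k kd] := half_expn_lt d0; exists k; apply: le_lt_trans kd.
  apply: le_trans (threshold_half _) _; rewrite !exprS.
  by have : 0 <= 2^-1 ^+ k :> R by [rewrite exprn_ge0// invr_ge0|]; lra.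
case: (ex_minnP e) => k kd kmin; exists k; split.
- by move=> j jk; apply: layer_eq1; rewrite leNgt; apply: contraL jk => /kmin; rewrite -leqNgt.
- apply: (@clamp_cases _ _ (fun y => y < 1)) => [_|_|].
  + exact: ltr01.
  + by rewrite ltr_pdivrMr// mul1r; lra.
  + by rewrite ler_pdivlMr// mul1r; lra.
- by move=> j kj; apply: layer_eq0; apply: le_trans (ltW kd); exact: threshold_le.
Qed.

Lemma cvg_layer k t0 (F : set_system 'rV[R]_n) (FF : Filter F) : t @[t --> F] --> t0 ->
  layer k t @[t --> F] --> layer k t0.
Proof.
move=> Ft0; apply/cvgrPdist_le => e e0.
have c : (threshold k - depth t) / (threshold k - threshold k.+1) @[t --> F] -->
    (threshold k - depth t0) / (threshold k - threshold k.+1).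
  apply: cvgM; last exact: cvg_cst.
  by apply: cvgB; [exact: cvg_cst|exact: cvg_depth_filter].
have /cvgrPdist_le/(_ e e0) := c; apply: filterS => t.
exact: le_trans (lipschitz_clamp _ _).
Qed.

End layers.

Section interior.
Context (R : realType) (S : polishMetricType R) d (Omega : measurableType d) (P : probability Omega R).
Local Notation pr := (prob P).
Hypothesis Pnonatomic : nonatomic P.
Variables (n : nat) (alpha : 'rV[R]_n -> probability (borel S) R) (X : 'rV[R]_n -> L0 P S).
Local Notation bd := (frontier (cube R n)).
Hypothesis alpha_cvg : forall t0, cube R n t0 ->
  cvg_law (within (cube R n) (nbhs t0)) alpha (alpha t0).
Hypothesis X_cvg : forall x, bd x -> X t @[t --> within bd (nbhs x)] --> X x.
Hypothesis lawX : forall t, bd t -> measure_eq (law (X t)) (alpha t).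

Local Notation Y t := (repr (X (radial t)) : Omega -> borel S).

Lemma cvg_prob_radial t0 : cube_radius t0 != 0 -> cvg_prob P (nbhs t0) (fun t => Y t) (Y t0).
Proof.
move=> r0 e e0; have e2 : 0 < e / 2 by rewrite divr_gt0.
have /cvg_metricP/(_ _ e2) := X_radial_cvg X_cvg r0; apply: filterS => t h.
by apply: L0_dist_lt_pr; rewrite metric_sym; lra.
Qed.

(** Countably many events suffice: the projections of the rational points are
    dense in the boundary. *)
Lemma ex_bits (s : nat -> S) : exists2 B : nat -> set Omega, dyadic P B &
  forall (q : 'rV[rat]_n) j l e, 0 < e -> \forall m \near \oo,
  pr [set w | mixed B [set w | mdist (s j) (repr (X (radial (map_mx ratr q))) w : S) < l.+1%:R^-1] m
        (word B m w)] < e.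
Proof.
pose D i := if unpickle i is Some (q, j, l) then
  [set w | mdist (s j) (repr (X (radial (map_mx ratr (q : 'rV[rat]_n)))) w : S) < (l : nat).+1%:R^-1]
  else set0.
have mD i : measurable (D i).
  rewrite /D; case: (unpickle i) => [[[q j] l]|] //.
  by apply: measurable_mdist_lt_cst; exact: measurable_repr.
have [B dB BP] := ex_generating_bits Pnonatomic mD; exists B => // q j l e e0.
by have := BP (pickle (q, j, l)) e e0; rewrite /D pickleK.
Qed.

(** Continuity is asserted inside the cube and, as closeness to [X], near the
    boundary, where the values of [g] are replaced by those of [X]. *)
Lemma interior_extension : exists g : 'rV[R]_n -> Omega -> borel S,
  [/\ forall t, 0 < depth t -> measurable_fun setT (g t),
      forall t C, 0 < depth t -> measurable C -> pr [set w | C (g t w)] = prob (alpha t) C,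
      forall t0, cube R n t0 -> 0 < depth t0 -> cvg_prob P (within (cube R n) (nbhs t0)) g (g t0) &
      forall e, 0 < e -> exists2 r, 0 < r & forall t, cube R n t -> 0 < depth t -> depth t < r ->
         pr [set w | e <= mdist (g t w : S) (Y t w)] <= e].
Proof.
have [s sP] := @ex_dense_seq R S.
have [B dB mixedP] := ex_bits s.
have [V [W [mVW VW01 VWP]]] := ex_randomizers dB.
pose eps k : R := 2^-1 ^+ k.
have eps0 k : 0 < eps k by rewrite exprn_gt0// invr_gt0.
have /choice[p pP] : forall k, exists p : nat * R * nat * R, [/\ 0 < p.1.1.2, 0 < p.2 &
  forall t, cube R n t -> cube_radius t != 0 -> depth t < p.2 ->
   pr [set w | 4 * eps k <= mdist (level s P B V p.1.1.1 p.1.1.2 (eps k) p.1.2 (alpha t) (Y t) w : S)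
                            (Y t w)] <= 5 * eps k].
  move=> k; have [N [tau [m [r H]]]] :=
    ex_level sP alpha_cvg X_cvg lawX (eps0 k) dB mVW VW01 VWP mixedP.
  by exists (N, tau, m, r).
(* for [N = 0] the level does not depend on [X], which [radial] makes
   discontinuous at the center *)
pose N k := if k is 0%N then 0%N else (p k).1.1.1.
pose tau k := (p k).1.1.2; pose m k := (p k).1.2; pose r k := (p k).2.
have tau0 k : 0 < tau k by have [] := pP k.
have r0 k : 0 < r k by have [] := pP k.
pose z k t := level s P B V (N k) (tau k) (eps k) (m k) (alpha t) (Y t).
have mY t : measurable_fun setT (Y t) by exact: measurable_repr.
have mz k t : measurable_fun setT (z k t).
  exact: (measurable_level sP dB mVW VW01).
(* an index at least [m k] and [m k.+1], so that [Wk k] is independent of the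
   levels [k] and [k.+1] *)
pose Wk k := W (m k + m k.+1)%N.
have mW k : measurable_fun setT (Wk k) by case: (mVW (m k + m k.+1)%N).
have W01 k w : 0 <= Wk k w < 1 by case: (VW01 (m k + m k.+1)%N w).
have unifW k th : 0 <= th <= 1 -> pr [set w | Wk k w < th] = th.
  move=> th01; have [+ _] := @VWP 0%N (m k + m k.+1)%N [::] th erefl (leq0n _) th01.
  by rewrite atom0 setTI expr0 mul1r.
have lawz k t th C : 0 <= th <= 1 -> measurable C ->
    pr ([set w | Wk k w < th] `&` [set w | C (z k t w)]) = th * prob (alpha t) C /\
    pr ([set w | Wk k w < th] `&` [set w | C (z k.+1 t w)]) = th * prob (alpha t) C.
  move=> th01 mC; split.
    by apply: (law_level sP dB mVW VW01 VWP) => //; exact: leq_addr.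
  by apply: (law_level sP dB mVW VW01 VWP) => //; exact: leq_addl.
pose theta := @layer R n r.
pose g := glued z Wk theta.
have th01 k t : 0 <= theta k t <= 1 by exact: layer01.
have act t : 0 < depth t -> exists k, active theta k t by exact: active_layer.
exists g; split.
- by move=> t /act[k kt]; exact: (measurable_glued mz mW W01 kt).
- move=> t C /act[k kt] mC.
  exact: (law_glued mz mW W01 th01 lawz kt mC).
- move=> t0 ct0 d0.
  have cid : t @[t --> within (cube R n) (nbhs t0)] --> t0 by exact: cvg_within.
  have [k0 kt0] := act _ d0.
  have [J [thJ cz]] : exists J, theta J t0 = 0 /\
      forall j, (j <= J)%N -> cvg_prob P (within (cube R n) (nbhs t0)) (z j) (z j t0).
    have cl j : ((0 < N j)%N -> cvg_prob P (within (cube R n) (nbhs t0)) (fun t => Y t) (Y t0)) ->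
        cvg_prob P (within (cube R n) (nbhs t0)) (z j) (z j t0).
      move=> h; apply: (cvg_level sP dB mVW VW01 VWP) => //; exact: alpha_cvg.
    have [rt0|rt0] := eqVneq (cube_radius t0) 0.
      exists 0%N; split; last by move=> j; rewrite leqn0 => /eqP ->; apply: cl.
      apply: layer_eq0 => //; rewrite /depth rt0 mulr0 subr0.
      by rewrite /= ge_min; apply/orP; left; lra.
    exists k0.+1; split; first by case: kt0 => _ _; apply.
    move=> j _; apply: cl => _ e e0.
    by apply: cvg_within; exact: (cvg_prob_radial rt0 e0).
  apply: (cvg_glued mz mW W01 unifW th01 _ (J := J)) => //.
  + by exists k0.
  + have h : \forall t \near within (cube R n) (nbhs t0), 0 < depth t.
      have cd : depth t @[t --> within (cube R n) (nbhs t0)] --> depth t0 by exact: cvg_depth_filter.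
      have /cvgrPdist_lt/(_ _ d0) := cd; apply: filterS => t h.
      by have := ler_norm (depth t0 - depth t); lra.
    by apply: filterS h => t; exact: act.
  + by move=> j; exact: cvg_layer.
- move=> e e0.
  (* two levels with errors at most [5 * eps j0] each *)
  have [|j0 j0e] := @half_expn_lt R (e / 10); first by rewrite divr_gt0.
  exists (threshold r j0.+1); first exact: threshold_gt0.
  move=> t ct dt0 dt.
  have [rt|rt] := eqVneq (cube_radius t) 0.
    move: dt; rewrite /depth rt mulr0 subr0 => h; exfalso.
    have := threshold_half r j0.+1.
    have : 2^-1 ^+ j0.+2 <= (1 : R) by rewrite exprn_ile1// ?invr_ge0// invf_le1// ler1n.
    by lra.
  have [k kt] := act _ dt0.
  apply: (@le_trans _ _ (2 * (5 * eps j0))); last by rewrite /eps; lra.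
  apply: (glued_close mz mW W01 (j0 := j0) (mY t) kt).
    move=> j jj0; apply: layer_eq1 => //; apply: ltW; apply: lt_le_trans dt _.
    exact: threshold_le.
  case=> // j jj0 /= thj.
  have ej : eps j.+1 <= eps j0 by apply: ler_wiXn2l; rewrite ?invr_ge0// ?invf_le1 ?ler1n//; exact: ltnW.
  have [_ _ /(_ t ct rt)] := pP j.+1.
  have dr : depth t < r j.+1.
    by apply: lt_le_trans (threshold_radius _ _); exact: layer_gt0 thj.
  move=> /(_ dr) h; apply: (@le_trans _ _ (5 * eps j.+1)); last by lra.
  apply: le_trans h; apply: le_pr.
  + exact: (measurable_mdist_ge _ (mz j.+1 t) (mY t)).
  + exact: (measurable_mdist_ge _ (mz j.+1 t) (mY t)).
  + by move=> w /= h; apply: le_trans h; move: j0e ej; rewrite /eps; lra.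
Qed.

End interior.

(** * The extension to the whole cube *)

Section extension.
Context (R : realType) (S : polishMetricType R) d (Omega : measurableType d) (P : probability Omega R).
Local Notation pr := (prob P).
Hypothesis Pnonatomic : nonatomic P.
Variables (n : nat) (alpha : 'rV[R]_n -> probability (borel S) R) (X : 'rV[R]_n -> L0 P S).
Local Notation bd := (frontier (cube R n)).
Hypothesis alpha_cvg : forall t0, cube R n t0 ->
  cvg_law (within (cube R n) (nbhs t0)) alpha (alpha t0).
Hypothesis X_cvg : forall x, bd x -> X t @[t --> within bd (nbhs x)] --> X x.
Hypothesis lawX : forall t, bd t -> measure_eq (law (X t)) (alpha t).

Lemma frontier_depth t : cube R n t -> bd t \/ 0 < depth t.
Proof.
move=> /cubeE; rewrite le_eqVlt => /orP[/eqP rt|rt]; first by left; apply/frontier_cubeE.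
by right; rewrite /depth; lra.
Qed.

(** Continuity at a boundary point is obtained by comparing the values at nearby
    points [t] with [X (radial t)]. *)
Lemma L0_extension : exists Z : 'rV[R]_n -> L0 P S,
  [/\ forall t0, cube R n t0 -> Z t @[t --> within (cube R n) (nbhs t0)] --> Z t0,
      forall t, bd t -> Z t = X t
    & forall t, cube R n t -> measure_eq (law (Z t)) (alpha t)].
Proof.
have [g [mg law_g cont_g close_g]] := interior_extension Pnonatomic alpha_cvg X_cvg lawX.
pose z t := if pselect (measurable_fun setT (g t)) is left mf then L0_of P mf else X t.
(* [g t] is known to be measurable only in the interior of the cube *)
have zE t : 0 < depth t -> {ae P, forall w, repr (z t) w = g t w}.
  by move=> /mg mf; rewrite /z; case: pselect => // mf'; exact: repr_L0_of.
have law_z t : 0 < depth t -> measure_eq (law (z t)) (alpha t).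
  move=> dt C mC.
  suff pC : prob (law (z t)) C = prob (alpha t) C.
    by have := prE (law (z t)) mC; rewrite pC -(prE (alpha t) mC).
  rewrite -law_g// /z; case: pselect => [mf|[]]; last exact: mg.
  exact: law_L0_of.
exists (fun t => if pselect (bd t) then X t else z t).
have depth0 t : bd t -> depth t = 0.
  by move=> /frontier_cubeE rt; rewrite /depth rt; lra.
split.
- move=> t0 ct0; apply/cvg_metricP => e e0.
  have cid : t @[t --> within (cube R n) (nbhs t0)] --> t0 by exact: cvg_within.
  have cd : depth t @[t --> within (cube R n) (nbhs t0)] --> depth t0 by exact: cvg_depth_filter.
  case: pselect => bt0; last first.
    have [//|d0] := frontier_depth ct0.
    have h1 : \forall t \near within (cube R n) (nbhs t0), 0 < depth t.
      have /cvgrPdist_lt/(_ _ d0) := cd; apply: filterS => t h.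
      by have := ler_norm (depth t0 - depth t); lra.
    have h2 := cont_g _ ct0 d0 _ e0.
    apply: filterS2 h1 h2 => t dt h.
    case: pselect => [bt|nbt]; first by move: dt; rewrite (depth0 _ bt) ltxx.
    rewrite metric_sym.
    exact: (L0_dist_le_pr (mg _ dt) (mg _ d0) (zE _ dt) (zE _ d0) e0 h).
  have e2 : 0 < e / 2 by rewrite divr_gt0.
  have [r1 r10 r1P] := close_g _ e2.
  have [r2 r20 r2P] := X_radial_near X_cvg bt0 e2.
  have h0 : \forall t \near within (cube R n) (nbhs t0), cube R n t by exact: withinT.
  have h1 : \forall t \near within (cube R n) (nbhs t0), `|depth t0 - depth t| < r1.
    by have /cvgrPdist_lt/(_ _ r10) := cd.
  have h2 : \forall t \near within (cube R n) (nbhs t0), `|t0 - t| < r2.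
    by have /cvgrPdist_lt/(_ _ r20) := cid.
  apply: filterS3 h0 h1 h2 => t ct; rewrite (depth0 _ bt0) sub0r normrN => dt.
  rewrite distrC => tt0.
  have [_ near] := r2P _ tt0.
  case: pselect => [bt|nbt].
    by move: near; rewrite (radial_id bt); lra.
  have [//|dt0] := frontier_depth ct.
  have close := r1P t ct dt0 (le_lt_trans (ler_norm _) dt).
  have zX : mdist (z t) (X (radial t)) <= e / 2.
    apply: (L0_dist_le_pr (mg _ dt0) (measurable_repr (X (radial t))) (zE _ dt0) _ e2 close).
    exact: aeW.
  have := metric_triangle (X t0) (X (radial t)) (z t).
  by rewrite (metric_sym (X (radial t))); lra.
- by move=> t bt; case: pselect.
- move=> t ct; case: pselect => bt; first exact: lawX.
  by have [//|] := frontier_depth ct; exact: law_z.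
Qed.

End extension.

Theorem theorem3 (R : realType) (S : polishMetricType R)
    (d : measure_display) (Omega : measurableType d) (P : probability Omega R)
    (Pcomplete : measure_is_complete P) (Pnonatomic : nonatomic P)
    (n : nat) (n_ge1 : (1 <= n)%N)
    (alpha : 'rV[R]_n -> weakProb S)
    (alpha_continuous : {within cube R n, continuous alpha})
    (X : 'rV[R]_n -> L0 P S)
    (X_continuous : {within frontier (cube R n), continuous X})
    (lawX : forall t, frontier (cube R n) t ->
       measure_eq (law (X t)) (alpha t)) :
  exists alphahat : 'rV[R]_n -> L0 P S,
    [/\ {within cube R n, continuous alphahat},
        forall t, frontier (cube R n) t -> alphahat t = X t
      & forall t, cube R n t -> measure_eq (law (alphahat t)) (alpha t)].
Proof.
have alpha_cvg t0 : cube R n t0 -> cvg_law (within (cube R n) (nbhs t0)) alpha (alpha t0).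
  by move=> ct0; apply: weakProb_cvg; move/subspace_continuousP : alpha_continuous; exact.
have X_cvg x : frontier (cube R n) x -> X t @[t --> within (frontier (cube R n)) (nbhs x)] --> X x.
  by move=> bx; move/subspace_continuousP : X_continuous; exact.
have [Z [cZ ZX lawZ]] := L0_extension Pnonatomic alpha_cvg X_cvg lawX.
by exists Z; split => //; apply/subspace_continuousP.
Qed.
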